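(* Let $G$ be any Grigorchuk group $G_\omega$ ($\omega\in\{\mathbf 0,\mathbf 1,\mathbf 2\}^\infty$) that is a torsion group (for example the first Grigorchuk group $G_{012}$), and let $X$ be an orbit of $G$ on the boundary $\{1,2\}^\infty$ of the binary rooted tree. Let $A$ be a non-trivial finite group, and set $W=A\wr_{X\times X}(G\times G)$, where $G\times G$ acts coordinatewise on $X\times X$. Then: (i) $W$ has exponential word growth; (ii) for every finitely supported probability measure $\mu$ on $W$ (not necessarily symmetric or non-degenerate), the random walk $(W,\mu)$ has trivial Poisson-Furstenberg boundary; (iii) every finitely supported random walk $(W,\mu)$ has zero drift, $\ell(\mu)=0$.
   Context: Grigorchuk groups: for $\omega=(v_1,v_2,\dots)\in\{\mathbf 0,\mathbf 1,\mathbf 2\}^\infty$ let $\omega'=(v_2,v_3,\dots)$. The group $G_\omega$ is the group of automorphisms of the binary rooted tree $\{1,2\}^*$ (acting from the right) generated by $a,b_\omega,c_\omega,d_\omega$, where $a$ exchanges the first letter ($1w\leftrightarrow 2w$), and $b_\omega,c_\omega,d_\omega$ fix the first letter and are defined recursively by: $b_\omega$ acts on the subtree at $2$ as $b_{\omega'}$, and on the subtree at $1$ as $a$ if $v_1\in\{\mathbf 0,\mathbf 1\}$ and trivially if $v_1=\mathbf 2$; $c_\omega$ acts on the subtree at $2$ as $c_{\omega'}$, and on the subtree at $1$ as $a$ if $v_1\in\{\mathbf 0,\mathbf 2\}$ and trivially if $v_1=\mathbf 1$; $d_\omega$ acts on the subtree at $2$ as $d_{\omega'}$, and on the subtree at $1$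 as $a$ if $v_1\in\{\mathbf 1,\mathbf 2\}$ and trivially if $v_1=\mathbf 0$. The first Grigorchuk group $G_{012}$ is the case $\omega=(\mathbf{012})^\infty$; there $b=\langle\!\langle a,c\rangle\!\rangle$, $c=\langle\!\langle a,d\rangle\!\rangle$, $d=\langle\!\langle 1,b\rangle\!\rangle$, where $\langle\!\langle g_1,g_2\rangle\!\rangle$ acts as $g_i$ on the subtree at $i$. Permutational wreath product: for a right action of a group $H$ on a set $Y$, $A\wr_Y H=\left(\sum_Y A\right)\rtimes H$, where $\sum_Y A$ is the group of finitely supported functions $Y\to A$ with $(h\cdot f)(y)=f(yh)$, and $(f_1h_1)(f_2h_2)=f_1(h_1\cdot f_2)h_1h_2$. Exponential word growth: $\lim_n v(n)^{1/n}>1$, where $v(n)$ is the number of elements of word norm at most $n$ for a finite generating set. Drift: $\ell(\mu)=\lim_n L(\mu^{*n})/n$ where $L(\nu)=\sum_g\nu(g)\|g\|_S$ for a word norm $\|\cdot\|_S$ of a finite generating set. The random walk $(W,\mu)$ starts at $1$ and moves from $x$ to $xg$ with probability $\mu(g)$. Its Poisson-Furstenberg boundary is the quotient of the space of infinite trajectories by the measurable hull of the relation $\boldsymbol x\sim\boldsymbol y$ iff there are $N\in\mathbb N$, $k\in\mathbb Z$ with $\boldsymbol x_n=\boldsymbol y_{n+k}$ for all $n\ge N$. Equivalently: $F\colon W\to\mathbb R$ is $\mu$-harmonic if $F(g)=\sum_{h\in W}F(gh)\mu(h)$ for all $g$; the boundary is trivial if and only if every bounded $\mu$-harmonic function is constant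 on the group generated by the support of $\mu$. *)

(* Defs.v *)
From HB Require Import structures.
From mathcomp Require Import all_boot all_order all_fingroup all_algebra.
From mathcomp Require Import finmap.
From mathcomp Require Import all_classical all_reals all_analysis.
From mathcomp Require Import ring lra.

Set Implicit Arguments.
Unset Strict Implicit.
Unset Printing Implicit Defensive.

Import Order.TTheory GRing.Theory Num.Theory.
Import numFieldNormedType.Exports.

Local Open Scope classical_set_scope.
Local Open Scope ring_scope.

Record right_action (H : groupType) (Y : Type) := RightAction {
  ract :> Y -> H -> Y;
  ract1 : forall y, ract y 1%g = y;
  ractM : forall y g h, ract y (g * h)%g = ract (ract y g) h
}.

Definition orbit_of (H : groupType) (Y : Type) (act : right_action H Y) (y0 : Y)
  : set Y := [set act y0 h | h in [set: H]].

Section OrbitAction.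
Variables (H : groupType) (Y : Type) (act : right_action H Y) (y0 : Y).

Fact orbit_act_subproof (y : orbit_of act y0) (h : H) :
  act (\val y) h \in orbit_of act y0.
Proof.
case: y => y /= /set_mem [g _ <-]; apply/mem_set.
by exists (g * h)%g; rewrite // ractM.
Qed.

Definition orbit_act (y : orbit_of act y0) (h : H) : orbit_of act y0 :=
  exist _ (act (\val y) h) (orbit_act_subproof y h).

Fact orbit_act1 y : orbit_act y 1%g = y.
Proof. by apply: val_inj; rewrite /= ract1. Qed.

Fact orbit_actM y g h : orbit_act y (g * h)%g = orbit_act (orbit_act y g) h.
Proof. by apply: val_inj; rewrite /= ractM. Qed.

Definition orbit_action : right_action H (orbit_of act y0) :=
  RightAction orbit_act1 orbit_actM.
End OrbitAction.

Section ProductAction.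
Variables (H1 H2 : groupType) (Y1 Y2 : Type).
Variables (act1 : right_action H1 Y1) (act2 : right_action H2 Y2).

Definition prod_act (y : Y1 * Y2) (h : H1 * H2) : Y1 * Y2 :=
  (act1 y.1 h.1, act2 y.2 h.2).

Fact prod_act1 y : prod_act y 1%g = y.
Proof. by case: y => y1 y2; rewrite /prod_act /= !ract1. Qed.

Fact prod_actM y g h : prod_act y (g * h)%g = prod_act (prod_act y g) h.
Proof. by rewrite /prod_act /= !ractM. Qed.

Definition prod_action : right_action (H1 * H2)%type (Y1 * Y2) :=
  RightAction prod_act1 prod_actM.
End ProductAction.

Definition letters (H : groupType) (S : set H) : set H :=
  [set s | S s \/ S s^-1%g].

Definition has_word (H : groupType) (S : set H) (g : H) (n : nat) : Prop :=
  exists w : seq H, [/\ size w = n, (forall s, s \in w -> letters S s)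
                      & g = (\prod_(s <- w) s)%g].

Definition generated_by (H : groupType) (S : set H) : set H :=
  [set g | exists n, has_word S g n].

Definition finite_generating_set (H : groupType) (S : set H) : Prop :=
  finite_set S /\ generated_by S = [set: H].

(* Least length of a word for [g]; the default 0 is irrelevant as soon as [S]
   generates. *)
Definition word_norm (H : groupType) (S : set H) (g : H) : nat :=
  xget 0%N [set n | has_word S g n /\ forall m, has_word S g m -> (n <= m)%N].

Definition generated_pred (H : groupType) (S : set H) : {pred H} :=
  fun g => `[< generated_by S g >].

Definition generated_type (H : groupType) (S : set H) :=
  {g : H | generated_pred S g}.

HB.instance Definition _ (H : groupType) (S : set H) :=
  SubChoice.on (generated_type S).

Fact generated_group_closed (H : groupType) (S : set H) :
  group_closed (generated_pred S).
Proof.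
split; first by apply/asboolP; exists 0%N, [::]; rewrite big_nil.
move=> x y /asboolP [_ [u [_ uS ->]]] /asboolP [_ [v [_ vS ->]]].
apply/asboolP; pose v' := rev [seq s^-1%g | s <- v].
exists (size (u ++ v')), (u ++ v'); split => //.
  move=> s; rewrite mem_cat mem_rev => /orP [/uS//|/mapP [t /vS tS ->]].
  by case: tS => tS; [right; rewrite invgK|left].
by rewrite big_cat /= /v' -map_rev big_map prodgV revK.
Qed.

HB.instance Definition _ (H : groupType) (S : set H) :=
  SubChoice_isSubGroup.Build H (generated_pred S) (generated_type S)
    (@generated_group_closed H S).

Definition torsion (H : groupType) : Prop :=
  forall g : H, exists n : nat, (0 < n)%N /\ (g ^+ n = 1)%g.

(* The letters 1 and 2 are encoded by [false] and [true]. *)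

Record tree_aut := TreeAut {
  taut :> seq bool -> seq bool;
  taut_bij : bijective taut;
  taut_size : forall w, size (taut w) = size w;
  taut_prefix : forall u w, prefix u w -> prefix (taut u) (taut w)
}.

Lemma tree_autP (g h : tree_aut) : (g : seq bool -> seq bool) =1 h -> g = h.
Proof.
case: g h => [g bg sg pg] [h bh sh ph] /= /funext gh; case: _ / gh in bh sh ph *.
by congr TreeAut; apply: Prop_irrelevance.
Qed.

HB.instance Definition _ := gen_eqMixin tree_aut.
HB.instance Definition _ := gen_choiceMixin tree_aut.

Definition taut_one : tree_aut :=
  @TreeAut id (inv_bij (fun=> erefl)) (fun=> erefl) (fun _ _ => id).

(* The action is on the right: in a product the left factor acts first. *)
Definition taut_mul (g h : tree_aut) : tree_aut :=
  @TreeAut (h \o g) (bij_comp (taut_bij h) (taut_bij g))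
    (fun w => etrans (taut_size h (g w)) (taut_size g w))
    (fun u w uw => taut_prefix h (taut_prefix g uw)).

Definition taut_inv_fun (g : tree_aut) (w : seq bool) : seq bool :=
  xget w [set v | g v = w].

Lemma taut_inv_funK (g : tree_aut) : cancel (taut_inv_fun g) g.
Proof.
move=> w; rewrite /taut_inv_fun; have [h _ gK] := taut_bij g.
by case: xgetP => [v _ //|/(_ (h w))/=]; rewrite gK.
Qed.

Lemma taut_funK (g : tree_aut) : cancel g (taut_inv_fun g).
Proof. by move=> w; apply: (bij_inj (taut_bij g)); rewrite taut_inv_funK. Qed.

Fact taut_inv_size (g : tree_aut) w : size (taut_inv_fun g w) = size w.
Proof. by rewrite -[in RHS](taut_inv_funK g w) taut_size. Qed.

Fact taut_inv_prefix (g : tree_aut) u w :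
  prefix u w -> prefix (taut_inv_fun g u) (taut_inv_fun g w).
Proof.
rewrite !prefixE => /eqP uw; apply/eqP; apply: (bij_inj (taut_bij g)).
rewrite taut_inv_funK -[RHS]uw -[in RHS](taut_inv_funK g w) taut_inv_size.
have := taut_prefix g (prefix_take (taut_inv_fun g w) (size u)).
rewrite prefixE => /eqP <-; congr take.
rewrite taut_size size_takel // taut_inv_size -uw size_take_min geq_minr //.
Qed.

Definition taut_inv (g : tree_aut) : tree_aut :=
  @TreeAut (taut_inv_fun g) (Bijective (taut_inv_funK g) (taut_funK g))
    (taut_inv_size g) (@taut_inv_prefix g).

Fact taut_mulA : associative taut_mul.
Proof. by move=> f g h; exact: tree_autP. Qed.
Fact taut_mul1g : left_id taut_one taut_mul.
Proof. by move=> g; exact: tree_autP. Qed.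
Fact taut_mulg1 : right_id taut_one taut_mul.
Proof. by move=> g; exact: tree_autP. Qed.
Fact taut_mulVg : left_inverse taut_one taut_inv taut_mul.
Proof. by move=> g; apply: tree_autP => w; exact: taut_inv_funK. Qed.
Fact taut_mulgV : right_inverse taut_one taut_inv taut_mul.
Proof. by move=> g; apply: tree_autP => w; exact: taut_funK. Qed.

HB.instance Definition _ := isGroup.Build tree_aut
  taut_mulA taut_mul1g taut_mulg1 taut_mulVg taut_mulgV.

Definition boundary := nat -> bool.

Definition boundary_act (x : boundary) (g : tree_aut) : boundary :=
  fun n => nth false (g (mkseq x n.+1)) n.

Lemma mkseq_boundary_act x (g : tree_aut) n :
  mkseq (boundary_act x g) n = g (mkseq x n).
Proof.
apply: (@eq_from_nth _ false) => [|i]; rewrite size_mkseq ?taut_size ?size_mkseq //.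
move=> lt_in; rewrite nth_mkseq // /boundary_act.
have -> : mkseq x i.+1 = take i.+1 (mkseq x n).
  by rewrite /mkseq -map_take take_iota (minn_idPl lt_in).
have := taut_prefix g (prefix_take (mkseq x n) i.+1).
rewrite prefixE => /eqP <-; rewrite nth_take //.
by rewrite taut_size size_takel // size_mkseq.
Qed.

Fact boundary_act1 x : boundary_act x 1%g = x.
Proof. by apply/funext => n; rewrite /boundary_act nth_mkseq. Qed.

Fact boundary_actM x (g h : tree_aut) :
  boundary_act x (g * h)%g = boundary_act (boundary_act x g) h.
Proof.
by apply/funext => n; rewrite {2}/boundary_act mkseq_boundary_act.
Qed.

Definition flip_fun (w : seq bool) : seq bool :=
  if w is x :: w' then ~~ x :: w' else [::].

(* Fixes the first letter, acts on the subtree at 1 as [flip_fun] if [p] holds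
   of the first symbol of [omega] and trivially otherwise, and on the subtree
   at 2 as the same automorphism for the shifted sequence. *)
Fixpoint spinal_fun (p : pred 'I_3) (omega : nat -> 'I_3) (w : seq bool)
  : seq bool :=
  match w with
  | [::] => [::]
  | false :: w' => false :: (if p (omega 0%N) then flip_fun w' else w')
  | true :: w' => true :: spinal_fun p (fun n => omega n.+1) w'
  end.

Fact flip_funK : involutive flip_fun.
Proof. by case=> //= x w; rewrite negbK. Qed.

Fact size_flip w : size (flip_fun w) = size w. Proof. by case: w. Qed.

Fact prefix_flip u w : prefix u w -> prefix (flip_fun u) (flip_fun w).
Proof.
by case: u w => [|x u] [|y w] //= /andP [/eqP -> ->]; rewrite eqxx.
Qed.

Fact spinal_funK p omega : involutive (spinal_fun p omega).
Proof.
move=> w; elim: w omega => [|[] w IHw] omega //=; first by rewrite IHw.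
by case: (p _) => //; rewrite flip_funK.
Qed.

Fact size_spinal p omega w : size (spinal_fun p omega w) = size w.
Proof.
elim: w omega => [|[] w IHw] omega //=; first by rewrite IHw.
by case: (p _) => //; rewrite size_flip.
Qed.

Fact prefix_spinal p omega u w :
  prefix u w -> prefix (spinal_fun p omega u) (spinal_fun p omega w).
Proof.
elim: u w omega => [|x u IHu] [|y w] omega; rewrite ?prefix0s //.
rewrite prefix_cons => /andP [/eqP <-]; case: x => /= uw.
  exact: IHu.
by case: (p _) => //; exact: prefix_flip.
Qed.

Definition grig_a : tree_aut :=
  TreeAut (inv_bij flip_funK) size_flip prefix_flip.

Definition spinal (p : pred 'I_3) (omega : nat -> 'I_3) : tree_aut :=
  TreeAut (inv_bij (spinal_funK p omega)) (size_spinal p omega)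
    (@prefix_spinal p omega).

Definition grig_b := spinal (fun v => val v \in [:: 0; 1]%N).
Definition grig_c := spinal (fun v => val v \in [:: 0; 2]%N).
Definition grig_d := spinal (fun v => val v \in [:: 1; 2]%N).

Definition grig_gens (omega : nat -> 'I_3) : set tree_aut :=
  [set grig_a; grig_b omega; grig_c omega; grig_d omega].

Definition grigorchuk (omega : nat -> 'I_3) : groupType :=
  generated_type (grig_gens omega).

Definition grig_act omega (x : boundary) (g : grigorchuk omega) : boundary :=
  boundary_act x (\val g).

Fact grig_act1 omega x : grig_act x (1%g : grigorchuk omega) = x.
Proof. exact: boundary_act1. Qed.

Fact grig_actM omega x (g h : grigorchuk omega) :
  grig_act x (g * h)%g = grig_act (grig_act x g) h.
Proof. exact: boundary_actM. Qed.

Definition grig_action (omega : nat -> 'I_3) :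
  right_action (grigorchuk omega) boundary :=
  RightAction (@grig_act1 omega) (@grig_actM omega).

Record finsupp_fun (Y : Type) (A : groupType) := FinsuppFun {
  fsf :> Y -> A;
  fsfP : finite_set [set y | fsf y <> 1%g]
}.

Lemma finsupp_funP (Y : Type) (A : groupType) (f1 f2 : finsupp_fun Y A) :
  (f1 : Y -> A) =1 f2 -> f1 = f2.
Proof.
case: f1 f2 => [f1 fin1] [f2 fin2] /= /funext f12.
by case: _ / f12 in fin2 *; congr FinsuppFun; apply: Prop_irrelevance.
Qed.

(* [Wreath act f h] is the element [f h] of the semidirect product. *)
Record wreath (A H : groupType) (Y : Type) (act : right_action H Y) := Wreath {
  wbase : finsupp_fun Y A;
  wtop : H
}.

HB.instance Definition _ A H Y (act : right_action H Y) :=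
  gen_eqMixin (wreath A act).
HB.instance Definition _ A H Y (act : right_action H Y) :=
  gen_choiceMixin (wreath A act).

Section Wreath.
Variables (A H : groupType) (Y : Type) (act : right_action H Y).
Local Notation W := (wreath A act).
Implicit Types u v : W.

Lemma wreathP u v : wbase u =1 wbase v -> wtop u = wtop v -> u = v.
Proof. by case: u v => [f g] [f' g'] /= /finsupp_funP -> ->. Qed.

Fact wreath_one_fin : finite_set [set y : Y | (1 : A)%g <> 1%g].
Proof. by apply: (sub_finite_set _ (finite_set0 Y)) => y /=. Qed.

Definition wreath_one : W := Wreath act (FinsuppFun wreath_one_fin) 1%g.

Lemma translate_fin (f : finsupp_fun Y A) (h : H) :
  finite_set [set y | f (act y h) <> 1%g].
Proof.
apply: (sub_finite_set _ (finite_image (fun y => act y h^-1%g) (fsfP f))).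
by move=> y /= fy; exists (act y h); rewrite // -ractM mulgV ract1.
Qed.

Fact wreath_mul_fin u v :
  finite_set [set y | (wbase u y * wbase v (act y (wtop u)) <> 1)%g].
Proof.
have uvfin : finite_set ([set y | wbase u y <> 1%g] `|`
                         [set y | wbase v (act y (wtop u)) <> 1%g]).
  by rewrite finite_setU; split; [exact: fsfP|exact: translate_fin].
apply: (sub_finite_set _ uvfin) => y /= uvy.
apply/not_andP => -[uy vy]; apply: uvy.
by rewrite uy vy mulg1.
Qed.

Definition wreath_mul u v : W :=
  Wreath act (FinsuppFun (wreath_mul_fin u v)) (wtop u * wtop v)%g.

Fact wreath_inv_fin u :
  finite_set [set y | ((wbase u (act y (wtop u)^-1))^-1 <> 1)%g].
Proof.
apply: (sub_finite_set _ (translate_fin (wbase u) (wtop u)^-1%g)) => y /=.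
by apply: contra_not => ->; rewrite invg1.
Qed.

Definition wreath_inv u : W :=
  Wreath act (FinsuppFun (wreath_inv_fin u)) (wtop u)^-1%g.

Fact wreath_mulA : associative wreath_mul.
Proof.
by move=> u v w; apply: wreathP => [y|] /=; rewrite ?ractM mulgA.
Qed.
Fact wreath_mul1g : left_id wreath_one wreath_mul.
Proof. by move=> u; apply: wreathP => [y|] /=; rewrite mul1g ?ract1. Qed.
Fact wreath_mulg1 : right_id wreath_one wreath_mul.
Proof. by move=> u; apply: wreathP => [y|] /=; rewrite mulg1. Qed.
Fact wreath_mulVg : left_inverse wreath_one wreath_inv wreath_mul.
Proof. by move=> u; apply: wreathP => [y|] /=; rewrite mulVg. Qed.
Fact wreath_mulgV : right_inverse wreath_one wreath_inv wreath_mul.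
Proof.
by move=> u; apply: wreathP => [y|] /=; rewrite -?ractM mulgV ?ract1 ?mulgV.
Qed.

HB.instance Definition _ := isGroup.Build W
  wreath_mulA wreath_mul1g wreath_mulg1 wreath_mulVg wreath_mulgV.
End Wreath.

Definition ball_card (H : groupType) (S : set H) (n : nat) : nat :=
  #|` fset_set [set g | (word_norm S g <= n)%N] |.

Definition exponential_word_growth (R : realType) (H : groupType) : Prop :=
  (exists S : set H, finite_generating_set S) /\
  (forall S : set H, finite_generating_set S ->
     exists2 l : R, 1 < l &
       (ball_card S n)%:R `^ n%:R^-1 @[n --> \oo] --> l).

Definition finsupp_probability (R : realType) (H : groupType) (mu : H -> R)
  : Prop :=
  [/\ finite_set [set g | mu g <> 0], (forall g, 0 <= mu g)
    & \sum_(g \in [set: H]) mu g = 1].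

Definition convolution (R : realType) (H : groupType) (mu nu : H -> R)
  : H -> R := fun g => \sum_(h \in [set: H]) mu h * nu (h^-1 * g)%g.

Definition convolution_pow (R : realType) (H : groupType) (mu : H -> R)
    (n : nat) : H -> R :=
  iter n (convolution mu) (fun g => (g == 1%g)%:R).

Definition mean_norm (R : realType) (H : groupType) (S : set H) (nu : H -> R)
  : R := \sum_(g \in [set: H]) nu g * (word_norm S g)%:R.

Definition has_drift (R : realType) (H : groupType) (S : set H) (mu : H -> R)
    (l : R) : Prop :=
  mean_norm S (convolution_pow mu n) / n%:R @[n --> \oo] --> l.

Definition path_space (H : groupType) := nat -> H.

HB.instance Definition _ (H : groupType) := gen_eqMixin (path_space H).
HB.instance Definition _ (H : groupType) := gen_choiceMixin (path_space H).
HB.instance Definition _ (H : groupType) :=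
  isPointed.Build (path_space H) (fun=> 1%g).

(* The product of the discrete sigma-algebras. *)
Definition path_events (H : groupType) : set (set (path_space H)) :=
  [set E | exists n (B : set H), E = [set x | B (x n)]].

Definition trajectories (H : groupType) :=
  g_sigma_algebraType (@path_events H).

(* Law of the walk started at 1 that moves from [x] to [x g] with
   probability [mu g]. *)
Definition walk_law (R : realType) (H : groupType) (mu : H -> R)
    (P : probability (trajectories H) R) : Prop :=
  forall (n : nat) (g : nat -> H),
    P [set x | forall i, (i <= n)%N -> x i = g i] =
    ((g 0%N == 1%g)%:R * \prod_(i < n) mu ((g i)^-1 * g i.+1)%g)%:E.

Definition asymptotic_equiv (H : groupType) (x y : path_space H) : Prop :=
  exists (N : nat) (k : int), forall n m : nat,
    (N <= n)%N -> m%:Z = n%:Z + k -> x n = y m.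

(* A set of trajectories is measurable in the quotient by the measurable hull
   of [asymptotic_equiv] iff it is measurable and saturated. *)
Definition saturated (H : groupType) (E : set (path_space H)) : Prop :=
  forall x y, asymptotic_equiv x y -> E x -> E y.

(* The quotient probability space is trivial, i.e. its events have probability
   0 or 1. *)
Definition trivial_boundary (R : realType) (H : groupType) (mu : H -> R)
  : Prop :=
  forall P : probability (trajectories H) R, walk_law mu P ->
  forall E : set (trajectories H), measurable E -> saturated E ->
    P E = 0%:E \/ P E = 1%:E.

(* [trivial_boundary] quantifies over all laws of the walk; such a law exists, as
   the image of Lebesgue measure on [0, 1[ under iterated expansion in the
   weights of [mu]. *)

Section WalkLawExists.
Variables (R : realType) (H : groupType) (mu : H -> R).

Fixpoint walk_step (s : seq H) (u : R) : H * R :=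
  if s is g :: s' then
    if u < mu g then (g, u / mu g) else walk_step s' (u - mu g)
  else (1%g, 0).

Definition walk_incr (s : seq H) (u : R) (i : nat) : H :=
  (walk_step s (iter i (fun v => (walk_step s v).2) u)).1.

Definition walk_path (s : seq H) (u : R) : trajectories H :=
  if 0 <= u < 1 then fun n => (\prod_(i < n) walk_incr s u i)%g
  else fun=> 1%g.

Hypothesis mu_ge0 : forall g, 0 <= mu g.

Lemma walk_step_bounds s u : 0 <= u < \sum_(g <- s) mu g ->
  ((walk_step s u).1 \in s) && (0 <= (walk_step s u).2 < 1).
Proof.
elim: s u => [|g s IHs] u; first by rewrite big_nil; lra.
rewrite big_cons /= => u_lt; case: ltP => u_g /=.
  rewrite in_cons eqxx /=; have mug : 0 < mu g by lra.
  by rewrite divr_ge0 ?ltr_pdivrMr ?mul1r; lra.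
have /IHs : 0 <= u - mu g < \sum_(g <- s) mu g by lra.
by rewrite in_cons => /andP [-> ->]; rewrite orbT.
Qed.

Lemma walk_step_itv s h a b : uniq s -> 0 <= a -> a <= b -> b <= 1 ->
  exists c d : R, [/\ 0 <= c, c <= d, d <= \sum_(g <- s) mu g,
    d - c = (b - a) * (if h \in s then mu h else 0)
    & forall u, 0 <= u < \sum_(g <- s) mu g ->
      ((walk_step s u).1 == h) && (a <= (walk_step s u).2 < b) =
      (c <= u < d)].
Proof.
move=> us a0 ab b1; elim: s us => [|g s IHs] /=.
  move=> _; exists 0, 0; rewrite big_nil; split => //; first by rewrite mulr0 subr0.
  by move=> u; lra.
case/andP => gs /IHs [c [d [c0 cd d1 dcE cdP]]]; rewrite big_cons in_cons.
have mug := mu_ge0 g; have [->|hg] /= := eqVneq h g.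
  have mua := ler_wpM2l mug ab; have mub := ler_wpM2l mug b1.
  have mua0 := mulr_ge0 mug a0.
  have s0 : 0 <= \sum_(g <- s) mu g by apply: sumr_ge0.
  exists (mu g * a), (mu g * b); split; [lra|lra|lra|ring|].
  move=> u u_lt; case: ltP => u_g /=.
    have mug' : 0 < mu g by lra.
    by rewrite eqxx /= ler_pdivlMr // ltr_pdivrMr // ![_ * mu g]mulrC.
  have /walk_step_bounds/andP[ins _] :
    0 <= u - mu g < \sum_(g <- s) mu g by lra.
  have -> : ((walk_step s (u - mu g)).1 == g) = false.
    by apply: contraNF gs => /eqP <-.
  by rewrite /=; lra.
exists (mu g + c), (mu g + d); split; [lra|lra|lra| |].
  by rewrite -dcE; ring.
move=> u u_lt; case: ltP => u_g /=.
  by rewrite eq_sym (negPf hg) /=; lra.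
by rewrite cdP; lra.
Qed.

Variable s : seq H.
Hypotheses (s_uniq : uniq s) (s_sum : \sum_(g <- s) mu g = 1).
Hypothesis s_supp : forall g, g \notin s -> mu g = 0.

Lemma walk_incr_itv n (h : nat -> H) : exists c d : R,
  [/\ 0 <= c, c <= d, d <= 1, d - c = \prod_(i < n) mu (h i)
    & forall u, 0 <= u < 1 ->
      (forall i, (i < n)%N -> walk_incr s u i = h i) <-> c <= u < d].
Proof.
elim: n h => [|n IHn] h.
  exists 0, 1; rewrite big_ord0; split => //; first by lra.
have [a [b [a0 ab b1 baE abP]]] := IHn (fun i => h i.+1).
have [c [d []]] := @walk_step_itv s (h 0%N) a b s_uniq a0 ab b1.
rewrite s_sum => c0 cd d1 dcE cdP; exists c, d; split => //.
  rewrite dcE big_ord_recl baE mulrC; congr (_ * _).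
  by case: ifPn => // /s_supp.
move=> u u01; rewrite -cdP //.
have v01 : 0 <= (walk_step s u).2 < 1.
  by have := @walk_step_bounds s u; rewrite s_sum => /(_ u01) /andP[].
split.
  move=> hu; rewrite -[X in X == _]/(walk_incr s u 0) hu // eqxx /=.
  by apply/(abP _ v01) => i i_lt; rewrite -(hu i.+1) // /walk_incr iterSr.
case/andP => /eqP h0 /(abP _ v01) hu [|i] i_lt //.
by rewrite -hu // /walk_incr iterSr.
Qed.

Definition walk_event n (h : nat -> H) : set R :=
  [set u | 0 <= u < 1 /\ forall i, (i < n)%N -> walk_incr s u i = h i].

Lemma walk_event_itv n (h : nat -> H) : exists c d : R,
  [/\ 0 <= c, c <= d, d <= 1, d - c = \prod_(i < n) mu (h i)
    & walk_event n h = `[c, d[%classic].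
Proof.
have [c [d [c0 cd d1 dcE cdP]]] := walk_incr_itv n h.
exists c, d; split => //; apply/seteqP; split => u /=; rewrite in_itv /=.
  by case=> u01 /(cdP _ u01).
by move=> cud; have u01 : 0 <= u < 1 by [lra]; split => //; apply/cdP.
Qed.

Let I01 : set (measurableTypeR R) := `[0, 1[%classic.
Let mI01 : measurable I01. Proof. exact: measurable_itv. Qed.

Lemma measurable_walk_path :
  measurable_fun setT (walk_path s : measurableTypeR R -> trajectories H).
Proof.
apply: (measurability (rT := trajectories H) (aT := measurableTypeR R) (@path_events H)) => //.
move=> _ [_ [n [B ->]] <-]; rewrite setTI.
pose F (w : n.-tuple (seq_sub s)) : set (measurableTypeR R) :=
  [set u | walk_event n (fun i => nth 1%g (map val w) i) u /\
           B (\prod_(h <- map val w) h)%g].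
have prodE u (w : n.-tuple (seq_sub s)) :
    walk_event n (fun i => nth 1%g (map val w) i) u ->
    (\prod_(h <- map val w) h = \prod_(i < n) walk_incr s u i)%g.
  case=> _ hu; rewrite (big_nth 1%g) size_map size_tuple big_mkord.
  by apply: eq_bigr => i _; rewrite hu.
have -> : walk_path s @^-1` [set x | B (x n)] =
          (\bigcup_w F w) `|` [set u | ~ I01 u /\ B 1%g].
  apply/seteqP; split => u /=; rewrite /walk_path /I01 /= in_itv /=.
    case: ifP => u01 Bu; last by right.
    left.
    have incr_in i : walk_incr s u i \in s.
      have v01 : 0 <= iter i (fun v => (walk_step s v).2) u < 1.
        elim: i => //= i IHi.
        by have := @walk_step_bounds s; rewrite s_sum => /(_ _ IHi) /andP[].
      by have := @walk_step_bounds s; rewrite s_sum => /(_ _ v01) /andP[].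
    pose w := [tuple (SeqSub (incr_in i) : seq_sub s) | i < n].
    have wE : map val w = [seq walk_incr s u (val i) | i <- enum 'I_n].
      by rewrite /w /= -map_comp.
    have uw : walk_event n (fun i => nth 1%g (map val w) i) u.
      split => // i i_lt.
      rewrite wE (nth_map (Ordinal i_lt)) ?size_enum_ord //.
      by congr walk_incr; exact/esym/(nth_enum_ord (Ordinal i_lt) i_lt).
    by exists w => //; split; rewrite ?(prodE u).
  case=> [[w _ [[u01 hu] Bw]]|[u01 B1]]; last by move/negP/negPf: u01 => ->.
  by rewrite u01 -(prodE u w) //; split.
apply: measurableU.
  apply: fin_bigcup_measurable => [|w _]; first exact: finite_finset.
  have [c [d [_ _ _ _ E]]] := walk_event_itv n (fun i => nth 1%g (map val w) i).
  rewrite /F; have [Bw|Bw] := pselect (B (\prod_(h <- map val w) h)%g).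
    have -> : [set u | walk_event n (fun i => nth 1%g (map val w) i) u /\
           B (\prod_(h <- map val w) h)%g] = `[c, d[%classic.
      by rewrite -E; apply/seteqP; split => u //= [].
    exact: measurable_itv.
  rewrite (_ : [set u | _] = set0) //; apply/seteqP.
  by split => u //= [].
have [B1|B1] := pselect (B 1%g).
  rewrite (_ : [set u | _] = ~` I01); first exact: measurableC.
  by apply/seteqP; split => u //= [].
rewrite (_ : [set u | _] = set0) //; apply/seteqP.
by split => u //= [].
Qed.

End WalkLawExists.

Section UnitProbability.
Variable R : realType.

Fact measurable_unit_itv :
  measurable (`[0, 1[%classic : set (measurableTypeR R)).
Proof. exact: measurable_itv. Qed.

Definition unit_prob : set (measurableTypeR R) -> \bar R :=
  mrestr (@lebesgue_measure R) measurable_unit_itv.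

HB.instance Definition _ := Measure.on unit_prob.

Fact unit_prob_setT : unit_prob setT = 1%:E.
Proof.
rewrite /unit_prob /mrestr setTI lebesgue_measure_itv /= lte_fin ltr01.
by rewrite oppr0 adde0.
Qed.

HB.instance Definition _ :=
  Measure_isProbability.Build _ _ R unit_prob unit_prob_setT.

Lemma unit_prob_itv (c d : R) : 0 <= c -> c <= d -> d <= 1 ->
  unit_prob `[c, d[%classic = (d - c)%:E.
Proof.
move=> c0 cd d1; rewrite /unit_prob /mrestr setIidl; last first.
  by move=> u /=; rewrite !in_itv /=; lra.
rewrite lebesgue_measure_itv /= lte_fin; case: ltP => // dc.
by have -> : d = c by [lra]; rewrite subrr.
Qed.
End UnitProbability.

Lemma walk_law_exists (R : realType) (H : groupType) (mu : H -> R) :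
  finsupp_probability mu ->
  exists P : probability (trajectories H) R, walk_law mu P.
Proof.
case=> mu_fin mu_ge0 mu1.
pose s : seq H := fset_set [set g | mu g <> 0].
have s_uniq : uniq s by exact: fset_uniq.
have s_supp g : g \notin s -> mu g = 0.
  move=> gs; apply: contrapT => mug; move/negP: gs; apply.
  by rewrite /s in_fset_set // mem_set.
have s_sum : \sum_(g <- s) mu g = 1 by rewrite -mu1; symmetry; exact: fsbigTE.
have mX := measurable_walk_path mu_ge0 s_uniq s_sum s_supp.
pose X_mixin := isMeasurableFun.Build _ _ _ _ _ mX.
pose X : {mfun measurableTypeR R >-> trajectories H} :=
  HB.pack (walk_path mu s : measurableTypeR R -> trajectories H) X_mixin.
exists (distribution (@unit_prob R) X) => n g.
have [c [d [c0 cd d1 dcE cdP]]] := walk_event_itv mu_ge0 s_uniq s_sum s_supp n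
  (fun i => (g i)^-1 * g i.+1)%g.
transitivity (unit_prob [set u | g 0%N = 1%g /\ `[c, d[%classic u]); last first.
  have [g0|g0] := eqVneq (g 0%N) 1%g; last first.
    rewrite mul0r (_ : [set u | _] = set0) ?measure0 //.
    by apply/seteqP; split => u //= [/eqP]; rewrite (negPf g0).
  rewrite mul1r -dcE -unit_prob_itv //; congr unit_prob.
  by apply/seteqP; split => u //= [].
rewrite -cdP /distribution /pushforward /= /unit_prob /mrestr.
congr lebesgue_measure; apply/seteqP; split => u /=; rewrite in_itv /=.
  case=> xg u01; move: xg; rewrite /walk_path u01 => xg.
  split=> //; split; first by rewrite -(xg 0%N) // big_ord0.
  split=> // i i_lt; rewrite -(xg i) ?(ltnW i_lt) // -(xg i.+1) //.
  by rewrite big_ord_recr /= mulKg.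
case=> [[g0 [_ hu]]] u01; rewrite /walk_path u01; split=> //.
elim=> [|i IHi] i_lt; first by rewrite big_ord0.
by rewrite big_ord_recr /= IHi ?(ltnW i_lt) // hu // mulVKg.
Qed.

(* Main.v *)
Require Import Defs.
From mathcomp Require Import all_boot all_order all_fingroup all_algebra.
From mathcomp Require Import finmap.
From mathcomp Require Import all_classical all_reals all_analysis.
From mathcomp Require Import ring lra zify.

Set Implicit Arguments.
Unset Strict Implicit.
Unset Printing Implicit Defensive.

Import Order.TTheory GRing.Theory Num.Theory.
Import numFieldNormedType.Exports.

Local Open Scope classical_set_scope.
Local Open Scope ring_scope.

(** The orbits of [G] look like lines and [G] grows subexponentially, so the action on
    [X * X] is planar: a random walk that moves by elements of finite order is
    recurrent there, while the group is still large enough for a cleverly chosen path of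
    length [n] to visit about [n] points and to light lamps at each of them.

    Growth. The words [aword (mixing_word omega l bits)] are short ([O(3 ^ k)] letters
    for [2 ^ k] of them) and no two of them move any point of the boundary to the same
    place ([mixing_elt_inj]). A translate of a finite set of points by a random one of
    them is therefore nearly disjoint from the set ([small_overlap]). Starting from a
    point and doubling repeatedly, one gets paths of length [L] whose inverted orbits
    have size proportional to [L], hence [2 ^ (c * L)] lamp configurations in the ball of
    radius [L] ([linear_configurations], [exponential_growth]).

    Entropy. Torsion of [G] makes every symbol occur infinitely often in [omega]
    ([torsion_recurring]): otherwise some [a * x] has infinite order, by passing to
    sections. Recurrence of the symbols makes words contract by 2 / 3 under the
    decomposition into sections, so [G] and [G * G] have subexponential growth
    ([words_subexponential]). Torsion also splits the transitions of the walk induced on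
    [X * X] into finite cycles, which bounds its antisymmetric part by its Dirichlet form
    ([sector_condition]); with the logarithmic cutoffs of a plane, the walk is recurrent,
    without any symmetry ([green_unbounded]). The position of the walk on the wreath
    product at time [n] is determined by its moves between the times at which some lamp
    position is visited for the last time. By recurrence these times have density 0,
    and by subexponential growth the moves between them cost [o(n)] bits. So the entropy
    of the [n]-th convolution power is [o(n)] ([wreath_zero_entropy]).

    Consequences of zero entropy. The increment of the entropy is a mean divergence, so
    that, for most [n], the law of [x * w_n] is close to that of [w_(n+1)] for each
    step [x] ([step_dist_null]). Hence bounded harmonic functions are constant along the
    walk ([bounded_harmonic_const]); the probability of a saturated event as a function
    of the starting point is one, so the event is independent of all cylinders and has
    probability 0 or 1 ([saturated_zero_one]). For the drift, the mean gain of norm due to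
    a first step [x] is asymptotically invariant under translation by [x]; as [x] has
    finite order, it averages over a cycle, where it telescopes to 0 ([gain_null],
    [zero_drift]). *)

(** * Words in the generators of a Grigorchuk group *)

(** [None] stands for the root flip [a]; [Some i] stands for the spinal generator
    whose section at the letter 1 is trivial exactly at the symbol [i], that is
    [d], [c], [b] for [i] = 0, 1, 2. *)
Definition letter := option 'I_3.

Definition oshift (omega : nat -> 'I_3) : nat -> 'I_3 := fun n => omega n.+1.

Definition lact (omega : nat -> 'I_3) (l : letter) : seq bool -> seq bool :=
  if l is Some i then spinal_fun (fun v => v != i) omega else flip_fun.

Definition wact (omega : nat -> 'I_3) (w : seq letter) (u : seq bool) :=
  foldl (fun u l => lact omega l u) u w.

Fixpoint sect (v : 'I_3) (w : seq letter) (e : bool) : seq letter :=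
  match w with
  | [::] => [::]
  | None :: w' => sect v w' (~~ e)
  | Some i :: w' =>
      if e then Some i :: sect v w' e
      else if v != i then None :: sect v w' e else sect v w' e
  end.

Definition flips (w : seq letter) : bool := odd (count (pred1 None) w).

Lemma wact_cons omega w e u :
  wact omega w (e :: u) =
  (e (+) flips w) :: wact (oshift omega) (sect (omega 0%N) w e) u.
Proof.
rewrite /flips; elim: w e u => [|[i|] w IHw] e u /=; first by rewrite addbF.
  by case: e => /=; rewrite IHw //=; case: (_ != i) => //=; case: u.
by rewrite IHw /=; congr (_ :: _); case: e; case: odd.
Qed.

Lemma wact_cat omega w1 w2 u : wact omega (w1 ++ w2) u = wact omega w2 (wact omega w1 u).
Proof. by rewrite /wact foldl_cat. Qed.

Lemma wact_nil omega w : wact omega w [::] = [::].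
Proof. by elim: w => //= -[i|] w. Qed.

(** The spinal generators form a Klein four-group. *)
Definition third (i j : 'I_3) : 'I_3 := inord (3 - (i + j)).

Lemma third_neq (v i j : 'I_3) : i != j -> (v != third i j) = (v != i) (+) (v != j).
Proof.
rewrite /third -!val_eqE /= => ij; rewrite inordK.
  by case: v i j ij => [[|[|[|v]]] ?] [[|[|[|i]]] ?] [[|[|[|j]]] ?].
by case: i j ij => [[|[|[|i]]] ?] [[|[|[|j]]] ?].
Qed.

Lemma spinal_third omega (i j : 'I_3) u : i != j ->
  spinal_fun (fun v => v != j) omega (spinal_fun (fun v => v != i) omega u) =
  spinal_fun (fun v => v != third i j) omega u.
Proof.
move=> ij; elim: u omega => [|[] u IHu] omega //=; first by rewrite IHu.
by rewrite (third_neq _ ij); case: (_ != i); case: (_ != j) => //=;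
  rewrite flip_funK.
Qed.

Definition push (l : letter) (w : seq letter) : seq letter :=
  match l, w with
  | None, None :: w' => w'
  | Some i, Some j :: w' => if i == j then w' else Some (third i j) :: w'
  | _, _ => l :: w
  end.

Definition red (w : seq letter) : seq letter := foldr push [::] w.

Lemma wact_push omega l w u : wact omega (push l w) u = wact omega (l :: w) u.
Proof.
case: l w => [i|] [|[j|] w] //=; last by rewrite flip_funK.
case: eqP => [->|/eqP ij]; first by rewrite spinal_funK.
by rewrite /= -spinal_third.
Qed.

Lemma wact_red omega w u : wact omega (red w) u = wact omega w u.
Proof. by elim: w u => //= l w IHw u; rewrite wact_push /= IHw. Qed.

Definition na (w : seq letter) := count (pred1 None) w.
Definition ns (w : seq letter) := count (predC1 None) w.
Definition no (i : 'I_3) (w : seq letter) := count (fun l => (l != None) && (l != Some i)) w.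

Lemma sum_no w : (\sum_(i < 3) no i w = 2 * ns w)%N.
Proof.
elim: w => [|l w IHw]; first by rewrite big1.
rewrite /no /ns /= big_split /= -/(ns w) mulnDr; congr (_ + _)%N; last exact: IHw.
rewrite !big_ord_recl big_ord0; case: l => [[[|[|[|]]] ?]|] //=.
Qed.

Lemma no_push i l w : (no i (push l w) <= no i (l :: w))%N.
Proof.
rewrite /no; case: l w => [j|] [|[k|] w] //=.
case: eqP => [->|/eqP jk] /=; first by lia.
rewrite addnA leq_add2r.
have := third_neq i jk; rewrite !(inj_eq Some_inj) ![_ == i]eq_sym.
by case: (i == j); case: (i == k); case: (_ == third _ _).
Qed.

Lemma na_push l w : (na (push l w) <= na (l :: w))%N.
Proof.
rewrite /na; case: l w => [j|] [|[k|] w] //=; last by lia.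
by case: eqP.
Qed.

Lemma no_red i w : (no i (red w) <= no i w)%N.
Proof.
elim: w => //= l w IHw; apply: leq_trans (no_push _ _ _) _.
by rewrite /no /= leq_add2l.
Qed.

Lemma na_red w : (na (red w) <= na w)%N.
Proof.
elim: w => //= l w IHw; apply: leq_trans (na_push _ _) _.
by rewrite /na /= leq_add2l.
Qed.

Definition alternating (w : seq letter) := sorted (fun l l' : letter => isSome l != isSome l') w.

Lemma alternating_push l w : alternating w -> alternating (push l w).
Proof.
case: l w => [i|] [|[j|] w] //=; last by move/path_sorted.
by case: eqP => _ //=; [move/path_sorted | case: w].
Qed.

Lemma alternating_red w : alternating (red w).
Proof. by elim: w => //= l w /alternating_push. Qed.

Lemma alternating_count w : alternating w ->
  (ns w <= (na w).+1)%N /\ (na w <= (ns w).+1)%N.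
Proof.
move=> aw.
suff : if w is l :: _ then if l is Some _ then (na w <= ns w <= (na w).+1)%N
       else (ns w <= na w <= (ns w).+1)%N else true.
  by case: w {aw} => // -[i|] w /andP[]; lia.
rewrite /na /ns; elim: w aw => // l w IHw aw.
have {}IHw := IHw (path_sorted aw).
by case: w l IHw aw => [|[j|] w] [i|] //=; lia.
Qed.

Lemma ns_red w : (ns (red w) <= ns w)%N.
Proof.
have : (\sum_(i < 3) no i (red w) <= \sum_(i < 3) no i w)%N.
  by apply: leq_sum => i _; exact: no_red.
by rewrite !sum_no leq_pmul2l.
Qed.

Lemma ns_red_na w : (ns (red w) <= (na w).+1)%N.
Proof.
have [h _] := alternating_count (alternating_red w).
by apply: leq_trans h _; rewrite ltnS na_red.
Qed.

Lemma size_red w : (size (red w) <= (ns (red w)).*2.+1)%N.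
Proof.
have [_ h] := alternating_count (alternating_red w).
by rewrite -(count_predC (pred1 None) (red w)) -/(na _) -/(ns _); lia.
Qed.

(** Each spinal letter of a word is handed down to exactly one of the two
    sections, and to the other one as an [a] unless it is killed. *)
Lemma no_sect i v w e : (no i (sect v w e) + no i (sect v w (~~ e)) = no i w)%N.
Proof.
elim: w e => [|[j|] w IHw] e //; last exact: (IHw (~~ e)).
have := IHw e; rewrite /no.
by case: e => /=; case: (v != j) => /=; lia.
Qed.

Lemma ns_sect v w e : (ns (sect v w e) + ns (sect v w (~~ e)) = ns w)%N.
Proof.
have : (\sum_(i < 3) (no i (sect v w e) + no i (sect v w (~~ e))) = \sum_(i < 3) no i w)%N.
  by apply: eq_bigr => i _; exact: no_sect.
by rewrite big_split /= !sum_no; lia.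
Qed.

Lemma na_sect v w e : (na (sect v w e) + na (sect v w (~~ e)) = no v w)%N.
Proof.
elim: w e => [|[j|] w IHw] e //.
  have := IHw e; rewrite /no /na /= (inj_eq Some_inj) (eq_sym j).
  by case: e; rewrite /=; case: (v == j) => /=; lia.
exact: (IHw (~~ e)).
Qed.

(** * Subexponential growth of Grigorchuk groups *)

Definition recurring (omega : nat -> 'I_3) :=
  forall v N, exists2 n, (N <= n)%N & omega n = v.

(** Depth-[k] description of the automorphism of a word, as a string that can be
    parsed from the left: the root flip and the descriptions of the two sections,
    down to reduced words, each closed by [None], at depth [k]. *)
Fixpoint key k omega (w : seq letter) : seq (option letter) :=
  if k is k'.+1 then
    (if flips (red w) then Some None else None)
      :: key k' (oshift omega) (sect (omega 0%N) (red w) false)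
      ++ key k' (oshift omega) (sect (omega 0%N) (red w) true)
  else rcons (map Some (red w)) None.

Fixpoint cost k omega (w : seq letter) : nat :=
  if k is k'.+1 then
    (cost k' (oshift omega) (sect (omega 0%N) (red w) false)
     + cost k' (oshift omega) (sect (omega 0%N) (red w) true))%N
  else ns (red w).

Lemma key_parse k omega w1 w2 s1 s2 :
  key k omega w1 ++ s1 = key k omega w2 ++ s2 ->
  wact omega w1 =1 wact omega w2 /\ s1 = s2.
Proof.
elim: k omega w1 w2 s1 s2 => [|k IHk] omega w1 w2 s1 s2 /=.
  rewrite !cat_rcons => eq12; suff [r12 ->] : red w1 = red w2 /\ s1 = s2.
    by split => // u; rewrite -wact_red r12 wact_red.
  elim: (red w1) (red w2) eq12 => [|l1 r1 IHr] [|l2 r2] //= [] //.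
  by move=> -> /IHr [-> ->].
case=> eqf; rewrite -!catA => /IHk[eq0 /IHk[eq1 ->]]; split=> // -[|e u].
  by rewrite !wact_nil.
rewrite -wact_red -[RHS]wact_red !wact_cons.
have -> : flips (red w1) = flips (red w2).
  by move: eqf; case: (flips (red w1)); case: (flips (red w2)).
by case: e; rewrite ?eq0 ?eq1.
Qed.

Lemma cost_le_ns k omega w : (cost k omega w <= ns (red w))%N.
Proof.
elim: k omega w => [|k IHk] omega w //=.
rewrite -(ns_sect (omega 0%N) (red w) false).
by apply: leq_add; apply: leq_trans (IHk _ _) (ns_red _).
Qed.

(** At the level of a symbol [v], reduced sections have at most one spinal letter
    more than they have [a]s, and only the letters other than [Some v] produce
    [a]s. *)
Lemma cost_le_no k omega w v n : (n < k)%N -> omega n = v ->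
  (cost k omega w <= no v (red w) + 2 ^ k)%N.
Proof.
elim: k omega w n => [|k IHk] omega w [|n] //= nk omn.
  have h e : (cost k (oshift omega) (sect (omega 0%N) (red w) e)
      <= (na (sect (omega 0%N) (red w) e)).+1)%N.
    exact: leq_trans (cost_le_ns _ _ _) (ns_red_na _).
  have := h true; have := h false; rewrite -omn.
  rewrite -(na_sect (omega 0%N) (red w) false) expnS.
  by have := expn_gt0 2 k; move=> /=; lia.
have h e := IHk (oshift omega) (sect (omega 0%N) (red w) e) n nk omn.
have h' e := no_red v (sect (omega 0%N) (red w) e).
have := h true; have := h false; have := h' true; have := h' false.
by rewrite -(no_sect v (omega 0%N) (red w) false) expnS /=; lia.
Qed.

Lemma size_key k omega w : (size (key k omega w) < (cost k omega w).*2 + 3 * 2 ^ k)%N.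
Proof.
elim: k omega w => [|k IHk] omega w /=.
  by rewrite size_rcons size_map; have := size_red w; lia.
rewrite size_cat expnS.
have := IHk (oshift omega) (sect (omega 0%N) (red w) false).
have := IHk (oshift omega) (sect (omega 0%N) (red w) true).
by lia.
Qed.

(** Every spinal letter is left out of [no v] for one of the three symbols [v], hence
    the factor 2 / 3 when [cost_le_no] is averaged over them. *)
Lemma cost_window k omega w : (forall v, exists2 n, (n < k)%N & omega n = v) ->
  (3 * cost k omega w <= 2 * ns (red w) + 3 * 2 ^ k)%N.
Proof.
move=> allv; rewrite -sum_no.
have : (\sum_(i < 3) cost k omega w <= \sum_(i < 3) (no i (red w) + 2 ^ k))%N.
  by apply: leq_sum => i _; have [n nk omn] := allv i; exact: cost_le_no nk omn.
by rewrite big_split /= !sum_nat_const card_ord.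
Qed.

Lemma cost_comp a b C k1 k2 omega :
  (forall w, a * cost k2 (iter k1 oshift omega) w <= b * ns (red w) + C)%N ->
  forall w, (a * cost (k1 + k2) omega w <= b * cost k1 omega w + 2 ^ k1 * C)%N.
Proof.
elim: k1 omega => [|k1 IHk] omega bnd w; first by rewrite expn0 mul1n bnd.
have {}IHk := IHk (oshift omega); rewrite -iterSr in IHk; have {}IHk := IHk bnd.
rewrite addSn /= expnS -mulnA !mulnDr.
have := IHk (sect (omega 0%N) (red w) false).
have := IHk (sect (omega 0%N) (red w) true).
by lia.
Qed.

Lemma recurring_iter k omega : recurring omega -> recurring (iter k oshift omega).
Proof.
have iterE n : iter k oshift omega n = omega (k + n)%N.
  by elim: k n => // k IHk n; rewrite iterS /oshift IHk addnS.
move=> rec v N; have [n kNn <-] := rec v (k + N)%N.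
exists (n - k)%N; first by lia.
by rewrite iterE subnKC //; lia.
Qed.

Lemma recurring_window omega : recurring omega ->
  exists k, forall v, exists2 n, (n < k)%N & omega n = v.
Proof.
move=> rec; have [f fP] : {f : 'I_3 -> nat & forall v, omega (f v) = v}.
  apply: (@choice _ _ (fun v n => omega n = v)) => v.
  by have [n _ <-] := rec v 0%N; exists n.
exists (\max_(v < 3) f v).+1 => v; exists (f v) => //.
by rewrite ltnS (leq_bigmax v).
Qed.

Lemma cost_contraction m omega : recurring omega ->
  exists k C, forall w, (3 ^ m * cost k omega w <= 2 ^ m * ns (red w) + C)%N.
Proof.
elim: m omega => [|m IHm] omega rec.
  by exists 0%N, 0%N => w; rewrite !mul1n addn0.
have [k1 win] := recurring_window rec.
have [k2 [C bnd]] := IHm _ (recurring_iter k1 rec).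
exists (k1 + k2)%N, (3 * 2 ^ k1 * C + 2 ^ m * (3 * 2 ^ k1))%N => w.
have := cost_comp bnd w; have := cost_window w win.
set c1 := cost k1 omega w; set c := cost _ omega w => h1 h2.
rewrite !expnS.
have := leq_mul (leqnn (2 ^ m)) h1; lia.
Qed.

(** By [cost_contraction] and [size_key], the key of a word of length [n] at a suitable
    depth has length about [2 * (2 / 3) ^ m * n], for [m] as large as one likes, and
    keys are strings over six symbols, padding included. *)
Lemma words_subexponential (R : realType) omega (d : R) : recurring omega -> 0 < d ->
  exists2 K : R, 0 < K & forall n, exists D : seq (seq letter),
    (size D)%:R <= K * expR (d * n%:R) /\
    forall w, (size w <= n)%N -> exists2 w', w' \in D & wact omega w =1 wact omega w'.
Proof.
move=> rec d0.
have [m md] : exists m, 2 * (2 / 3) ^+ m * ln 6 <= d :> R.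
  have := @cvg_geometric R (2 * ln 6) (2 / 3).
  rewrite ger0_norm; last by lra.
  case/(_ _)/Wrap; first by lra.
  move/cvgrPdist_le => /(_ _ d0)[m _ /(_ m (leqnn _))]; rewrite sub0r normrN => h.
  by exists m; apply: le_trans h; rewrite mulrAC; exact: ler_norm.
have [k [C bnd]] := cost_contraction m rec.
pose M n := (((2 ^ m * n + C) %/ 3 ^ m).*2 + 3 * 2 ^ k)%N.
pose pad n (s : seq (option letter)) := map Some s ++ nseq (M n - size s) None.
have keyM n w : (size w <= n)%N -> (size (key k omega w) <= M n)%N.
  move=> wn; apply: leq_trans (ltnW (size_key _ _ _)) _.
  rewrite leq_add2r leq_double leq_divRL ?expn_gt0 // mulnC.
  apply: leq_trans (bnd _) _; rewrite leq_add2r leq_mul2l.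
  by rewrite (leq_trans (ns_red _)) ?orbT // (leq_trans (count_size _ _)).
exists (expR (ln 6 * (2 * C + 3 * 2 ^ k)%:R)); first exact: expR_gt0.
move=> n.
pose A := option (option letter).
exists [seq xget [::] [set w | (size w <= n)%N /\ pad n (key k omega w) = tval t]
        | t : (M n).-tuple A].
split.
  rewrite size_map -cardE card_tuple !card_option card_ord natrX -expRD.
  have e6 : 6%:R = expR (ln 6%:R) :> R by rewrite lnK // posrE ltr0n.
  rewrite {1}e6 -expRM_natl ler_expR.
  have Mle : (M n)%:R <= 2 * ((2 / 3) ^+ m * n%:R + C%:R) + (3 * 2 ^ k)%:R :> R.
    rewrite natrD lerD2r -muln2 natrM mulrC ler_pM2l //.
    have : (((2 ^ m * n + C) %/ 3 ^ m) * 3 ^ m)%:R <= (2 ^ m * n + C)%:R :> R.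
      by rewrite ler_nat leq_trunc_div.
    rewrite natrM natrD natrM !natrX -ler_pdivlMr ?exprn_gt0 // => /le_trans; apply.
    rewrite mulrDl expr_div_n mulrAC lerD2l ler_pdivrMr ?exprn_gt0 //.
    by rewrite ler_peMr // exprn_ege1 // ler1n.
  have ln6 : 0 <= ln 6 :> R by rewrite ln_ge0 // ler1n.
  have := ler_wpM2r ln6 Mle => /le_trans; apply.
  have := ler_wpM2r (ler0n R n) md.
  set u := ln _; set v := (2 / 3) ^+ m.
  by lra.
move=> w wn.
have padsize : size (pad n (key k omega w)) == M n.
  by rewrite /pad size_cat size_map size_nseq subnKC // keyM.
exists (xget [::] [set w0 | (size w0 <= n)%N /\
                    pad n (key k omega w0) = tval (Tuple padsize)]).
  by apply: map_f; rewrite mem_enum.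
case: xgetP => [w' _ [w'n padE]|/(_ w)/=]; last by case.
have {}padE : key k omega w' = key k omega w.
  have padK s : pmap id (pad n s) = s.
    rewrite /pad pmap_cat.
    have -> : pmap id (nseq (M n - size s) (None : option (option letter))) = [::].
      by elim: (_ - _)%N.
    by rewrite cats0; elim: s => //= x s ->.
  by rewrite -[LHS]padK padE /= padK.
by have [] := @key_parse k omega w w' [::] [::] (congr1 (cat^~ [::]) (esym padE)).
Qed.

Definition gletter omega (l : letter) : tree_aut :=
  if l is Some i then spinal (fun v => v != i) omega else grig_a.

Lemma gletterE omega l : (gletter omega l : seq bool -> seq bool) = lact omega l.
Proof. by case: l. Qed.

Lemma eq_spinal (p q : pred 'I_3) omega : p =1 q -> spinal p omega = spinal q omega.
Proof.
move=> pq; apply: tree_autP => u /=.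
by elim: u omega => [|[] u IHu] omega //=; rewrite ?IHu ?pq.
Qed.

Lemma grig_gensP omega g : grig_gens omega g <-> exists l, g = gletter omega l.
Proof.
have sp (v : 'I_3) : [/\ (val v \in [:: 0; 1]%N) = (v != Ordinal (isT : 2 < 3)%N),
    (val v \in [:: 0; 2]%N) = (v != Ordinal (isT : 1 < 3)%N)
    & (val v \in [:: 1; 2]%N) = (v != Ordinal (isT : 0 < 3)%N)].
  by case: v => [[|[|[|v]]] ?].
split.
  case=> [[[->|->]|->]|->]; first by exists None.
  - by exists (Some (Ordinal (isT : 2 < 3)%N)); apply: eq_spinal => v; case: (sp v).
  - by exists (Some (Ordinal (isT : 1 < 3)%N)); apply: eq_spinal => v; case: (sp v).
  - by exists (Some (Ordinal (isT : 0 < 3)%N)); apply: eq_spinal => v; case: (sp v).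
case=> -[i|] ->; last by do 3 left.
case: i => [[|[|[|i]]] //= i3].
- right; apply: eq_spinal => v; case: (sp v) => _ _ ->.
  by congr (_ != _); apply: val_inj.
- left; right; apply: eq_spinal => v; case: (sp v) => _ -> _.
  by congr (_ != _); apply: val_inj.
- left; left; right; apply: eq_spinal => v; case: (sp v) => -> _ _.
  by congr (_ != _); apply: val_inj.
Qed.

Lemma gletter_invol omega l : (gletter omega l * gletter omega l)%g = 1%g.
Proof.
apply: tree_autP => u; rewrite /= gletterE.
by case: l => [i|]; [exact: spinal_funK|exact: flip_funK].
Qed.

Definition gword omega (w : seq letter) : tree_aut := (\prod_(l <- w) gletter omega l)%g.

Lemma gwordE omega w u : gword omega w u = wact omega w u.
Proof.
elim: w u => [|l w IHw] u; rewrite /gword ?big_nil ?big_cons //=.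
by rewrite IHw gletterE.
Qed.

Lemma gword_generated omega w : generated_pred (grig_gens omega) (gword omega w).
Proof.
apply/asboolP; exists (size w), (map (gletter omega) w); split.
- by rewrite size_map.
- by move=> s /mapP[l _ ->]; left; apply/grig_gensP; exists l.
- by rewrite big_map.
Qed.

Definition gelt omega (w : seq letter) : grigorchuk omega :=
  exist _ (gword omega w) (gword_generated omega w).

Lemma gelt_cons omega l w : gelt omega (l :: w) = (gelt omega [:: l] * gelt omega w)%g.
Proof. by apply: val_inj; rewrite /= /gword big_cons big_seq1. Qed.

Lemma gelt_surj omega (g : grigorchuk omega) : exists w, g = gelt omega w.
Proof.
case: g => g gP; have /asboolP[_ [s [_ sP gE]]] := gP.
suff [w wE] : exists w, g = gword omega w by exists w; apply: val_inj.
rewrite {}gE; elim: s sP => [|h s IHs] sP.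
  by exists [::]; rewrite /gword !big_nil.
have [|w wE] := IHs; first by move=> t ts; apply: sP; rewrite in_cons ts orbT.
have [l hE] : exists l, h = gletter omega l.
  have [/grig_gensP//|/grig_gensP[l hV]] := sP h (mem_head _ _).
  exists l; rewrite -[LHS]invgK hV; apply: (@mulgI _ (gletter omega l)).
  by rewrite mulgV gletter_invol.
by exists (l :: w); rewrite big_cons wE hE /gword big_cons.
Qed.

(** * Torsion forces every symbol to recur *)

Definition word_torsion omega :=
  forall w, exists2 n, (0 < n)%N & forall u, iter n (wact omega w) u = u.

Lemma grigorchuk_word_torsion omega : torsion (grigorchuk omega) -> word_torsion omega.
Proof.
move=> tors w; have [n [n0 wn]] := tors (gelt omega w); exists n => // u.
have /(congr1 (fun g : grigorchuk omega => (\val g : tree_aut) u)) := wn.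
have -> : \val (gelt omega w ^+ n)%g = (gword omega w ^+ n)%g.
  by elim: (n) => // m IHm; rewrite !expgS -IHm.
move=> gu; transitivity ((gword omega w ^+ n)%g u); last exact: gu.
by elim: (n) u {gu} => // m IHm u; rewrite iterSr IHm expgS /= gwordE.
Qed.

(** Every word is the section at 2 of some word fixing the first letter, since
    [a x a] has section [a] there when [x] is not killed. *)
Lemma word_torsion_shift omega : word_torsion omega -> word_torsion (oshift omega).
Proof.
move=> tors w; pose x := if omega 0%N == 0 then 1 else 0 : 'I_3.
have xP : omega 0%N != x by rewrite /x; case: (eqVneq (omega 0%N) 0) => [->|].
pose lift (w : seq letter) := flatten [seq if l is Some i then [:: Some i]
                       else [:: None; Some x; None] | l <- w] : seq letter.
have liftE w' : flips (lift w') = false /\ sect (omega 0%N) (lift w') true = w'.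
  elim: w' => [|[i|] w' [f s]] //; split=> //.
  - by rewrite /= s.
  - by rewrite -[RHS]f /flips /= negbK.
  - by rewrite /= xP s.
have [n n0 nP] := tors (lift w); exists n => // u.
have := nP (true :: u).
suff -> : forall m u, iter m (wact omega (lift w)) (true :: u) =
    true :: iter m (wact (oshift omega) w) u by case.
elim=> // m IHm v; rewrite iterSr wact_cons; have [-> ->] := liftE w.
by rewrite IHm -iterSr.
Qed.

(** If [v] never occurs, the square of [a * gletter (Some v)] has the element of
    the same name as its section at 2, so an even order could be halved for ever. *)
Lemma avoid_infinite_order n omega v : (forall k, omega k != v) -> (0 < n)%N ->
  ~ (forall u, iter n (wact omega [:: None; Some v]) u = u).
Proof.
elim/ltn_ind: n omega => n IHn omega av n0 id.
have step e u : exists u', wact omega [:: None; Some v] (e :: u) = ~~ e :: u'.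
  by rewrite wact_cons addbT; eexists.
have par m e u : exists u', iter m (wact omega [:: None; Some v]) (e :: u) = e (+) odd m :: u'.
  elim: m => [|m [u' IHm]]; first by exists u; rewrite addbF.
  by rewrite iterS IHm; have [u'' ->] := step (e (+) odd m) u'; exists u''; rewrite /= addbN.
have [h nE] : exists h, n = h.*2.
  exists n./2; have [u' ] := par n true [::]; rewrite id => -[].
  by move=> h _; rewrite -[LHS]odd_double_half; case: odd h.
have hn : (h < n)%N by lia.
have h0 : (0 < h)%N by lia.
apply: (IHn h hn (oshift omega) (fun k => av k.+1) h0) => u.
have /(_ (true :: u)) := id; rewrite nE.
suff -> : forall m u, iter m.*2 (wact omega [:: None; Some v]) (true :: u) =
    true :: iter m (wact (oshift omega) [:: None; Some v]) u by case.
elim=> // m IHm u'; rewrite doubleS !iterSr -wact_cat wact_cons /= av.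
by rewrite /flips /= IHm -iterSr.
Qed.

Lemma torsion_recurring omega : torsion (grigorchuk omega) -> recurring omega.
Proof.
move=> /grigorchuk_word_torsion tors v N; apply: contrapT => none.
have iterE m n : iter m oshift omega n = omega (m + n)%N.
  by elim: m n => // m IHm n; rewrite iterS /oshift IHm addnS.
have torsN : word_torsion (iter N oshift omega).
  by elim: (N) => // m; rewrite iterS; exact: word_torsion_shift.
have [n n0 nP] := torsN [:: None; Some v].
apply: avoid_infinite_order n0 nP => k; rewrite iterE.
by apply/eqP => omv; apply: none; exists (N + k)%N => //; rewrite leq_addr.
Qed.

(** * Subexponential growth as a property of groups *)

Definition subexponential (R : realType) (H : groupType) :=
  forall (Q : seq H) (d : R), 0 < d -> exists2 K : R, 0 < K &
  forall n, exists D : seq H, (size D)%:R <= K * expR (d * n%:R) /\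
    forall l : seq H, size l = n -> {subset l <= Q} -> (\prod_(h <- l) h)%g \in D.

Lemma grigorchuk_subexponential (R : realType) omega :
  recurring omega -> subexponential R (grigorchuk omega).
Proof.
move=> rec Q d d0.
have [wd wdP] : {wd : grigorchuk omega -> seq letter & forall g, g = gelt omega (wd g)}.
  exact: (choice (@gelt_surj omega)).
pose c := \max_(q <- Q) size (wd q).
have d'0 : 0 < d / c.+1%:R by rewrite divr_gt0.
have [K K0 KP] := words_subexponential rec d'0; exists K => // n.
have [D [sD DP]] := KP (c * n)%N; exists (map (gelt omega) D); split.
  rewrite size_map; apply: le_trans sD _; rewrite ler_pM2l // ler_expR -mulrA.
  rewrite ler_pM2l // natrM mulrA ler_piMl ?ler0n //.
  by rewrite mulrC ler_pdivrMr // mul1r ler_nat.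
move=> l ln lQ; have [|w' w'D w'E] := DP (flatten (map wd l)).
  rewrite size_flatten /shape -map_comp -ln; elim: l {ln} lQ => //= q l IHl lQ.
  rewrite mulnS leq_add //.
    by rewrite /c (big_rem q) ?lQ ?mem_head //= leq_maxl.
  by apply: IHl => h hl; apply: lQ; rewrite in_cons hl orbT.
apply/mapP; exists w' => //.
have -> : (\prod_(h <- l) h)%g = gelt omega (flatten (map wd l)).
  elim: l {ln lQ w'E} => [|q l IHl].
    by apply: val_inj; rewrite big_nil /= /gword big_nil.
  rewrite big_cons IHl [in LHS](wdP q); apply: val_inj.
  by rewrite /= /gword big_cat.
by apply: val_inj; apply: tree_autP => u; rewrite /= !gwordE.
Qed.

Lemma prod_subexponential (R : realType) (H1 H2 : groupType) :
  subexponential R H1 -> subexponential R H2 -> subexponential R (H1 * H2)%type.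
Proof.
move=> sub1 sub2 Q d d0; have d20 : 0 < d / 2 by lra.
have [K1 K10 K1P] := sub1 (map fst Q) _ d20.
have [K2 K20 K2P] := sub2 (map snd Q) _ d20.
exists (K1 * K2); first exact: mulr_gt0.
move=> n; have [D1 [sD1 D1P]] := K1P n; have [D2 [sD2 D2P]] := K2P n.
exists [seq (h1, h2) | h1 <- D1, h2 <- D2]; split.
  rewrite size_allpairs natrM.
  apply: le_trans (ler_pM (ler0n _ _) (ler0n _ _) sD1 sD2) _.
  rewrite mulrACA -expRD; have -> : d / 2 * n%:R + d / 2 * n%:R = d * n%:R by field.
  by [].
move=> l ln lQ.
have -> : (\prod_(h <- l) h)%g =
    ((\prod_(h <- map fst l) h)%g, (\prod_(h <- map snd l) h)%g).
  by elim: l {ln lQ} => [|h l IHl] /=; rewrite ?big_nil // !big_cons IHl.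
apply/allpairsP; eexists (_, _); split; last by [].
  by apply: D1P; rewrite ?size_map // => h /mapP[q /lQ qQ ->]; apply: map_f.
by apply: D2P; rewrite ?size_map // => h /mapP[q /lQ qQ ->]; apply: map_f.
Qed.

(** * Action of words on the boundary *)

Definition btail (x : boundary) : boundary := fun n => x n.+1.

Definition bact omega w (x : boundary) : boundary := boundary_act x (gword omega w).

Lemma mkseqS (x : boundary) n : mkseq x n.+1 = x 0%N :: mkseq (btail x) n.
Proof. by rewrite /mkseq /= -[1%N]addn0 iotaDl -map_comp. Qed.

Lemma bact_head omega w x : bact omega w x 0%N = x 0%N (+) flips w.
Proof. by rewrite /bact /boundary_act mkseqS gwordE wact_cons. Qed.

Lemma bact_tail omega w x :
  btail (bact omega w x) = bact (oshift omega) (sect (omega 0%N) w (x 0%N)) (btail x).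
Proof.
apply/funext => n; rewrite /btail /bact /boundary_act mkseqS gwordE wact_cons /=.
by rewrite gwordE.
Qed.

Lemma bact_ext omega w1 w2 : wact omega w1 =1 wact omega w2 ->
  bact omega w1 = bact omega w2.
Proof.
by move=> e12; apply/funext => x; apply/funext => n; rewrite /bact /boundary_act !gwordE e12.
Qed.

Lemma bact_cat omega w1 w2 x : bact omega (w1 ++ w2) x = bact omega w2 (bact omega w1 x).
Proof. by rewrite /bact /gword big_cat boundary_actM. Qed.

Lemma bact_inj omega w : injective (bact omega w).
Proof.
move=> x y /(congr1 (fun z => boundary_act z (gword omega w)^-1%g)).
by rewrite /bact -!boundary_actM mulgV !boundary_act1.
Qed.

Lemma bact_nil omega x : bact omega [::] x = x.
Proof. by rewrite /bact /gword big_nil boundary_act1. Qed.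

(** * A family of short words that mixes every boundary point *)

Definition aword (w : seq 'I_3) : seq letter := flatten [seq [:: None; Some i] | i <- w].

(** In terms of the automorphism [tau] that acts as [a] on the first letter and on
    both subtrees, [aword (zeta v w)] has, over a sequence starting with [v], the
    value of [w] in the subtree 2 and its conjugate by [a] in the subtree 1,
    followed by [tau] to the number of occurrences of [v] in [w]. Both sections
    are thus controlled at the price of tripling the length only. *)
Definition zeta (v : 'I_3) (w : seq 'I_3) : seq 'I_3 :=
  flatten [seq (if i == v then [:: v + 1; v; v + 2] else [:: i; i]) : seq 'I_3 | i <- w].

Lemma zeta_cons v i w :
  zeta v (i :: w) = (if i == v then [:: v + 1; v; v + 2] else [:: i; i]) ++ zeta v w.
Proof. by []. Qed.

Lemma aword_cat w1 w2 : aword (w1 ++ w2) = aword w1 ++ aword w2.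
Proof. by rewrite /aword map_cat flatten_cat. Qed.

Lemma size_aword w : size (aword w) = (size w).*2.
Proof. by elim: w => //= i w ->. Qed.

Lemma flips_aword w : flips (aword w) = odd (size w).
Proof. by rewrite /flips; elim: w => //= i w ->. Qed.

Lemma size_zeta v w : (size (zeta v w) <= 3 * size w)%N.
Proof.
elim: w => // i w IHw; rewrite zeta_cons size_cat mulnS.
by apply: leq_add IHw; case: eqP.
Qed.

Lemma odd_size_zeta v w : odd (size (zeta v w)) = odd (count_mem v w).
Proof.
by elim: w => // i w IHw; rewrite zeta_cons size_cat oddD IHw /= oddD; case: eqP.
Qed.

Lemma odd_count_zeta l v w : odd (count_mem l (zeta v w)) = odd (count_mem v w).
Proof.
elim: w => // i w IHw; rewrite zeta_cons count_cat oddD IHw [in RHS]/= [in RHS]oddD; congr (_ (+) _).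
case: eqP => _ /=; last by rewrite addn0 addnn odd_double.
by case: v l {IHw} => [[|[|[|v]]] ?] [[|[|[|l]]] ?].
Qed.

Lemma zeta_others (v : 'I_3) : [/\ v != v + 1, v != v + 2 & third (v + 1) (v + 2) = v].
Proof.
split; try by case: v => [[|[|[|v]]] ?].
by case: v => [[|[|[|v]]] ?] //; apply: val_inj; rewrite /third /= inordK.
Qed.

Lemma sect_zeta omega v w e u :
  wact omega (sect v (aword (zeta v w)) e) u =
  if e then wact omega (aword w ++ nseq (odd (count_mem v w)) None) u
  else wact omega (None :: aword w ++ nseq (~~ odd (count_mem v w)) None) u.
Proof.
have [x1 x2 x3] := zeta_others v.
have yx : v + 1 != v + 2 by case: (v) => [[|[|[|?]]] ?].
elim: w e u => [|i w IHw] e u; first by case: e => //=; rewrite flip_funK.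
rewrite zeta_cons; case: (eqVneq i v) => [->|iv] /=.
  case: e; rewrite /= ?x1 ?x2 /= ?eqxx /=; last first.
    by rewrite IHw negbK flip_funK spinal_third // x3.
  rewrite IHw /= flip_funK /= !wact_cat.
  by case: odd.
have vi : v != i by rewrite eq_sym.
by case: e; rewrite /= vi /= IHw (negPf iv) /= ?flip_funK.
Qed.

(** The letter [l + 1], and not [l], randomises the first letter, so that the parity
    of the number of [l]s keeps determining the parity that [zeta] reads. *)
Fixpoint mixing_word omega (l : 'I_3) (bits : seq bool) : seq 'I_3 :=
  if bits is b :: bits' then
    nseq b (l + 1) ++ zeta (omega 0%N) (mixing_word (oshift omega) (omega 0%N) bits')
  else [::].

Lemma bact_zeta_inj omega w1 w2 x :
  bact omega (aword (zeta (omega 0%N) w1)) x = bact omega (aword (zeta (omega 0%N) w2)) x ->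
  odd (count_mem (omega 0%N) w1) = odd (count_mem (omega 0%N) w2) /\
  exists y, bact (oshift omega) (aword w1) y = bact (oshift omega) (aword w2) y.
Proof.
move=> eqx; have eqodd : odd (count_mem (omega 0%N) w1) = odd (count_mem (omega 0%N) w2).
  have := congr1 (@^~ 0%N) eqx; rewrite !bact_head !flips_aword !odd_size_zeta.
  exact: addbI.
split=> //; have := congr1 btail eqx; rewrite !bact_tail.
have := sect_zeta (oshift omega) (omega 0%N); case: (x 0%N) => sz.
  rewrite (bact_ext (sz w1 true)) (bact_ext (sz w2 true)) eqodd !bact_cat => /bact_inj.
  by exists (btail x).
rewrite (bact_ext (sz w1 false)) (bact_ext (sz w2 false)) eqodd.
rewrite -(cat1s None (aword w1 ++ _)) -(cat1s None (aword w2 ++ _)) !bact_cat => /bact_inj.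
by exists (bact (oshift omega) [:: None] (btail x)).
Qed.

Lemma mixing_word_inj omega l bits1 bits2 x :
  size bits1 = size bits2 ->
  odd (count_mem l (mixing_word omega l bits1)) = odd (count_mem l (mixing_word omega l bits2)) ->
  bact omega (aword (mixing_word omega l bits1)) x =
  bact omega (aword (mixing_word omega l bits2)) x -> bits1 = bits2.
Proof.
elim: bits1 bits2 omega l x => [|b1 bits1 IH] [|b2 bits2] //= omega l x [] eqs.
have l1 : (l + 1 == l) = false by case: (l) => [[|[|[|?]]] ?].
rewrite !count_cat !count_nseq /= l1 !mul0n !add0n !odd_count_zeta => eqodd eqx.
have eqb : b1 = b2.
  have := congr1 (@^~ 0%N) eqx; rewrite !bact_head !flips_aword !size_cat !oddD.
  rewrite !size_nseq !odd_size_zeta eqodd => /addbI/addIb.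
  by case: (b1); case: (b2).
congr (_ :: _) => //; move: eqx; rewrite eqb !aword_cat !bact_cat.
by case/bact_zeta_inj => _ [y]; apply: IH.
Qed.

Lemma size_mixing_word omega l bits :
  ((size (mixing_word omega l bits)).*2 < 3 ^ size bits)%N.
Proof.
elim: bits omega l => //= b bits IH omega l; rewrite size_cat size_nseq expnS.
have := IH (oshift omega) (omega 0%N).
by have := size_zeta (omega 0%N) (mixing_word (oshift omega) (omega 0%N) bits); case: b; lia.
Qed.

Definition mixing_elt omega bits : grigorchuk omega :=
  gelt omega (aword (zeta (omega 0%N) (mixing_word (oshift omega) (omega 0%N) bits))).

Lemma mixing_elt_inj omega bits1 bits2 x : size bits1 = size bits2 ->
  grig_act x (mixing_elt omega bits1) = grig_act x (mixing_elt omega bits2) ->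
  bits1 = bits2.
Proof.
move=> eqs /(@bact_zeta_inj omega) [eqodd [y eqy]].
exact: mixing_word_inj eqs eqodd eqy.
Qed.

Lemma mixing_elt_word omega bits : exists2 w,
  mixing_elt omega bits = gelt omega w & (size w <= 3 ^ (size bits).+1)%N.
Proof.
eexists; first by []; rewrite size_aword expnS.
have := size_zeta (omega 0%N) (mixing_word (oshift omega) (omega 0%N) bits).
by have := size_mixing_word (oshift omega) (omega 0%N) bits; lia.
Qed.

(** * Orbits are lines *)

Fixpoint all_ones (x : boundary) n := if n is m.+1 then all_ones x m && x m else true.

(** Flips the letter after the first 1 (that is, after the first [false]). *)
Definition btau (x : boundary) : boundary := fun n =>
  x n (+) (if n is m.+1 then ~~ x m && all_ones x m else false).

Lemma all_ones_tail x n : all_ones x n.+1 = x 0%N && all_ones (btail x) n.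
Proof.
elim: n => [|n IHn]; first by rewrite /= andbT.
by rewrite -[LHS]/(all_ones x n.+1 && x n.+1) IHn -andbA.
Qed.

Lemma btauK : involutive btau.
Proof.
move=> x.
have h n : all_ones (btau x) n = all_ones x n /\ (all_ones x n -> btau x n = x n).
  elim: n => [|n [IH1 IH2]]; first by split => //; rewrite /btau addbF.
  split; first by rewrite /= IH1; case: (all_ones x n) IH2 => // ->.
  by rewrite /btau /= => /andP[_ ->]; rewrite addbF.
apply/funext => -[|n]; rewrite {1}/btau ?addbF; first by rewrite /btau addbF.
have [-> h2] := h n; rewrite {1}/btau -addbA.
by case: all_ones h2 => [->|] //; rewrite ?andbF ?andbT ?addbb ?addbF.
Qed.

Lemma bact_spinal_formula omega i x n :
  bact omega [:: Some i] x n =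
  x n (+) (if n is m.+1 then (~~ x m && all_ones x m) && (omega m != i) else false).
Proof.
elim: n omega x => [|n IHn] omega x; first by rewrite bact_head.
rewrite -[LHS]/(btail (bact omega [:: Some i] x) n) bact_tail.
have [x0|x0] /= := boolP (x 0%N).
  rewrite IHn; case: n {IHn} => [|n]; first by rewrite /= x0.
  by rewrite -[RHS]/(_ (+) (~~ _ && all_ones x n.+1 && _)) all_ones_tail x0.
case: n {IHn} => [|n]; last first.
  rewrite all_ones_tail (negPf x0) /= andbF addbF.
  by case: (_ != i); rewrite ?bact_nil // -[LHS]/(btail _ _) bact_tail bact_nil.
by rewrite /= x0 /=; case: (_ != i); rewrite ?bact_nil ?addbF // bact_head.
Qed.

(** Whatever [omega] is, a spinal generator moves a point by [btau] or not at all; so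
    an orbit has the geometry of a line on which [bflip] and [btau] alternate. *)
Lemma bact_spinal omega i x :
  bact omega [:: Some i] x = x \/ bact omega [:: Some i] x = btau x.
Proof.
have [[m /andP[xm xE]]|none] :=
  pselect (exists m, (~~ x m && all_ones x m) && (omega m == i)).
  left; apply/funext => n; rewrite bact_spinal_formula; case: n => [|n]; rewrite ?addbF //.
  have [xn|] := boolP (~~ x n && all_ones x n); last by rewrite addbF.
  suff -> : n = m by rewrite xE addbF.
  have before p q : (p < q)%N -> all_ones x q -> x p.
    by elim: q => // q IHq; rewrite ltnS leq_eqVlt => /orP[/eqP->|/IHq h] /= /andP[] // /h.
  by case: (ltngtP n m) => // h; move: xn xm => /andP[/negP xn an] /andP[/negP xm am];
    have := before _ _ h; [move/(_ am)|move/(_ an)].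
right; apply/funext => n; rewrite bact_spinal_formula /btau; case: n => // n.
have [xn|//] := boolP (~~ x n && all_ones x n); rewrite andTb.
by case: eqP => // omn; case: none; exists n; rewrite xn omn eqxx.
Qed.

Definition bflip (x : boundary) : boundary := fun n => x n (+) (n == 0)%N.

Lemma bflipK : involutive bflip.
Proof. by move=> x; apply/funext => n; rewrite /bflip -addbA addbb addbF. Qed.

Lemma bact_flip omega x : bact omega [:: None] x = bflip x.
Proof.
apply/funext => -[|n]; first by rewrite bact_head.
by rewrite -[LHS]/(btail _ _) bact_tail bact_nil /bflip addbF.
Qed.

(** Leave [o] by [bflip] or by [btau] and then alternate the two. *)
Fixpoint branch (o : boundary) (e : bool) n : boundary :=
  if n is m.+1 then (if odd m (+) e then bflip else btau) (branch o e m) else o.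

Definition bsphere o n : seq boundary := [:: branch o false n; branch o true n].

Definition bdist o y : nat :=
  xget 0%N [set n | y \in bsphere o n /\ forall m, y \in bsphere o m -> (n <= m)%N].

Lemma bsphere_step o n y (b : bool) : y \in bsphere o n ->
  exists2 m, (m <= n.+1)%N & (if b then bflip else btau) y \in bsphere o m.
Proof.
have inb e m : branch o e m \in bsphere o m by rewrite !inE; case: e; rewrite eqxx ?orbT.
suff h e : exists2 m, (m <= n.+1)%N & (if b then bflip else btau) (branch o e n) \in bsphere o m.
  by rewrite !inE => /orP[]/eqP->.
have [eb|] := eqVneq (odd n (+) e) b.
  by exists n.+1 => //; have := inb e n.+1; rewrite /= eb.
case: n => [|n] /= eb.
  exists 1%N => //; have := inb b 1%N; by [].
exists n; first by lia.
have -> : odd n (+) e = b by move: eb; case: (odd n); case: e; case: b.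
by case: (b); rewrite ?bflipK ?btauK.
Qed.

Lemma bsphere_word omega o n y w : y \in bsphere o n ->
  exists2 m, (m <= n + size w)%N & bact omega w y \in bsphere o m.
Proof.
elim: w n y => [|l w IHw] n y yn; first by exists n; rewrite ?addn0 ?bact_nil.
rewrite -cat1s bact_cat.
have [m mn ym] : exists2 m, (m <= n.+1)%N & bact omega [:: l] y \in bsphere o m.
  case: l => [i|]; last by rewrite bact_flip; exact: (bsphere_step true).
  case: (bact_spinal omega i y) => ->; last exact: (bsphere_step false).
  by exists n.
have [m' m'm ym'] := IHw _ _ ym; exists m' => //=; apply: leq_trans m'm _; lia.
Qed.

Lemma bdistP o y n : y \in bsphere o n ->
  y \in bsphere o (bdist o y) /\ forall m, y \in bsphere o m -> (bdist o y <= m)%N.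
Proof.
move=> yn; rewrite /bdist; case: xgetP => [m _ []//|/= none].
have ex : exists n, y \in bsphere o n by exists n.
have [m ym mmin] := ex_minnP ex; case: (none m); split=> // k; exact: mmin.
Qed.

(** Around every point there is a length function with small spheres that each group
    element changes by a bounded amount. The exponent is 0 for a line, and 1 for a
    plane. *)
Definition polynomial_spheres (H : groupType) (Y : choiceType) (act : right_action H Y)
    (k : nat) :=
  forall o : Y, exists (rho : Y -> nat) (sph : nat -> seq Y) (C : nat),
  [/\ rho o = 0%N, forall y, y \in sph (rho y),
      forall r, (size (sph r) <= C * r.+1 ^ k)%N
    & forall h, exists c, forall y, (rho (act y h) <= rho y + c)%N].

Lemma grig_orbit_spheres omega x0 :
  polynomial_spheres (orbit_action (grig_action omega) x0) 0.
Proof.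
move=> o; set X := orbit_action _ _.
have dist (y : orbit_of (grig_action omega) x0) : val y \in bsphere (val o) (bdist (val o) (val y)).
  have [g _ gE] := set_mem (valP o); have [h _ hE] := set_mem (valP y).
  have [w wE] := gelt_surj (g^-1 * h)%g.
  have yE : val y = bact omega w (val o).
    transitivity (grig_act (val o) (gelt omega w)); last by [].
    rewrite -wE -gE -hE /= -grig_actM mulgA mulgV mul1g //.
  have [m _] := @bsphere_word omega (val o) 0 (val o) w (mem_head _ _).
  by rewrite -yE => /bdistP[].
exists (fun y => bdist (val o) (val y)), (fun r => pmap insub (bsphere (val o) r)), 2%N.
split=> [|y|r|h].
- have [_ /(_ 0%N (mem_head _ _))] := @bdistP (val o) (val o) 0 (mem_head _ _).
  by rewrite leqn0 => /eqP.
- by rewrite mem_pmap_sub; exact: dist.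
- by rewrite size_pmap_sub; exact: count_size.
- have [w wE] := gelt_surj h; exists (size w) => y.
  have [m mle] := bsphere_word omega w (dist y).
  rewrite -[bact _ _ _]/(grig_act (val y) (gelt omega w)) -wE => /bdistP[_].
  move=> _; have [m' m'le ym'] := bsphere_word omega w (dist y).
  move: ym'; rewrite -[bact _ _ _]/(grig_act (val y) (gelt omega w)) -wE.
  move=> ym'; have [_ /(_ _ ym')] := bdistP ym'.
  by move=> /leq_trans; apply.
Qed.

Lemma prod_spheres (H1 H2 : groupType) (Y1 Y2 : choiceType)
    (act1 : right_action H1 Y1) (act2 : right_action H2 Y2) :
  polynomial_spheres act1 0 -> polynomial_spheres act2 0 ->
  polynomial_spheres (prod_action act1 act2 : right_action _ (Y1 * Y2)%type) 1.
Proof.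
move=> planar1 planar2 [p1 p2].
have [rho1 [s1 [C1 [rho1o in1 size1 lip1]]]] := planar1 p1.
have [rho2 [s2 [C2 [rho2o in2 size2 lip2]]]] := planar2 p2.
pose B (T : Type) (s : nat -> seq T) r := flatten [seq s i | i <- iota 0 r.+1].
have sizeB (T : Type) (s : nat -> seq T) C r : (forall r, (size (s r) <= C * r.+1 ^ 0)%N) ->
    (size (B T s r) <= C * r.+1)%N.
  move=> sC; rewrite /B size_flatten /shape -map_comp sumnE big_map.
  apply: leq_trans (_ : \sum_(i <- iota 0 r.+1) C <= _)%N.
    by apply: leq_sum => i _; have := sC i; rewrite muln1.
  by rewrite big_const_seq count_predT size_iota iter_addn addn0.
have inB (T : eqType) (s : nat -> seq T) i r y : (i <= r)%N -> y \in s i -> y \in B T s r.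
  by move=> ir ys; apply/flattenP; exists (s i) => //; apply: map_f; rewrite mem_iota; lia.
exists (fun y => maxn (rho1 y.1) (rho2 y.2)).
exists (fun r => [seq (a, b) | a <- s1 r, b <- B _ s2 r] ++ [seq (a, b) | a <- B _ s1 r, b <- s2 r]).
exists (2 * C1 * C2)%N; split=> [|[y1 y2]|r|[h1 h2]] /=.
- by rewrite rho1o rho2o.
- rewrite mem_cat; have [le|le] := leqP (rho1 y1) (rho2 y2).
    by apply/orP; right; apply: allpairs_f => //; exact: inB (in1 _).
  by apply/orP; left; apply: allpairs_f => //; exact: inB (ltnW le) (in2 _).
- rewrite size_cat !size_allpairs expn1.
  have := leq_mul (size1 r) (sizeB _ s2 _ r size2).
  by have := leq_mul (sizeB _ s1 _ r size1) (size2 r); rewrite !expn0 !muln1; lia.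
- have [c1 h1P] := lip1 h1; have [c2 h2P] := lip2 h2; exists (maxn c1 c2) => -[y1 y2] /=.
  by have := h1P y1; have := h2P y2; lia.
Qed.

(** * Word norms and the growth rate *)

Section WordNorm.
Variables (H : groupType) (S : set H).

Lemma has_word1 : has_word S 1%g 0.
Proof. by exists [::]; rewrite big_nil. Qed.

Lemma has_wordM g h m n : has_word S g m -> has_word S h n -> has_word S (g * h)%g (m + n).
Proof.
move=> [u [<- uS ->]] [v [<- vS ->]]; exists (u ++ v); split.
- by rewrite size_cat.
- by move=> s; rewrite mem_cat => /orP[/uS|/vS].
- by rewrite big_cat.
Qed.

Lemma has_wordV g n : has_word S g n -> has_word S g^-1%g n.
Proof.
move=> [u [<- uS ->]]; exists (rev [seq s^-1%g | s <- u]); split.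
- by rewrite size_rev size_map.
- move=> s; rewrite mem_rev => /mapP[t /uS tS ->].
  by case: tS => tS; [right; rewrite invgK|left].
- by rewrite -map_rev big_map prodgV revK.
Qed.

Lemma has_word_letter s : S s -> has_word S s 1.
Proof.
move=> Ss; exists [:: s]; rewrite big_seq1; split=> // t.
by rewrite inE => /eqP->; left.
Qed.

Lemma word_norm_min g n : has_word S g n ->
  has_word S g (word_norm S g) /\ (word_norm S g <= n)%N.
Proof.
move=> gn; have ex : exists n, `[< has_word S g n >] by exists n; apply/asboolP.
have [m /asboolP gm mmin] := ex_minnP ex.
rewrite /word_norm; case: xgetP => [k _ [gk kmin]|/(_ m)/= []]; first by split=> //; exact: kmin.
by split=> // k gk; apply: mmin; apply/asboolP.
Qed.

Lemma word_norm_le g n : has_word S g n -> (word_norm S g <= n)%N.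
Proof. by case/word_norm_min. Qed.

Hypothesis genS : generated_by S = [set: H].

Lemma word_normP g : has_word S g (word_norm S g).
Proof.
have : generated_by S g by rewrite genS.
by case=> n /word_norm_min[].
Qed.

Lemma word_normM g h : (word_norm S (g * h)%g <= word_norm S g + word_norm S h)%N.
Proof. by apply: word_norm_le; apply: has_wordM; exact: word_normP. Qed.

Lemma word_normV g : word_norm S g^-1%g = word_norm S g.
Proof.
apply/eqP; rewrite eqn_leq (word_norm_le (has_wordV (word_normP g))) /=.
by rewrite -{1}[g]invgK (word_norm_le (has_wordV (word_normP _))).
Qed.

Hypothesis finS : finite_set S.

Lemma ball_finite n : finite_set [set g | (word_norm S g <= n)%N].
Proof.
have finL : finite_set (letters S).
  apply: (@sub_finite_set _ _ (S `|` [set s^-1%g | s in S])) => [s [|sS]|].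
  - by left.
  - by right; exists s^-1%g; rewrite ?invgK.
  - by rewrite finite_setU; split=> //; exact: finite_image.
have finW m : finite_set [set g | has_word S g m].
  elim: m => [|m IHm].
    apply: sub_finite_set (finite_set1 1%g) => g /= [w [/size0nil -> _ ->]].
    by rewrite big_nil.
  apply: sub_finite_set (finite_image2 mulg finL IHm) => g /= [w [wm wS ->]].
  case: w wm wS => // s w [wm] wS.
  exists s; first by apply: wS; rewrite mem_head.
  exists (\prod_(t <- w) t)%g; last by rewrite big_cons.
  by exists w; split=> // t tw; apply: wS; rewrite in_cons tw orbT.
apply: (@sub_finite_set _ _ (\bigcup_(m in `I_n.+1) [set g | has_word S g m])).
  by move=> g /= gn; exists (word_norm S g); rewrite //=; exact: word_normP.
by apply: bigcup_finite => [|m _]; [exact: finite_II|exact: finW].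
Qed.

Lemma ball_card_ge (D : seq H) n : uniq D -> (forall g, g \in D -> (word_norm S g <= n)%N) ->
  (size D <= ball_card S n)%N.
Proof.
move=> uD Dn; apply: uniq_leq_size => // g gD.
by rewrite in_fset_set ?mem_set //=; [exact: Dn|exact: ball_finite].
Qed.

Lemma ball_cardM m n : (ball_card S (m + n) <= ball_card S m * ball_card S n)%N.
Proof.
pose F k := fset_set [set g | (word_norm S g <= k)%N].
suff : (size (F (m + n)%N) <= size [seq (g * h)%g | g <- F m, h <- F n])%N.
  by rewrite size_allpairs.
apply: uniq_leq_size; first exact: fset_uniq.
move=> g; rewrite in_fset_set; last exact: ball_finite.
move=> /set_mem /= gmn; have [w [wn wS gE]] := word_normP g.
have sub (v : seq H) k : (size v <= k)%N -> {subset v <= w} ->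
    (\prod_(h <- v) h)%g \in fset_set [set g | (word_norm S g <= k)%N].
  move=> vk vw; rewrite in_fset_set; last exact: ball_finite.
  apply/mem_set => /=; apply: leq_trans vk; apply: word_norm_le.
  by exists v; split=> // s /vw; exact: wS.
apply/allpairsP; exists ((\prod_(h <- take m w) h)%g, (\prod_(h <- drop m w) h)%g); split=> /=.
- by apply: sub => [|h /mem_take //]; rewrite size_take_min geq_minl.
- by apply: sub => [|h /mem_drop //]; rewrite size_drop wn; lia.
- by rewrite -big_cat cat_take_drop.
Qed.

Lemma ball_card_gt0 n : (0 < ball_card S n)%N.
Proof.
apply: (@ball_card_ge [:: 1%g]) => // g; rewrite inE => /eqP->.
by apply: leq_trans (word_norm_le has_word1) _.
Qed.

End WordNorm.

(** A long index is a sum of copies of one that almost realises the infimum, up to a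
    bounded remainder. *)
Lemma fekete (R : realType) (a : nat -> R) : (forall n, 0 <= a n) ->
  (forall m n, a (m + n)%N <= a m + a n) ->
  a n / n%:R @[n --> \oo] --> inf [set a n.+1 / n.+1%:R | n in [set: nat]].
Proof.
move=> a0 aD; set E := [set _ | _ in _]; pose l : R := inf E; rewrite -[inf E]/l.
have Elb : lbound E 0 by move=> _ [n _ <-]; rewrite divr_ge0.
have Einf : has_inf E by split; [exists (a 1%N / 1%:R); exists 0%N|exists 0].
have lle n : (0 < n)%N -> l <= a n / n%:R.
  by case: n => // n _; apply: ge_inf; [exists 0|exists n].
suff near_inf (e : R) : 0 < e -> \forall n \near \oo, `|l - a n / n%:R| <= e.
  by apply/cvgrPdist_le => e; exact: near_inf.
move=> e0; have e20 : 0 < e / 2 by rewrite divr_gt0.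
have [_ [m _ <-] mle] := inf_adherent e20 Einf.
have aM q : a (q * m.+1)%N <= q%:R * a m.+1 + a 0%N.
  elim: q => [|q IHq]; first by rewrite mul0r add0r.
  by rewrite mulSn; apply: le_trans (aD _ _) _; rewrite -natr1; lra.
pose B := a 0%N + \sum_(r < m.+1) a r.
have B0 : 0 <= B by rewrite addr_ge0 ?sumr_ge0.
near=> n.
have n0 : (0 < n)%N by near: n; exact: nbhs_infty_gt.
have nB : 2 * B / e <= n%:R by near: n; exact: nbhs_infty_ger.
have n0R : 0 < n%:R :> R by rewrite ltr0n.
rewrite ler_norml lerBrDl; apply/andP; split; last by have := lle n n0; lra.
suff : a n / n%:R <= a m.+1 / m.+1%:R + e / 2.
  by move: mle; set p := a m.+1 / _; lra.
rewrite ler_pdivrMr // {1}(divn_eq n m.+1).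
apply: le_trans (aD _ _) _; apply: le_trans (lerD (aM _) (lexx _)) _.
have rB : a (n %% m.+1)%N <= \sum_(r < m.+1) a r.
  have lt : (n %% m.+1 < m.+1)%N by rewrite ltn_mod.
  by rewrite (bigD1 (Ordinal lt)) //= lerDl sumr_ge0.
have qm : (n %/ m.+1)%:R * a m.+1 <= a m.+1 / m.+1%:R * n%:R.
  rewrite [leRHS]mulrAC ler_pdivlMr // mulrAC -natrM mulrC ler_wpM2l // ler_nat.
  exact: leq_trunc_div.
have : B <= e / 2 * n%:R by move: nB; rewrite ler_pdivrMr //; lra.
by rewrite mulrDl /B; move: qm; set p := _ / _ * n%:R; lra.
Unshelve. all: by end_near. Qed.

Lemma growth_rate (R : realType) (H : groupType) (S : set H) (c : R) :
  finite_generating_set S -> 0 < c ->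
  (forall N, exists2 n, (N <= n)%N & c * n%:R <= ln (ball_card S n)%:R) ->
  exists2 l : R, 1 < l & (ball_card S n)%:R `^ n%:R^-1 @[n --> \oo] --> l.
Proof.
move=> [finS genS] c0 big; pose a n : R := ln (ball_card S n)%:R.
have b1 n : 1 <= (ball_card S n)%:R :> R by rewrite ler1n ball_card_gt0.
have b0 n : 0 < (ball_card S n)%:R :> R by exact: lt_le_trans (b1 n).
have a0 n : 0 <= a n by rewrite ln_ge0.
have aD m n : a (m + n)%N <= a m + a n.
  by rewrite -lnM ?posrE // ler_ln ?posrE ?mulr_gt0 // -natrM ler_nat ball_cardM.
have /= := fekete a0 aD; set l := inf _ => al.
have lc : c <= l.
  rewrite leNgt; apply/negP => lc; have d0 : 0 < c - l by rewrite subr_gt0.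
  have /cvgrPdist_lt/(_ _ d0)[N _ NP] := al.
  have [n Nn cn] := big N.+1; have := NP n (ltnW Nn); rewrite ltr_norml => /andP[h _].
  have n0 : 0 < n%:R :> R by rewrite ltr0n (leq_trans _ Nn).
  have : c <= a n / n%:R by rewrite ler_pdivlMr.
  by move: h => /=; lra.
exists (expR l); first by rewrite expR_gt1 (lt_le_trans c0).
have -> : (fun n => (ball_card S n)%:R `^ n%:R^-1 : R) = expR \o (fun n => a n / n%:R).
  by apply/funext => n; rewrite /= /powR gt_eqF // mulrC.
by apply: continuous_cvg => //; exact: continuous_expR.
Qed.

(** * Generators of the wreath product *)

Section WreathGenerators.
Variables (A H : groupType) (Y : choiceType) (act : right_action H Y).
Local Notation W := (wreath A act).
Implicit Types (f : finsupp_fun Y A) (h : H).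

Lemma finsupp_of_seq (f : Y -> A) (s : seq Y) : (forall y, y \notin s -> f y = 1%g) ->
  finite_set [set y | f y <> 1%g].
Proof.
move=> fs; apply: (@sub_finite_set _ _ [set` s]) => [y /= fy|]; last exact: finite_seq.
by apply: contrapT => /negP/fs.
Qed.

Definition fin_fun (f : Y -> A) (s : seq Y) (fs : forall y, y \notin s -> f y = 1%g) :
  finsupp_fun Y A := FinsuppFun (finsupp_of_seq fs).

Fact fin_fun1_subproof (y : Y) : y \notin [::] -> (1 : A)%g = 1%g. Proof. by []. Qed.
Definition fin_fun1 := fin_fun fin_fun1_subproof.

Fact fin_delta_subproof (p : Y) (a : A) y :
  y \notin [:: p] -> (if y == p then a else 1)%g = 1%g.
Proof. by rewrite inE => /negPf->. Qed.
Definition fin_delta p a := fin_fun (@fin_delta_subproof p a).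

Definition lamp f : W := Wreath act f 1%g.
Definition wmove h : W := Wreath act fin_fun1 h.

Lemma wmoveM h k : wmove (h * k) = (wmove h * wmove k)%g.
Proof. by apply: wreathP => //= y; rewrite mulg1. Qed.

Lemma wmove1 : wmove 1 = 1%g.
Proof. by apply: wreathP. Qed.

Lemma wreath_split f h : Wreath act f h = (lamp f * wmove h)%g.
Proof. by apply: wreathP => [y|] /=; rewrite ?mulg1 ?mul1g. Qed.

Variables (SH : set H) (p : Y).
Hypotheses (genH : generated_by SH = [set: H]) (trans : forall y, exists h, y = act p h).

Definition wreath_gens : set W := [set wmove h | h in SH] `|` [set lamp (fin_delta p a) | a in [set: A]].

Lemma generatedM (S : set W) u v : generated_by S u -> generated_by S v -> generated_by S (u * v)%g.
Proof. by move=> [m um] [n vn]; exists (m + n)%N; exact: has_wordM. Qed.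

Lemma wreath_generated : generated_by wreath_gens = [set: W].
Proof.
apply/seteqP; split=> // -[f h] _.
have gM k : generated_by wreath_gens (wmove k).
  have : generated_by SH k by rewrite genH.
  case=> n [w [_ wS ->]]; elim: w wS => [|s w IHw] wS.
    by exists 0%N; rewrite big_nil wmove1; exact: has_word1.
  rewrite big_cons wmoveM; apply: generatedM; last first.
    by apply: IHw => t tw; apply: wS; rewrite in_cons tw orbT.
  have inS t : SH t -> has_word wreath_gens (wmove t) 1.
    by move=> St; apply: has_word_letter; left; exists t.
  have [sS|sS] := wS s (mem_head _ _); first by exists 1%N; exact: inS.
  exists 1%N; have -> : wmove s = (wmove s^-1)^-1%g.
    by apply: (@mulgI _ (wmove s^-1)); rewrite mulgV -wmoveM mulVg wmove1.
  by apply: has_wordV; exact: inS.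
have gD y a : generated_by wreath_gens (lamp (fin_delta y a)).
  have [k yE] := trans y.
  have -> : lamp (fin_delta y a) = (wmove k^-1 * lamp (fin_delta p a) * wmove k)%g.
    apply: wreathP => [z|] /=; last by rewrite mulg1 mulVg.
    rewrite mul1g mulg1 yE; congr (if _ then _ else _).
    apply/eqP/eqP => [->|<-]; first by rewrite -ractM mulgV ract1.
    by rewrite -ractM mulVg ract1.
  apply: generatedM; last exact: gM; apply: generatedM; first exact: gM.
  by exists 1%N; apply: has_word_letter; right; exists a.
rewrite wreath_split; apply: generatedM; last exact: gM.
have /finite_seqP[s sE] := fsfP f.
have {sE} fs y : y \notin s -> f y = 1%g.
  move=> ys; apply: contrapT => fy; move/negP: ys; apply.
  by have : [set y | f y <> 1%g] y by []; rewrite sE.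
elim: s f fs => [|y s IHs] f fs.
  have -> : lamp f = 1%g by apply: wreathP => // y; exact: fs.
  by exists 0%N; exact: has_word1.
have f's z : z \notin s -> (if z == y then 1 else f z)%g = 1%g.
  by move=> zs; case: eqVneq => // zy; apply: fs; rewrite in_cons negb_or zy.
have -> : lamp f = (lamp (fin_delta y (f y)) * lamp (fin_fun f's))%g.
  apply: wreathP => [z|] /=; rewrite ?mulg1 // ract1.
  by case: eqP => [->|]; rewrite ?mulg1 ?mul1g.
by apply: generatedM; [exact: gD|apply: IHs].
Qed.
End WreathGenerators.

Lemma prod_generated (H1 H2 : groupType) (S1 : set H1) (S2 : set H2) :
  generated_by S1 = [set: H1] -> generated_by S2 = [set: H2] ->
  generated_by ([set (s, 1%g) | s in S1] `|` [set (1%g, s) | s in S2]) = [set: H1 * H2].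
Proof.
move=> gen1 gen2; apply/seteqP; split=> // -[h1 h2] _; set S := _ `|` _.
have -> : (h1, h2) = ((h1, 1) * (1, h2))%g by congr (_, _); rewrite ?mulg1 ?mul1g.
have [m [w [_ wS h1E]]] : generated_by S1 h1 by rewrite gen1.
have [n [v [_ vS h2E]]] : generated_by S2 h2 by rewrite gen2.
exists (size w + size v)%N; apply: has_wordM.
  exists (map (fun s => (s, 1%g)) w); rewrite size_map; split=> // [s /mapP[t /wS tS ->]|].
    by case: tS => tS; [left; left; exists t|right; left; exists t^-1%g; rewrite // -[RHS]/(t^-1, 1^-1)%g invg1].
  by rewrite h1E big_map; elim: (w) => [|s u IHu]; rewrite ?big_nil ?big_cons // -IHu;
    congr (_, _); rewrite mulg1.
exists (map (fun s => (1%g, s)) v); rewrite size_map; split=> // [s /mapP[t /vS tS ->]|].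
  by case: tS => tS; [left; right; exists t|right; right; exists t^-1%g; rewrite // -[RHS]/(1^-1, t^-1)%g invg1].
by rewrite h2E big_map; elim: (v) => [|s u IHu]; rewrite ?big_nil ?big_cons // -IHu;
  congr (_, _); rewrite mulg1.
Qed.

Lemma grigorchuk_fg omega : exists S : set (grigorchuk omega), finite_generating_set S.
Proof.
exists [set gelt omega [:: l] | l in [set: letter]]; split.
  by apply: finite_image; exact: finite_finset.
apply/seteqP; split=> // g _; have [w ->] := gelt_surj g; exists (size w).
exists [seq gelt omega [:: l] | l <- w]; split; first by rewrite size_map.
  by move=> _ /mapP[l _ ->]; left; exists l.
rewrite big_map; elim: w => [|l w IHw].
  by rewrite big_nil; apply: val_inj; rewrite /= /gword big_nil.
by rewrite big_cons -IHw gelt_cons.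
Qed.

(** * Many lamp configurations within a small radius *)

Section LampConfigurations.
Variables (A : finGroupType) (H : groupType) (Y : choiceType) (act : right_action H Y).
Local Notation W := (wreath A act).
Variables (S : set W).
Hypotheses (finS : finite_set S) (genS : generated_by S = [set: W]).

Definition reachable (D : seq Y) (L : nat) (t : H) := forall f : finsupp_fun Y A,
  (forall y, y \notin D -> f y = 1%g) -> (word_norm S (Wreath act f t) <= L)%N.

Lemma reachable_singleton p : exists L, reachable [:: p] L 1%g.
Proof.
exists (\max_(a : A) word_norm S (lamp act (fin_delta p a))) => f fp.
have -> : Wreath act f 1%g = lamp act (fin_delta p (f p)).
  apply: wreathP => //= y; case: eqP => [->//|/eqP yp].
  by apply: fp; rewrite inE.
exact: (leq_bigmax (f p)).
Qed.

Lemma reachable_le D L L' t : (L <= L')%N -> reachable D L t -> reachable D L' t.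
Proof. by move=> LL' DL f fD; apply: leq_trans LL'; exact: DL. Qed.

(** Walk along [t], then along [g], then along [t] again. *)
Lemma reachable_double D L t g l : reachable D L t -> (word_norm S (wmove A act g) <= l)%N ->
  reachable (D ++ [seq act y (t * g)^-1%g | y <- D]) (2 * L + l) (t * g * t)%g.
Proof.
move=> DL gl f fD.
have f1D y : y \notin D -> (if y \in D then f y else 1)%g = 1%g by move/negPf->.
have f2D y : y \notin D ->
    (if act y (t * g)^-1%g \in D then 1 else f (act y (t * g)^-1))%g = 1%g.
  move=> yD; case: ifPn => // y'D; apply: fD; rewrite mem_cat negb_or y'D /=.
  apply: contra yD => /mapP[z zD eqy].
  by have := congr1 (act^~ (t * g)%g) eqy; rewrite -!ractM mulVg !ract1 => ->.
have -> : Wreath act f (t * g * t)%g =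
    (Wreath act (fin_fun f1D) t * wmove A act g * Wreath act (fin_fun f2D) t)%g.
  apply: wreathP => [y|] //=; rewrite mulg1 -ractM mulgV ract1.
  by case: ifP; rewrite ?mulg1 ?mul1g.
apply: leq_trans (word_normM genS _ _) _; rewrite mul2n -addnn addnAC.
apply: leq_add; last exact: DL.
by apply: leq_trans (word_normM genS _ _) _; apply: leq_add; [exact: DL|].
Qed.

Lemma reachable_ball (D : seq Y) L t : (1 < #|A|)%N -> uniq D -> reachable D L t ->
  (2 ^ size D <= ball_card S L)%N.
Proof.
move=> A1 uD DL; have [a a1] : exists a : A, a != 1%g.
  apply/existsP; apply: contraLR A1; rewrite negb_exists -leqNgt => /forallP allE.
  rewrite -(cards1 (1%g : A)) -cardsT; apply: subset_leq_card; apply/fintype.subsetP => x _.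
  by rewrite inE; have := allE x; rewrite negbK.
pose F (b : (size D).-tuple bool) y : A := if nth false b (index y D) then a else 1%g.
have FD b y : y \notin D -> F b y = 1%g.
  by move=> yD; rewrite /F nth_default // size_tuple memNindex.
pose E := [seq Wreath act (fin_fun (FD b)) t | b : (size D).-tuple bool].
have -> : (2 ^ size D = size E)%N by rewrite size_map -cardE card_tuple card_bool.
apply: ball_card_ge => // [|_ /mapP[b _ ->]]; last by apply: DL => y /(FD b).
rewrite map_inj_uniq ?enum_uniq // => b c /(congr1 (fun w => wbase w : Y -> A)) /= FE.
apply: eq_from_tnth => i; have iD : (i < size D)%N := ltn_ord i.
have [y0 _] : exists y0 : Y, true by case: (D) i iD => [|y0 _] // [].
have := congr1 (@^~ (nth y0 D i)) FE; rewrite /F !index_uniq // !(tnth_nth false).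
by case: nth; case: nth => // /eqP; rewrite ?(negPf a1) // eq_sym (negPf a1).
Qed.

(** Translating [D] by a random element of a family that mixes every point makes
    it almost disjoint from itself. *)
Lemma small_overlap (T : finType) (g : T -> H) (D : seq Y) (t : H) : (0 < #|T|)%N ->
  uniq D -> (forall y, injective (fun i => act y (g i))) ->
  exists i, (#|T| * count (mem D) [seq act y (t * g i)^-1%g | y <- D] <= size D ^ 2)%N.
Proof.
move=> T0 uD ginj; apply: contrapT => none.
have big i : (size D ^ 2 < #|T| * count (mem D) [seq act y (t * g i)^-1%g | y <- D])%N.
  by rewrite ltnNge; apply/negP => h; apply: none; exists i.
have : (\sum_(i : T) (size D ^ 2).+1 <=
    \sum_(i : T) #|T| * count (mem D) [seq act y (t * g i)^-1%g | y <- D])%N.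
  by apply: leq_sum => i _; exact: big.
rewrite sum_nat_const -big_distrr /= leq_pmul2l // ltnNge => /negP; apply.
have cntE i : (count (mem D) [seq act y (t * g i)^-1%g | y <- D] =
    \sum_(y <- D) \sum_(x <- D) (act (act x t) (g i) == y))%N.
  rewrite count_map -sum1_count big_mkcond; apply: eq_bigr => y _ /=.
  case: ifPn => yD.
    rewrite (bigD1_seq (act y (t * g i)^-1%g)) //= -!ractM mulVg ract1 eqxx.
    rewrite big1 ?addn0 // => x; apply: contraNeq; rewrite eqb0 negbK => /eqP<-.
    by rewrite -!ractM mulgA mulgV ract1.
  rewrite big_seq big1 // => x xD; apply/eqP; rewrite eqb0; apply: contra yD => /eqP <-.
  by rewrite -!ractM mulgA mulgV ract1.
under eq_bigr do rewrite cntE.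
rewrite exchange_big /= expnS expn1 -[X in (_ <= X * _)%N]sum1_size big_distrl /=.
apply: leq_sum => y _; rewrite exchange_big /= mul1n -sum1_size.
apply: leq_sum => x _.
case: (pickP (fun i => act (act x t) (g i) == y)) => [i /eqP iE|no]; last first.
  by rewrite big1 // => i _; rewrite no.
rewrite (bigD1 i) //= iE eqxx big1 // => j; apply: contraNeq.
by rewrite eqb0 negbK => /eqP jE; apply/eqP/(ginj (act x t)); rewrite jE.
Qed.

(** The size [si] after [i] doublings of a set of [s <= M] points is at least
    [2 ^ i * s - (4 ^ i - 2 ^ i) * M ^ 2 / (2 * N)]: the doubling of a set of size at
    most [2 ^ j * M] loses at most [4 ^ j * M ^ 2 / N] points. *)
Definition overlap_bound (M N : nat) (s i si : nat) :=
  (si <= 2 ^ i * M /\ 2 * N * (2 ^ i * s) + 2 ^ i * M ^ 2 <= 2 * N * si + 4 ^ i * M ^ 2)%N.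

Lemma reachable_doublings (T : finType) (g : T -> H) (l M : nat) D L t i :
  (0 < #|T|)%N -> (forall y, injective (fun i => act y (g i))) ->
  (forall i, word_norm S (wmove A act (g i)) <= l)%N ->
  uniq D -> (size D <= M)%N -> reachable D L t ->
  exists D' t', [/\ uniq D', reachable D' (2 ^ i * L + (2 ^ i).-1 * l) t'
    & overlap_bound M #|T| (size D) i (size D')].
Proof.
move=> T0 ginj gl uD DM DL; elim: i => [|i [D1 [t1 [uD1 D1L [D1M D1s]]]]].
  by exists D, t; split; rewrite /overlap_bound ?mul1n ?mul0n ?addn0.
have [j] := small_overlap t1 T0 uD1 ginj.
set D2 := [seq _ | _ <- _] => ov; exists (D1 ++ [seq y <- D2 | y \notin D1]), (t1 * g j * t1)%g.
have uD2 : uniq D2.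
  rewrite map_inj_uniq // => y z /(congr1 (act^~ (t1 * g j)%g)).
  by rewrite -!ractM mulVg !ract1.
have size2 : (size [seq y <- D2 | y \notin D1] + count (mem D1) D2 = size D1)%N.
  by rewrite size_filter addnC -(size_map (fun y => act y (t1 * g j)^-1%g) D1) -(count_predC (mem D1)).
split.
- rewrite cat_uniq uD1 filter_uniq // andbT; apply/hasPn => y.
  by rewrite mem_filter => /andP[].
- have D12L : reachable (D1 ++ D2) (2 * (2 ^ i * L + (2 ^ i).-1 * l) + l) (t1 * g j * t1)%g.
    exact: reachable_double.
  move=> f fD; apply: leq_trans (D12L f _) _; last first.
    have : (0 < 2 ^ i)%N by rewrite expn_gt0.
    rewrite expnS; case: (2 ^ i)%N => // q _; have -> : (2 * q.+1).-1 = (2 * q).+1 by lia.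
    by rewrite /=; nia.
  move=> y; rewrite mem_cat negb_or => /andP[y1 y2]; apply: fD.
  by rewrite mem_cat negb_or y1 mem_filter y1.
- rewrite /overlap_bound size_cat !expnS; split; first by lia.
  move: ov D1s D1M; rewrite !expnS !expn0 !muln1; set cnt := count _ _ in size2 *.
  set N := #|T|; set s1 := size D1 in size2 *; set u := size _ in size2 *.
  have e4 : (4 ^ i = 2 ^ i * 2 ^ i)%N by rewrite -expnMn.
  rewrite e4; set q := (2 ^ i)%N => ov D1s D1M.
  have := leq_mul D1M D1M; nia.
Qed.
End LampConfigurations.

Section ExponentialGrowth.
Variables (omega : nat -> 'I_3) (x0 : boundary) (A : finGroupType).
Local Notation G := (grigorchuk omega).
Local Notation X := (orbit_action (grig_action omega) x0).
Local Notation XX := (prod_action X X).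
Local Notation Y := (orbit_of (grig_action omega) x0 * orbit_of (grig_action omega) x0)%type.
Local Notation W := (wreath A XX).

Lemma orbit_transitive (x y : orbit_of (grig_action omega) x0) : exists h : G, y = X x h.
Proof.
have [g _ gE] := set_mem (valP x); have [h _ hE] := set_mem (valP y).
exists (g^-1 * h)%g; apply: val_inj; rewrite /= -gE -hE /= -grig_actM.
by rewrite mulgA mulgV mul1g.
Qed.

Lemma base_point : orbit_of (grig_action omega) x0.
Proof. by exists x0; apply/mem_set; exists 1%g => //; rewrite ract1. Qed.

Lemma wreath_fg : exists S : set W, finite_generating_set S.
Proof.
have [SG [finG genG]] := grigorchuk_fg omega.
exists (@wreath_gens A _ _ XX ([set (s, 1%g) | s in SG] `|` [set (1%g, s) | s in SG])
          (base_point, base_point)); split; last first.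
  apply: wreath_generated; first exact: prod_generated.
  move=> [y1 y2]; have [h1 ->] := orbit_transitive base_point y1.
  by have [h2 ->] := orbit_transitive base_point y2; exists (h1, h2).
rewrite finite_setU; split; apply: finite_image; last exact: finite_finset.
by rewrite finite_setU; split; apply: finite_image.
Qed.

Variable S : set W.
Hypotheses (finS : finite_set S) (genS : generated_by S = [set: W]).

Lemma move_norm : exists c, forall w1 w2,
  (word_norm S (wmove A XX (gelt omega w1, gelt omega w2)) <= c * (size w1 + size w2))%N.
Proof.
have gelt0 : gelt omega [::] = 1%g by apply: val_inj; rewrite /= /gword big_nil.
have wmove0 : wmove A XX (1%g, 1%g) = 1%g by exact: wmove1.
pose c1 := \max_(l : letter) word_norm S (wmove A XX (gelt omega [:: l], 1%g)).
pose c2 := \max_(l : letter) word_norm S (wmove A XX (1%g, gelt omega [:: l])).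
have n1 w : (word_norm S (wmove A XX (gelt omega w, 1%g)) <= c1 * size w)%N.
  elim: w => [|l w IHw]; first by rewrite gelt0 wmove0 muln0; apply: word_norm_le; exact: has_word1.
  have -> : (gelt omega (l :: w), 1%g) = ((gelt omega [:: l], 1) * (gelt omega w, 1))%g :> G * G.
    by rewrite gelt_cons; congr (_, _); rewrite mulg1.
  rewrite wmoveM mulnS; apply: leq_trans (word_normM genS _ _) _.
  by apply: leq_add => //; exact: (leq_bigmax l).
have n2 w : (word_norm S (wmove A XX (1%g, gelt omega w)) <= c2 * size w)%N.
  elim: w => [|l w IHw]; first by rewrite gelt0 wmove0 muln0; apply: word_norm_le; exact: has_word1.
  have -> : (1%g, gelt omega (l :: w)) = ((1, gelt omega [:: l]) * (1, gelt omega w))%g :> G * G.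
    by rewrite gelt_cons; congr (_, _); rewrite mulg1.
  rewrite wmoveM mulnS; apply: leq_trans (word_normM genS _ _) _.
  by apply: leq_add => //; exact: (leq_bigmax l).
exists (maxn c1 c2) => w1 w2.
have -> : (gelt omega w1, gelt omega w2) = ((gelt omega w1, 1) * (1, gelt omega w2))%g :> G * G.
  by congr (_, _); rewrite ?mulg1 ?mul1g.
rewrite wmoveM mulnDr; apply: leq_trans (word_normM genS _ _) _.
by apply: leq_add; [apply: leq_trans (n1 _) _|apply: leq_trans (n2 _) _];
  rewrite leq_mul2r ?leq_maxl ?leq_maxr orbT.
Qed.

Definition mixing_pair k (b : k.-tuple bool * k.-tuple bool) : G * G :=
  (mixing_elt omega b.1, mixing_elt omega b.2).

Lemma mixing_pair_inj k (y : Y) : injective (fun b => XX y (@mixing_pair k b)).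
Proof.
move=> [b1 b2] [c1 c2] eqy.
have e1 := congr1 (fun z => val z.1) eqy; have e2 := congr1 (fun z => val z.2) eqy.
by congr (_, _); apply: val_inj; [apply: mixing_elt_inj e1|apply: mixing_elt_inj e2];
  rewrite !size_tuple.
Qed.

(** Five doublings cost a factor 32 in length; meanwhile the mixing words get
    three bits better, and 27 times longer, so that their total length remains
    linear and their overlaps are summable. *)
Lemma linear_configurations : exists a, forall J, exists D t, exists L : nat,
  [/\ uniq D, reachable S D L t, (L <= a * 32 ^ J)%N & (32 ^ J <= 2 * size D)%N].
Proof.
have [L0 L0P] := reachable_singleton S (base_point, base_point).
have [c cP] := move_norm.
(* The mixing words of [3 * J + 3] bits have total length at most
   [2 * 3 ^ (3 * J + 4) = 162 * 27 ^ J]; five doublings use [2 ^ 5 - 1 = 31] of them,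
   and [31 * 162 + 27 * 1005 <= 32 * 1005]. *)
pose b := (1005 * c)%N; exists (L0 + b)%N => J.
suff [D [t [L [uD DL [s1 s2] Lle]]]] : exists D t, exists L : nat,
    [/\ uniq D, reachable S D L t,
      (size D <= 32 ^ J)%N /\ (32 ^ J + 16 ^ J <= 2 * size D)%N
      & (L + b * 27 ^ J <= (L0 + b) * 32 ^ J)%N].
  by exists D, t, L; split=> //; lia.
elim: J => [|J [D [t [L [uD DL [s1 s2] Lle]]]]].
  by exists [:: (base_point, base_point)], 1%g, L0; split; rewrite // !muln1.
pose k := (3 * J + 3)%N.
have cardT : #|{: k.-tuple bool * k.-tuple bool}| = (64 * 16 ^ J * 2 ^ J * 2 ^ J)%N.
  rewrite card_prod card_tuple card_bool -expnD -!mulnA -!expnMn.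
  by rewrite -[(16 * (2 * 2))%N]/(2 ^ 6)%N -[64%N]/(2 ^ 6)%N -expnM -expnD /k; congr expn; lia.
have [|i|D' [t' [uD' D'L [s1' s2']]]] := @reachable_doublings _ _ _ _ S genS _
  (@mixing_pair k) (162 * c * 27 ^ J) (32 ^ J) D L t 5 _ (@mixing_pair_inj k) _ uD s1 DL.
- by rewrite cardT !muln_gt0 !expn_gt0.
- have [w1 w1E w1s] := mixing_elt_word omega i.1.
  have [w2 w2E w2s] := mixing_elt_word omega i.2.
  rewrite /mixing_pair w1E w2E; apply: leq_trans (cP _ _) _.
  rewrite mulnAC mulnC leq_mul2r; apply/orP; right.
  move: w1s w2s; rewrite !size_tuple /k addn3 !expnS expnM -[(3 ^ 3)%N]/27%N.
  by lia.
exists D', t', (2 ^ 5 * L + (2 ^ 5).-1 * (162 * c * 27 ^ J))%N; split; first exact: uD'.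
- exact: D'L.
- split; first by rewrite [(32 ^ J.+1)%N]expnS.
  move: s2'; rewrite cardT !expnS.
  have -> : (32 ^ J = 16 ^ J * 2 ^ J)%N by rewrite -expnMn.
  have e32 : (32 ^ J = 16 ^ J * 2 ^ J)%N by rewrite -expnMn.
  move: s2; rewrite e32 expn0 !muln1.
  have x0' : (0 < 16 ^ J)%N by rewrite expn_gt0.
  have y0' : (0 < 2 ^ J)%N by rewrite expn_gt0.
  move: x0' y0'; set x := (16 ^ J)%N; set y := (2 ^ J)%N; set s := size D; set s' := size D'.
  move=> x0' y0' s2 s2'.
  have xyy : (0 < x * y * y)%N by rewrite !muln_gt0 x0' y0'.
  rewrite -(leq_pmul2l xyy).
  have := leq_mul (leqnn (x * y * y)) s2; nia.
- by rewrite !expnS /b; move: Lle; rewrite /b; lia.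
Qed.
End ExponentialGrowth.

Lemma exponential_growth (R : realType) omega x0 (A : finGroupType) : (1 < #|A|)%N ->
  let X := orbit_action (grig_action omega) x0 in
  exponential_word_growth R (wreath A (prod_action X X)).
Proof.
move=> A1 X; split; first exact: wreath_fg.
move=> S finS; have [finS' genS'] := finS.
have [a aP] := linear_configurations genS'.
have a0 : (0 < a.+1)%N by [].
apply: (@growth_rate _ _ _ (ln 2 / (2 * a.+1%:R))) => //.
  by rewrite divr_gt0 // ?mulr_gt0 // ln_gt0 // ltr1n.
move=> N; have [D [t [L [uD DL Lle Dle]]]] := aP N.
exists (a.+1 * 32 ^ N)%N.
  by apply: leq_trans (ltnW (ltn_expl N (isT : 1 < 32)%N)) _; rewrite leq_pmull.
have Lle' : (L <= a.+1 * 32 ^ N)%N by apply: leq_trans Lle _; rewrite leq_mul2r leqnSn orbT.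
have := reachable_ball finS' genS' A1 uD (reachable_le Lle' DL).
set B := ball_card _ _ => DB.
have ln2 : 0 < ln 2 :> R by rewrite ln_gt0 // ltr1n.
apply: (@le_trans _ _ ((size D)%:R * ln 2)).
  have nz : a.+1%:R != 0 :> R by rewrite pnatr_eq0.
  rewrite natrM; move: nz; set q : R := a.+1%:R => nz.
  have -> : ln 2 / (2 * q) * (q * (32 ^ N)%:R) = (32 ^ N)%:R / 2 * ln 2 :> R by field.
  by rewrite ler_pM2r // ler_pdivrMr // -natrM ler_nat mulnC.
have -> : (size D)%:R * ln 2 = ln ((2 ^ size D)%:R) :> R.
  by rewrite natrX lnXn // mulr_natl.
by rewrite ler_ln ?posrE ?ltr0n ?expn_gt0 // ?ler_nat // (leq_trans _ DB) // expn_gt0.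
Qed.

(** * Finitely supported random walks *)

Section PathExpectation.
Variables (R : realType) (T : eqType) (s : seq T) (p : T -> R).

(** The expectation of a function of the first [n] steps. *)
Fixpoint pexp n (F : seq T -> R) : R :=
  if n is m.+1 then \sum_(x <- s) p x * pexp m (fun l => F (x :: l)) else F [::].

Lemma eq_pexp n F1 F2 : (forall l, size l = n -> {subset l <= s} -> F1 l = F2 l) ->
  pexp n F1 = pexp n F2.
Proof.
elim: n F1 F2 => [|n IHn] F1 F2 eqF /=; first exact: eqF.
rewrite !big_seq; apply: eq_bigr => x xs; congr (_ * _); apply: IHn => l ln ls.
by apply: eqF; rewrite /= ?ln // => y; rewrite in_cons => /orP[/eqP->|/ls].
Qed.

Lemma pexp_sum (I : Type) (r : seq I) n (F : I -> seq T -> R) :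
  pexp n (fun l => \sum_(i <- r) F i l) = \sum_(i <- r) pexp n (F i).
Proof.
elim: n F => //= n IHn F; rewrite exchange_big /=; apply: eq_bigr => x _.
by rewrite IHn big_distrr.
Qed.

Lemma pexpZ n a F : pexp n (fun l => a * F l) = a * pexp n F.
Proof.
elim: n F => //= n IHn F; rewrite big_distrr; apply: eq_bigr => x _ /=.
by rewrite IHn mulrCA.
Qed.

Lemma pexpD n F1 F2 : pexp n (fun l => F1 l + F2 l) = pexp n F1 + pexp n F2.
Proof.
elim: n F1 F2 => //= n IHn F1 F2; rewrite -big_split; apply: eq_bigr => x _ /=.
by rewrite IHn mulrDr.
Qed.

Lemma pexpN n F : pexp n (fun l => - F l) = - pexp n F.
Proof. by rewrite -mulN1r -pexpZ; apply: eq_pexp => l _ _; rewrite mulN1r. Qed.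

Lemma pexpB n F1 F2 : pexp n (fun l => F1 l - F2 l) = pexp n F1 - pexp n F2.
Proof. by rewrite pexpD pexpN. Qed.

Lemma pexp_cat m n F :
  pexp (m + n) F = pexp m (fun l1 => pexp n (fun l2 => F (l1 ++ l2))).
Proof. by elim: m F => //= m IHm F; apply: eq_bigr => x _; rewrite IHm. Qed.

Hypotheses (p0 : forall x, 0 <= p x) (p1 : \sum_(x <- s) p x = 1).

Lemma pexp_cst n a : pexp n (fun=> a) = a.
Proof.
elim: n => //= n ->; under eq_bigr do rewrite mulrC.
by rewrite -big_distrr /= p1 mulr1.
Qed.

Lemma le_pexp n F1 F2 : (forall l, size l = n -> {subset l <= s} -> F1 l <= F2 l) ->
  pexp n F1 <= pexp n F2.
Proof.
elim: n F1 F2 => [|n IHn] F1 F2 leF /=; first exact: leF.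
rewrite !big_seq; apply: ler_sum => x xs; apply: ler_wpM2l => //; apply: IHn => l ln ls.
by apply: leF; rewrite /= ?ln // => y; rewrite in_cons => /orP[/eqP->|/ls].
Qed.

Lemma pexp_ge0 n F : (forall l, 0 <= F l) -> 0 <= pexp n F.
Proof. by move=> F0; rewrite -[leLHS](pexp_cst n); exact: le_pexp. Qed.

Lemma pexp_gt0 n F l : (forall l, 0 <= F l) -> (forall x, x \in s -> 0 < p x) ->
  size l = n -> {subset l <= s} -> 0 < F l -> 0 < pexp n F.
Proof.
move=> F0 ps; elim: n l F F0 => [|n IHn] l F F0; first by move/size0nil->.
case: l => // x l [ln] ls Fl /=.
have xs : x \in s by apply: ls; rewrite mem_head.
rewrite (big_rem x) //=; apply: ltr_pwDl; last first.
  by apply: sumr_ge0 => y _; rewrite mulr_ge0 // pexp_ge0.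
rewrite mulr_gt0 ?ps //; apply: (IHn l) => // y yl.
by apply: ls; rewrite in_cons yl orbT.
Qed.

Lemma ler_norm_pexp n F : `|pexp n F| <= pexp n (fun l => `|F l|).
Proof.
rewrite ler_norml -pexpN; apply/andP; split; apply: le_pexp => l _ _.
  by rewrite lerNl ler_normr lexx orbT.
exact: ler_norm.
Qed.

End PathExpectation.

Section Entropy.
Variables (R : realType) (H : groupType) (s : seq H) (p : H -> R).
Hypotheses (p0 : forall x, 0 <= p x) (p1 : \sum_(x <- s) p x = 1).
Hypothesis ps : forall x, x \in s -> 0 < p x.

Definition gexp n (F : H -> R) : R := pexp s p n (fun l => F (\prod_(h <- l) h)%g).

(** The [n]-step distribution. *)
Definition pmf n (g : H) : R := gexp n (fun h => (h == g)%:R).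

Lemma gexp0 F : gexp 0 F = F 1%g.
Proof. by rewrite /gexp /= big_nil. Qed.

Lemma gexpS n F : gexp n.+1 F = \sum_(x <- s) p x * gexp n (fun h => F (x * h)%g).
Proof.
apply: eq_bigr => x _; congr (_ * _); apply: eq_pexp => l _ _.
by rewrite big_cons.
Qed.

Lemma gexp_sum (I : Type) (r : seq I) n (F : I -> H -> R) :
  gexp n (fun h => \sum_(i <- r) F i h) = \sum_(i <- r) gexp n (F i).
Proof. exact: pexp_sum. Qed.

Lemma gexpZ n a F : gexp n (fun h => a * F h) = a * gexp n F.
Proof. exact: pexpZ. Qed.

Lemma gexpB n F1 F2 : gexp n (fun h => F1 h - F2 h) = gexp n F1 - gexp n F2.
Proof. exact: pexpB. Qed.

Fixpoint paths n : seq (seq H) :=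
  if n is m.+1 then [seq x :: l | x <- s, l <- paths m] else [:: [::]].

Lemma mem_paths n l : l \in paths n <-> size l = n /\ {subset l <= s}.
Proof.
elim: n l => [|n IHn] l /=.
  by rewrite inE; split=> [/eqP-> //|[/size0nil->]].
split=> [/allpairsP[[x l'] /= [xs /IHn[<- l's] ->]]|].
  by split=> // y; rewrite in_cons => /orP[/eqP->|/l's].
case: l => [|x l] [] // [ln] ls; apply: allpairs_f; first by apply: ls; rewrite mem_head.
by apply/IHn; split=> // y yl; apply: ls; rewrite in_cons yl orbT.
Qed.

Definition psupp n : seq H := undup [seq (\prod_(h <- l) h)%g | l <- paths n].

Lemma psuppP n l : size l = n -> {subset l <= s} -> (\prod_(h <- l) h)%g \in psupp n.
Proof.
by move=> ln ls; rewrite mem_undup; apply: map_f; apply/mem_paths.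
Qed.

Lemma gexpE n (D : seq H) F : uniq D -> {subset psupp n <= D} ->
  gexp n F = \sum_(g <- D) pmf n g * F g.
Proof.
move=> uD nD; transitivity (gexp n (fun h => \sum_(g <- D) F g * (h == g)%:R)).
  apply: eq_pexp => l ln ls; have gD := nD _ (psuppP ln ls).
  rewrite (bigD1_seq _ gD uD) /= eqxx mulr1 [X in _ + X]big1 ?addr0 // => g /negPf.
  by rewrite eq_sym => ->; rewrite mulr0.
by rewrite gexp_sum; apply: eq_bigr => g _; rewrite gexpZ mulrC.
Qed.

Lemma pmf_ge0 n g : 0 <= pmf n g.
Proof. by apply: pexp_ge0. Qed.

Lemma pmf_gt0 n l : size l = n -> {subset l <= s} -> 0 < pmf n (\prod_(h <- l) h)%g.
Proof. by move=> ln ls; apply: pexp_gt0 ln ls _ => //; rewrite eqxx ltr01. Qed.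

Lemma pmfS n x g : x \in s -> p x * pmf n g <= pmf n.+1 (x * g)%g.
Proof.
move=> xs; rewrite /pmf gexpS (big_rem x) //=; apply: ler_wpDr.
  by apply: sumr_ge0 => y _; rewrite mulr_ge0 //; apply: pexp_ge0.
apply: ler_wpM2l => //; apply: le_pexp => // l _ _.
by rewrite ler_nat; case: eqP => // ->; rewrite eqxx.
Qed.

Definition entropy n : R := gexp n (fun g => - ln (pmf n g)).

(** Gibbs' inequality, from [ln x <= x - 1]: with Kraft's inequality for [c] it turns the
    mean length of a code into a bound for the entropy. *)
Lemma entropy_le_code n (c : H -> R) : (forall g, g \in psupp n -> 0 < c g) ->
  \sum_(g <- psupp n) c g <= 1 -> entropy n <= gexp n (fun g => - ln (c g)).
Proof.
move=> c0 c1; rewrite -subr_ge0 -gexpB.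
have us : uniq (psupp n) by exact: undup_uniq.
rewrite (gexpE _ us) //.
have := c1; rewrite -subr_ge0 => /le_trans; apply.
have -> : 1 = \sum_(g <- psupp n) pmf n g * 1 by rewrite -(gexpE _ us) // [RHS]pexp_cst.
rewrite -sumrB !big_seq; apply: ler_sum => g gs.
have pg : 0 < pmf n g.
  by move: gs; rewrite mem_undup => /mapP[l /mem_paths[ln ls] ->]; exact: pmf_gt0.
have : ln (1 + (c g / pmf n g - 1)) <= c g / pmf n g - 1.
  by apply: le_ln1Dx; have := divr_gt0 (c0 g gs) pg; lra.
rewrite addrC subrK lnM ?posrE ?invr_gt0 ?c0 // lnV ?posrE //.
move=> /(ler_wpM2l (ltW pg)).
have -> : pmf n g * (c g / pmf n g - 1) = c g - pmf n g by field; rewrite gt_eqF.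
by lra.
Qed.

Definition step_supp n x : seq H := undup (psupp n ++ [seq (x^-1 * g)%g | g <- psupp n.+1]).

(** How far the walk conditioned on its first step [x] is from the unconditioned one: the
    distance of the laws of [x * w_n] and [w_(n+1)] in total variation. *)
Definition step_dist n x : R :=
  \sum_(g <- step_supp n x) `|pmf n g - pmf n.+1 (x * g)%g|.

Lemma step_dist_ge0 n x : 0 <= step_dist n x.
Proof. exact: sumr_ge0. Qed.

Lemma step_supp_left n x F :
  gexp n (fun h => F (x * h)%g) = \sum_(g <- step_supp n x) pmf n g * F (x * g)%g.
Proof.
apply: gexpE; first exact: undup_uniq.
by move=> g gn; rewrite mem_undup mem_cat gn.
Qed.

Lemma step_supp_right n x F :
  gexp n.+1 F = \sum_(g <- step_supp n x) pmf n.+1 (x * g)%g * F (x * g)%g.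
Proof.
rewrite -(big_map (mulg x) predT (fun h => pmf n.+1 h * F h)); apply: gexpE.
  by rewrite map_inj_uniq ?undup_uniq //; exact: mulgI.
move=> g gn; rewrite -[g](mulVKg x); apply: map_f.
by rewrite mem_undup mem_cat map_f ?orbT.
Qed.

Lemma step_distP n x F B : (forall g, `|F g| <= B) ->
  `|gexp n (fun h => F (x * h)%g) - gexp n.+1 F| <= B * step_dist n x.
Proof.
move=> FB; rewrite step_supp_left (step_supp_right _ x) -sumrB.
apply: le_trans (ler_norm_sum _ _ _) _; rewrite /step_dist big_distrr /=.
apply: ler_sum => g _; rewrite -mulrBl normrM mulrC ler_wpM2r //.
Qed.

(** A form of Pinsker's inequality, through the Hellinger distance. *)
Lemma hellinger (t u v : R) : 0 < t -> 0 <= u -> 0 <= v -> (0 < u -> 0 < v) ->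
  `|u - v| <= (u * (ln u - ln v) - u + v) / (2 * t) + t * (u + v).
Proof.
move=> t0; rewrite le_eqVlt => /predU1P[<-|u0] v0 uv.
  rewrite sub0r normrN ger0_norm // mul0r sub0r oppr0 !add0r -[X in X <= _]mul1r.
  rewrite [v / _]mulrC -mulrDl ler_wpM2r //.
  have t20 : 0 < 2 * t by lra.
  rewrite -(ler_pM2l t20) mulrDr mulfV ?gt_eqF // mulr1.
  by have := sqr_ge0 (2 * t - 1); rewrite expr2; nra.
have {uv} v0' := uv u0.
set a := Num.sqrt u; set b := Num.sqrt v.
have a0 : 0 < a by rewrite sqrtr_gt0.
have b0 : 0 < b by rewrite sqrtr_gt0.
have uE : u = a * a by rewrite -expr2 sqr_sqrtr // ltW.
have vE : v = b * b by rewrite -expr2 sqr_sqrtr // ltW.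
have lnab : ln b - ln a <= b / a - 1.
  have : ln (1 + (b / a - 1)) <= b / a - 1.
    by apply: le_ln1Dx; have := divr_gt0 b0 a0; lra.
  by rewrite addrC subrK lnM ?posrE ?invr_gt0 // lnV ?posrE.
have kl : (a - b) * (a - b) <= u * (ln u - ln v) - u + v.
  rewrite uE vE !lnM ?posrE //.
  have := ler_wpM2l (ltW (mulr_gt0 a0 a0)) lnab.
  have -> : a * a * (b / a - 1) = a * b - a * a by field; rewrite gt_eqF.
  by nra.
have t20 : 0 < 2 * t by lra.
have amgm : `|u - v| <= (a - b) * (a - b) / (2 * t) + t * (u + v).
  have -> : u - v = (a - b) * (a + b) by rewrite uE vE; ring.
  rewrite normrM (@ger0_norm _ (a + b)); last by lra.
  have -> : (a - b) * (a - b) / (2 * t) + t * (u + v) =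
      ((a - b) * (a - b) + 2 * t * t * (u + v)) / (2 * t) by field; rewrite gt_eqF.
  rewrite ler_pdivlMr // uE vE.
  have -> : (a - b) * (a - b) = `|a - b| * `|a - b| by rewrite -normrM ger0_norm // -expr2 sqr_ge0.
  have := normr_ge0 (a - b); set d := `|a - b| => d0.
  have h1 := sqr_ge0 (d - t * (a + b)).
  have h2 : 0 <= (t * (a - b)) ^+ 2 by exact: sqr_ge0.
  by nra.
apply: le_trans amgm _; rewrite lerD2r ler_pM2r ?invr_gt0 //.
Qed.

(** The increment of the entropy is the mean divergence of the law of [x * w_n] from
    that of [w_(n+1)]; sublinear entropy thus makes these distances small on average. *)
Lemma mean_step_dist n t : 0 < t ->
  \sum_(x <- s) p x * step_dist n x <= (entropy n.+1 - entropy n) / (2 * t) + 2 * t.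
Proof.
move=> t0.
have stepx x : x \in s -> step_dist n x <=
    (gexp n (fun g => ln (pmf n g)) - gexp n (fun g => ln (pmf n.+1 (x * g)%g))) / (2 * t) + 2 * t.
  move=> xs.
  have left1 : \sum_(g <- step_supp n x) pmf n g = 1.
    have := step_supp_left n x (fun=> 1); rewrite [LHS]pexp_cst // => ->.
    by apply: eq_bigr => g _; rewrite mulr1.
  have right1 : \sum_(g <- step_supp n x) pmf n.+1 (x * g)%g = 1.
    have := step_supp_right n x (fun=> 1); rewrite [LHS]pexp_cst // => ->.
    by apply: eq_bigr => g _; rewrite mulr1.
  have := step_supp_left n x (fun g => ln (pmf n (x^-1 * g)%g)).
  have -> : gexp n (fun h => ln (pmf n (x^-1 * (x * h))%g)) = gexp n (fun g => ln (pmf n g)).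
    by apply: eq_pexp => l _ _; rewrite mulKg.
  have -> := step_supp_left n x (fun g => ln (pmf n.+1 g)).
  move=> ->; under eq_bigr do rewrite mulKg.
  set u := pmf n; set v := fun g => pmf n.+1 (x * g)%g.
  have -> : (\sum_(g <- step_supp n x) u g * ln (u g) -
      \sum_(g <- step_supp n x) u g * ln (v g)) / (2 * t) + 2 * t =
      \sum_(g <- step_supp n x) ((u g * (ln (u g) - ln (v g)) - u g + v g) / (2 * t)
          + t * (u g + v g)).
    rewrite big_split /= -big_distrl /= -big_distrr /= !big_split /= sumrN left1 right1.
    rewrite subrK -sumrB; congr (_ / _ + _); last by ring.
    by apply: eq_bigr => g _; rewrite mulrBr.
  apply: ler_sum => g _; apply: hellinger => //; rewrite ?pmf_ge0 //.
  by move=> ug; apply: lt_le_trans (pmfS n g xs); rewrite mulr_gt0 // ps.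
have : \sum_(x <- s) p x * step_dist n x <= \sum_(x <- s) p x *
    ((gexp n (fun g => ln (pmf n g)) - gexp n (fun g => ln (pmf n.+1 (x * g)%g))) / (2 * t) + 2 * t).
  by rewrite !big_seq; apply: ler_sum => x xs; rewrite ler_wpM2l // stepx.
move=> /le_trans; apply; rewrite le_eqVlt; apply/orP; left; apply/eqP.
have entE m : entropy m = - gexp m (fun g => ln (pmf m g)) by exact: pexpN.
rewrite !entE gexpS.
under eq_bigr do rewrite mulrDr mulrA mulrBr.
rewrite big_split /= -!big_distrl /= p1 mul1r sumrB -big_distrl /= p1 mul1r.
by congr (_ / _ + _); rewrite opprK addrC.
Qed.
End Entropy.

(** * Consequences of zero asymptotic entropy *)

Section CesaroNull.
Variable R : realType.
Implicit Types a b : nat -> R.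

Definition sublinear a := forall e : R, 0 < e ->
  exists N0, forall N, (N0 <= N)%N -> a N <= e * N%:R.

Definition cesaro_null a := forall e : R, 0 < e ->
  exists N0, forall N, (N0 <= N)%N -> `|\sum_(n < N) a n| <= e * N%:R.

Lemma cesaro_null_dominated a b (C c : R) : 0 <= C -> cesaro_null b ->
  (forall N, `|\sum_(n < N) a n| <= C * `|\sum_(n < N) b n| + c) -> cesaro_null a.
Proof.
move=> C0 bn ab e e0; have C1 : 0 < C + 1 by rewrite ltr_wpDl.
have [|N0 N0P] := bn (e / (2 * (C + 1))); first by rewrite divr_gt0 // mulr_gt0.
exists (maxn N0 (Num.truncn (2 * `|c| / e)).+1) => N; rewrite geq_max => /andP[N0N cN].
have {}cN : c <= e / 2 * N%:R.
  have : 2 * `|c| / e <= N%:R.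
    by apply/ltW/(lt_le_trans (truncnS_gt _)); rewrite ler_nat.
  by rewrite ler_pdivrMr //; have := ler_norm c; nra.
apply: le_trans (ab N) _; have := N0P _ N0N; set B := `|_| => BN.
have : C * B <= e / 2 * N%:R.
  have -> : e / 2 * N%:R = (C + 1) * (e / (2 * (C + 1)) * N%:R) by field; rewrite gt_eqF.
  apply: le_trans (ler_wpM2l C0 BN) _; rewrite ler_wpM2r //; last lra.
  by rewrite mulr_ge0 // divr_ge0 ?ltW // mulr_gt0.
by lra.
Qed.

Lemma cesaro_nullD a b : cesaro_null a -> cesaro_null b -> cesaro_null (fun n => a n + b n).
Proof.
move=> an bn e e0; have e20 : 0 < e / 2 by rewrite divr_gt0.
have [Na NaP] := an _ e20; have [Nb NbP] := bn _ e20.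
exists (maxn Na Nb) => N; rewrite geq_max => /andP[/NaP aN /NbP bN].
rewrite big_split /=; apply: le_trans (ler_normD _ _) _.
by move: aN bN; lra.
Qed.

Lemma cesaro_nullZ a c : cesaro_null a -> cesaro_null (fun n => c * a n).
Proof.
move=> an; apply: (cesaro_null_dominated (normr_ge0 c) an (c := 0)) => N.
by rewrite -big_distrr normrM addr0.
Qed.

Lemma cesaro_null_sum (T : eqType) (r : seq T) (a : T -> nat -> R) :
  (forall x, x \in r -> cesaro_null (a x)) -> cesaro_null (fun n => \sum_(x <- r) a x n).
Proof.
elim: r => [|x r IHr] ar.
  move=> e e0; exists 0%N => N _; rewrite big1 => [|i _]; last by rewrite big_nil.
  by rewrite normr0 mulr_ge0 // ltW.
have -> : (fun n => \sum_(y <- x :: r) a y n) = (fun n => a x n + \sum_(y <- r) a y n).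
  by apply/funext => n; rewrite big_cons.
apply: cesaro_nullD; first by apply: ar; rewrite mem_head.
by apply: IHr => y yr; apply: ar; rewrite in_cons yr orbT.
Qed.

Lemma cesaro_null_le0 a c : cesaro_null a -> (forall n, c <= a n) -> c <= 0.
Proof.
move=> an ca; rewrite leNgt; apply/negP => c0.
have [|N NP] := an (c / 2); first by rewrite divr_gt0.
have := NP N.+1 (leqnSn N); have := ler_norm (\sum_(n < N.+1) a n).
have : \sum_(n < N.+1) c <= \sum_(n < N.+1) a n by apply: ler_sum.
rewrite sumr_const card_ord -mulr_natr.
have : 0 < N.+1%:R :> R by [].
by nra.
Qed.
End CesaroNull.

Section ZeroEntropy.
Variables (R : realType) (H : groupType) (s : seq H) (p : H -> R).
Hypotheses (p0 : forall x, 0 <= p x) (p1 : \sum_(x <- s) p x = 1).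
Hypothesis ps : forall x, x \in s -> 0 < p x.
Local Notation gexp := (gexp s p).
Local Notation step_dist := (step_dist s p).
Hypothesis zero_entropy : sublinear (entropy s p).

Lemma step_dist_null x : x \in s -> cesaro_null (step_dist ^~ x).
Proof.
move=> xs; pose d n := \sum_(x <- s) p x * step_dist n x.
have d0 n : 0 <= d n by apply: sumr_ge0 => y _; rewrite mulr_ge0 ?step_dist_ge0.
apply: (@cesaro_null_dominated _ _ d (p x)^-1 0); first by rewrite invr_ge0.
  move=> e e0; have t0 : 0 < e / 4 by rewrite divr_gt0.
  have [|N0 N0P] := @zero_entropy (e * (e / 4)); first by rewrite mulr_gt0.
  exists N0 => N /N0P entN; rewrite ger0_norm ?sumr_ge0 //.
  have : \sum_(n < N) d n <= (entropy s p N - entropy s p 0) / (2 * (e / 4)) + 2 * (e / 4) * N%:R.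
    elim: (N) => [|M IHM]; first by rewrite big_ord0 subrr mul0r mulr0 addr0.
    rewrite big_ord_recr /=; have := mean_step_dist p0 p1 ps M t0; rewrite -/(d M) => dM.
    apply: le_trans (lerD IHM dM) _; rewrite -natr1; set q := 2 * (e / 4).
    by rewrite !mulrBl; lra.
  move=> /le_trans; apply.
  have -> : entropy s p 0 = 0.
    by rewrite /entropy /pmf !gexp0 eqxx ln1 oppr0.
  rewrite subr0 -[leRHS]addr0 -lerBrDr.
  have -> : e * N%:R + 0 - 2 * (e / 4) * N%:R = e * (e / 4) * N%:R / (2 * (e / 4)).
    by field; rewrite gt_eqF.
  by rewrite ler_pM2r // invr_gt0 mulr_gt0.
move=> N; rewrite addr0 !ger0_norm ?sumr_ge0 //; last by move=> i _; exact: step_dist_ge0.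
rewrite mulrC ler_pdivlMr ?ps // big_distrl; apply: ler_sum => n _ /=.
rewrite /d (big_rem x) //= mulrC lerDl; apply: sumr_ge0 => y _.
by rewrite mulr_ge0 ?step_dist_ge0.
Qed.

(** [F g] and [F (g * x)] are the means of [F (g * _)] for the laws of [w_(n+1)] and
    [x * w_n], which approach each other for suitable [n]. *)
Lemma bounded_harmonic_const (F : H -> R) (B : R) (x g : H) : (forall h, `|F h| <= B) ->
  (forall h, F h = \sum_(y <- s) p y * F (h * y)%g) -> x \in s -> F (g * x)%g = F g.
Proof.
move=> FB Fharm xs.
have Fn n h : gexp n (fun k => F (h * k)%g) = F h.
  elim: n h => [|n IHn] h; first by rewrite gexp0 mulg1.
  rewrite gexpS [RHS]Fharm; apply: eq_bigr => y _; rewrite -IHn; congr (_ * _).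
  by apply: eq_pexp => l _ _; rewrite mulgA.
apply/eqP; rewrite -subr_eq0 -normr_eq0 eq_le normr_ge0 andbT.
apply: (cesaro_null_le0 (cesaro_nullZ B (step_dist_null xs))) => n.
have := @step_distP _ _ s p n x (fun h => F (g * h)%g) B (fun h => FB (g * h)%g).
rewrite Fn; have -> // : gexp n (fun h => F (g * (x * h))%g) = F (g * x)%g.
by rewrite -(Fn n (g * x)%g); apply: eq_pexp => l _ _; rewrite mulgA.
Qed.

Variable S : set H.
Hypothesis genS : generated_by S = [set: H].
Local Notation norm g := (word_norm S g)%:R.

Definition gain x g : R := norm g - norm (x^-1 * g)%g.

Lemma gain_bound x g : `|gain x g| <= norm x.
Proof.
rewrite /gain ler_norml; apply/andP; split.
  rewrite lerBrDl -lerBrDr opprK addrC -natrD ler_nat -(word_normV genS x).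
  exact: word_normM.
by rewrite lerBlDr -natrD ler_nat -{1}[g](mulVKg x) word_normM.
Qed.

(** The mean gain in norm due to a first step [x] is asymptotically invariant
    under translation by [x], and its translates by the powers of [x] sum to
    zero, since they telescope around a cycle. *)
Lemma gain_null x m : x \in s -> (0 < m)%N -> (x ^+ m = 1)%g ->
  cesaro_null (fun n => gexp n (fun g => gain x (x * g)%g)).
Proof.
move=> xs m0 xm; pose b j n := gexp n (fun g => gain x (x * x ^- j * g)%g).
pose Bd : R := norm x; pose D N := \sum_(n < N) step_dist n x.
have D0 N : 0 <= D N by apply: sumr_ge0 => i _; exact: step_dist_ge0.
have Bd0 : 0 <= Bd by rewrite /Bd.
have bB j n : `|b j n| <= Bd.
  apply: le_trans (ler_norm_pexp s p0 _ _) _.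
  rewrite -[leRHS](pexp_cst p1 n); apply: le_pexp => // l _ _; exact: gain_bound.
have bstep j n : `|b j n - b j.+1 n.+1| <= Bd * step_dist n x.
  have := @step_distP _ _ s p n x (fun h => gain x (x * x ^- j.+1 * h)%g) Bd
    (fun h => gain_bound x _).
  have -> // : gexp n (fun h => gain x (x * x ^- j.+1 * (x * h))%g) = b j n.
  apply: eq_pexp => l _ _; congr (gain x _).
  by rewrite expgS invgM !mulgA mulgVK.
have bsum n : \sum_(j < m) b j n = 0.
  rewrite -gexp_sum; transitivity (gexp n (fun=> 0)); last exact: pexp_cst.
  apply: eq_pexp => l _ _; set g := (\prod_(h <- l) h)%g.
  have -> : \sum_(j < m) gain x (x * x ^- j * g)%g =
      \sum_(j < m) (- norm (x * x ^- j.+1 * g)%g - - norm (x * x ^- j * g)%g).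
    apply: eq_bigr => j _; rewrite /gain opprK addrC; congr (- norm _ + _).
    by rewrite expgSr invgM !mulgA mulVg mul1g mulgV mul1g.
  rewrite -(big_mkord predT (fun j => - norm (x * x ^- j.+1 * g)%g - - norm (x * x ^- j * g)%g)).
  by rewrite telescope_sumr // xm expg0 subrr.
have Sstep j N : `|\sum_(n < N) b j n - \sum_(n < N) b j.+1 n| <= Bd * D N + 2 * Bd.
  have -> : \sum_(n < N) b j n - \sum_(n < N) b j.+1 n =
      \sum_(n < N) (b j n - b j.+1 n.+1) + (b j.+1 N - b j.+1 0%N).
    elim: N => [|N IHN]; first by rewrite !big_ord0 !subrr addr0.
    by rewrite !big_ord_recr /=; lra.
  apply: le_trans (ler_normD _ _) _; apply: lerD.
    apply: le_trans (ler_norm_sum _ _ _) _; rewrite /D big_distrr /=.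
    by apply: ler_sum => i _; exact: bstep.
  by apply: le_trans (ler_normB _ _) _; have := bB j.+1 N; have := bB j.+1 0%N; lra.
have S0 j N : `|\sum_(n < N) b 0%N n - \sum_(n < N) b j n| <= j%:R * (Bd * D N + 2 * Bd).
  elim: j => [|j IHj]; first by rewrite subrr normr0 mul0r.
  have -> : \sum_(n < N) b 0%N n - \sum_(n < N) b j.+1 n =
    (\sum_(n < N) b 0%N n - \sum_(n < N) b j n) + (\sum_(n < N) b j n - \sum_(n < N) b j.+1 n).
    by rewrite addrA subrK.
  apply: le_trans (ler_normD _ _) _; rewrite -natr1 mulrDl mul1r.
  by apply: lerD; [exact: IHj|exact: Sstep].
apply: (@cesaro_null_dominated _ _ (step_dist ^~ x) (m%:R * Bd) (m%:R * (2 * Bd))).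
- by rewrite mulr_ge0.
- exact: step_dist_null.
move=> N; rewrite [X in _ * X + _]ger0_norm; last exact: D0.
rewrite -mulrA -mulrDr -/(D N).
have -> : \sum_(n < N) gexp n (fun g => gain x (x * g)%g) = \sum_(n < N) b 0%N n.
  apply: eq_bigr => n _; apply: eq_pexp => l _ _.
  by rewrite expg0 invg1 mulg1.
have m0R : 0 < m%:R :> R by rewrite ltr0n.
rewrite -(ler_pM2l m0R) -[X in X * `|_| <= _]gtr0_norm // -normrM.
have -> : m%:R * (\sum_(n < N) b 0%N n) =
    \sum_(j < m) (\sum_(n < N) b 0%N n - \sum_(n < N) b j n).
  by rewrite sumrB sumr_const card_ord exchange_big /= [X in _ - X]big1 ?subr0 ?mulr_natl.
apply: le_trans (ler_norm_sum _ _ _) _.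
have -> : m%:R * (m%:R * (Bd * D N + 2 * Bd)) = \sum_(j < m) m%:R * (Bd * D N + 2 * Bd).
  by rewrite sumr_const card_ord mulr_natl.
apply: ler_sum => j _; apply: le_trans (S0 _ _) _.
by rewrite ler_wpM2r ?ler_nat ?(ltnW (ltn_ord j)) // addr_ge0 // mulr_ge0.
Qed.

Lemma zero_drift : (forall x, x \in s -> exists m, (0 < m)%N /\ (x ^+ m = 1)%g) ->
  gexp N (fun g => norm g) / N%:R @[N --> \oo] --> (0 : R).
Proof.
move=> tors; pose a n := \sum_(x <- s) p x * gexp n (fun g => gain x (x * g)%g).
have an : cesaro_null a.
  apply: cesaro_null_sum => x xs; apply: cesaro_nullZ.
  by have [m [m0 xm]] := tors x xs; exact: gain_null m0 xm.
have LE N : gexp N (fun g => norm g) = \sum_(n < N) a n.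
  elim: N => [|N IHN].
    rewrite big_ord0 gexp0; have := word_norm_le (has_word1 S).
    by rewrite leqn0 => /eqP->.
  rewrite big_ord_recr /= -IHN gexpS /a.
  under [X in _ + X]eq_bigr => x _.
    rewrite /gain gexpB mulrBr (_ : gexp N (fun h => norm (x^-1 * (x * h))%g) = gexp N (fun g => norm g)).
      over.
    by apply: eq_pexp => l _ _; rewrite mulKg.
  by rewrite sumrB -big_distrl /= p1 mul1r addrC subrK.
suff lim e : 0 < e -> \forall N \near \oo, `|0 - gexp N (fun g => norm g) / N%:R| <= e.
  by apply/cvgrPdist_le => e; exact: lim.
move=> e0; have [N0 N0P] := an _ e0.
near=> N; rewrite sub0r normrN normrM normfV [X in _ / X]ger0_norm //.
have N1 : (0 < N)%N by near: N; exact: nbhs_infty_gt.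
rewrite ler_pdivrMr ?ltr0n // LE; apply: N0P.
by near: N; exact: nbhs_infty_ge.
Unshelve. all: by end_near. Qed.
End ZeroEntropy.

(** * Recurrence of walks by torsion elements *)

Section FiniteSums.
Variables (R : realType) (Y : choiceType).
Implicit Types f g : Y -> R.

Definition ysum f : R := \sum_(y \in [set: Y]) f y.

Definition vanishes_off f (D : seq Y) := forall y, y \notin D -> f y = 0.

Definition finitary f := exists D, vanishes_off f D.

Lemma ysumE f D : uniq D -> vanishes_off f D -> ysum f = \sum_(y <- D) f y.
Proof.
move=> uD fD; rewrite /ysum (fsbigTE [fset y | y in D]%fset); last first.
  by move=> y; rewrite inE /= => /fD.
by apply: perm_big; apply: uniq_perm => // y; rewrite inE.
Qed.

Lemma finitaryP f g : finitary f -> finitary g -> exists D, [/\ uniq D,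
  vanishes_off f D & vanishes_off g D].
Proof.
move=> [D fD] [E gE]; exists (undup (D ++ E)); split=> [|y|y]; first exact: undup_uniq.
  by rewrite mem_undup mem_cat negb_or => /andP[/fD].
by rewrite mem_undup mem_cat negb_or => /andP[_ /gE].
Qed.

Lemma finitaryB f g : finitary f -> finitary g -> finitary (fun y => f y - g y).
Proof.
move=> ff fg; have [D [_ fD gD]] := finitaryP ff fg; exists D => y yD.
by rewrite fD // gD // subrr.
Qed.

Lemma finitaryM f g : finitary f -> finitary (fun y => f y * g y).
Proof. by move=> [D fD]; exists D => y /fD->; rewrite mul0r. Qed.

Lemma finitary_sum (I : Type) (r : seq I) (F : I -> Y -> R) :
  (forall i, finitary (F i)) -> finitary (fun y => \sum_(i <- r) F i y).
Proof.
move=> fF; elim: r => [|i r [D rD]]; first by exists [::] => y _; rewrite big_nil.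
have [E iE] := fF i; exists (D ++ E) => y; rewrite mem_cat negb_or => /andP[yD yE].
by rewrite big_cons iE // rD // addr0.
Qed.

Lemma ysumB f g : finitary f -> finitary g -> ysum (fun y => f y - g y) = ysum f - ysum g.
Proof.
move=> ff fg; have [D [uD fD gD]] := finitaryP ff fg.
rewrite !(ysumE uD) // ?sumrB // => y yD.
by rewrite fD // gD // subrr.
Qed.

Lemma ysumZ a f : finitary f -> ysum (fun y => a * f y) = a * ysum f.
Proof.
move=> ff; have [D [uD fD _]] := finitaryP ff ff.
by rewrite !(ysumE uD) // ?big_distrr // => y yD; rewrite fD // mulr0.
Qed.

Lemma le_ysum f g : finitary f -> finitary g -> (forall y, f y <= g y) -> ysum f <= ysum g.
Proof.
move=> ff fg fg_le; have [D [uD fD gD]] := finitaryP ff fg.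
by rewrite !(ysumE uD) //; apply: ler_sum.
Qed.

Lemma ysum_ge0 f : finitary f -> (forall y, 0 <= f y) -> 0 <= ysum f.
Proof.
by move=> ff f0; have [D [uD fD _]] := finitaryP ff ff; rewrite (ysumE uD fD) sumr_ge0.
Qed.

Variables (H : groupType) (act : right_action H Y).

Lemma finitary_shift f h : finitary f -> finitary (fun y => f (act y h)).
Proof.
move=> [D fD]; exists [seq act y h^-1%g | y <- D] => y yD; apply: fD.
apply: contra yD => yhD; apply/mapP; exists (act y h) => //.
by rewrite -ractM mulgV ract1.
Qed.

Lemma ysum_shift f h : ysum (fun y => f (act y h)) = ysum f.
Proof.
apply/esym/(reindex_fsbigT (fun y => act y h) f).
by exists (fun y => act y h^-1%g) => y; rewrite -ractM ?mulgV ?mulVg ract1.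
Qed.

(** The sector condition. As [h] has order [m], the transitions [y -> y h]
    decompose into cycles of length [m], on which [u - u h] has mean zero; so
    the antisymmetric part of the walk is controlled by its Dirichlet form. *)
Lemma sector_condition (phi u : Y -> R) h m (t eta : R) :
  (0 < m)%N -> (h ^+ m = 1)%g -> 0 < t -> finitary phi -> finitary u ->
  (forall j, ysum (fun y => (phi (act y (h ^+ j)%g) - phi y) ^+ 2) <= eta) ->
  ysum (fun y => phi y * (u y - u (act y h))) <=
    t * eta / 2 + ysum (fun y => (u y - u (act y h)) ^+ 2) / (2 * t).
Proof.
move=> m0 hm t0 fphi fu phi_eta; pose du y := u y - u (act y h).
have fdu : finitary du by apply: finitaryB => //; exact: finitary_shift.
pose b j := ysum (fun y => phi y * u (act y (h ^+ j)%g)).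
have m0R : 0 < m%:R :> R by rewrite ltr0n.
set rhs := _ + _.
have step j : ysum (fun y => phi y * du y) - (b j - b j.+1) <= rhs.
  pose hj := (h ^+ j)%g; have fd : finitary (fun y => phi y * du y) by exact: finitaryM.
  have fdj : finitary (fun y => phi (act y hj) * du (act y hj)) := finitary_shift hj fd.
  have fdj' : finitary (fun y => phi y * du (act y hj)) by exact: finitaryM.
  have fduj : finitary (fun y => du (act y hj) ^+ 2).
    by apply: finitaryM; exact: finitary_shift.
  have fphij : finitary (fun y => (phi (act y hj) - phi y) ^+ 2).
    by apply: finitaryM; apply: finitaryB => //; exact: finitary_shift.
  have scale a f : finitary f -> finitary (fun y => a * f y).
    by move=> [D DP]; exists D => y /DP->; rewrite mulr0.
  have -> : b j - b j.+1 = ysum (fun y => phi y * du (act y hj)).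
    rewrite /b -ysumB; try exact: finitaryM.
    by congr ysum; apply/funext => y; rewrite /du -mulrBr -ractM -expgSr.
  rewrite -(ysum_shift (fun y => phi y * du y) hj) -ysumB //.
  have -> : rhs = t / 2 * eta + (2 * t)^-1 * ysum (fun y => du y ^+ 2).
    by rewrite /rhs; congr (_ + _); [ring|rewrite mulrC].
  rewrite -(ysum_shift (fun y => du y ^+ 2) hj).
  have t20 : 0 < t / 2 by rewrite divr_gt0.
  apply: (@le_trans _ _ (t / 2 * ysum (fun y => (phi (act y hj) - phi y) ^+ 2)
      + (2 * t)^-1 * ysum (fun y => du (act y hj) ^+ 2))); last first.
    by rewrite lerD2r ler_pM2l //; exact: phi_eta.
  rewrite -!ysumZ // -lerBlDr -ysumB; [|exact: finitaryB|exact: scale].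
  apply: le_ysum; [by apply: finitaryB; [exact: finitaryB|exact: scale]|exact: scale|].
  move=> y; rewrite -mulrBl; set a := phi (act y hj) - phi y; set d := du (act y hj).
  rewrite lerBlDr.
  have -> : t / 2 * a ^+ 2 + (2 * t)^-1 * d ^+ 2 = (d ^+ 2 + (t * a) ^+ 2) / (2 * t).
    by field; rewrite gt_eqF.
  rewrite ler_pdivlMr ?mulr_gt0 //.
  by have := sqr_ge0 (t * a - d); rewrite !expr2; nra.
have sum_b : \sum_(j < m) (b j - b j.+1) = 0.
  rewrite -(big_mkord predT (fun j => b j - b j.+1)).
  transitivity (- \sum_(0 <= j < m) (b j.+1 - b j)).
    by rewrite -sumrN; apply: eq_bigr => j _; rewrite opprB.
  rewrite telescope_sumr // /b hm expg0; apply/eqP.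
  by rewrite oppr_eq0 subrr.
have : \sum_(j < m) (ysum (fun y => phi y * du y) - (b j - b j.+1)) <= \sum_(j < m) rhs.
  by apply: ler_sum => j _; exact: step.
by rewrite sumrB sum_b subr0 !sumr_const card_ord ler_pMn2r.
Qed.
End FiniteSums.

(** * Test functions of small energy on spaces of quadratic growth *)

Section LogCutoff.
Variable R : realType.

Definition harm n : R := \sum_(i < n) i.+1%:R^-1.

Lemma harm_ge0 n : 0 <= harm n.
Proof. by apply: sumr_ge0 => i _; rewrite invr_ge0. Qed.

Lemma harmD_le n j : harm (n + j) - harm n <= j%:R / n.+1%:R.
Proof.
elim: j => [|j IHj]; first by rewrite addn0 subrr mul0r.
rewrite addnS /harm big_ord_recr /= -/(harm (n + j)) -[j.+1%:R]natr1 mulrDl mul1r addrAC.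
apply: lerD => //; rewrite lef_pV2 ?posrE ?ltr0n // ler_nat.
by rewrite ltnS leq_addr.
Qed.

Lemma harm_le m n : (m <= n)%N -> harm m <= harm n.
Proof.
move=> /subnKC <-; elim: (n - m)%N => [|j IHj]; first by rewrite addn0.
by rewrite addnS /harm big_ord_recr /=; apply: le_trans IHj _; rewrite lerDl invr_ge0.
Qed.

Lemma harm_exp2 m : m%:R / 2 <= harm (2 ^ m).
Proof.
elim: m => [|m IHm]; first by rewrite mul0r harm_ge0.
have half n : 2^-1 <= harm (n.+1 + n.+1) - harm n.+1.
  have h j : (j <= n.+1)%N -> j%:R / (n.+1 + n.+1)%:R <= harm (n.+1 + j) - harm n.+1.
    elim: j => [|j IHj] jn; first by rewrite mul0r addn0 subrr.
    rewrite [(n.+1 + j.+1)%N]addnS /harm big_ord_recr /= -/(harm (n.+1 + j)) -[j.+1%:R]natr1 mulrDl mul1r addrAC.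
    apply: lerD; first by apply: IHj; exact: ltnW.
    rewrite lef_pV2 ?posrE ?ltr0n // ler_nat; lia.
  apply: le_trans (h n.+1 (leqnn _)).
  by rewrite natrD ler_pdivlMr ?addr_gt0 ?ltr0n //; lra.
rewrite expnS mul2n -addnn -natr1 mulrDl.
have : (0 < 2 ^ m)%N by rewrite expn_gt0.
case: (2 ^ m)%N IHm => // n IHm _; have := half n; lra.
Qed.

Lemma harm_unbounded (B : R) : exists n, B <= harm n.
Proof.
exists (2 ^ (Num.truncn (2 * `|B|)).+1)%N; apply: le_trans (harm_exp2 _).
have := truncnS_gt (2 * `|B|); have := ler_norm B; lra.
Qed.

Lemma harm_lip c r r' : (r <= r' + c)%N -> (r' <= r + c)%N ->
  `|harm r - harm r'| <= (c * c.+1)%:R / r.+1%:R.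
Proof.
move=> h1 h2; have [le|/ltnW le] := leqP r r'.
  rewrite distrC ger0_norm ?subr_ge0 ?harm_le //.
  rewrite -(subnKC le); apply: le_trans (harmD_le _ _) _.
  by rewrite ler_pM2r ?invr_gt0 ?ltr0n // ler_nat mulnS; lia.
rewrite ger0_norm ?subr_ge0 ?harm_le // -{1}(subnKC le).
apply: le_trans (harmD_le _ _) _.
rewrite ler_pdivrMr ?ltr0n // mulrAC ler_pdivlMr ?ltr0n // -!natrM ler_nat.
have := leq_mul (leqnn c) (leqnn r'); nia.
Qed.

Variables (H : groupType) (Y : choiceType) (act : right_action H Y).
Hypothesis planar : polynomial_spheres act 1.

(** A logarithmic cutoff: its slope at distance [r] is of order [1 / (r * ln N)], and the
    sphere of radius [r] has [O(r)] points, so its energy is of order [1 / ln N]. *)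
Lemma small_energy (o : Y) (K : seq H) (eta : R) : 0 < eta ->
  exists phi : Y -> R, [/\ finitary phi, phi o = 1, forall y, 0 <= phi y <= 1
    & forall k, k \in K -> ysum (fun y => (phi (act y k) - phi y) ^+ 2) <= eta].
Proof.
move=> eta0; have [rho [sph [C [rhoo insph sizesph lip]]]] := planar o.
have [lipc lipcP] : {f : H -> nat & forall h y, (rho (act y h) <= rho y + f h)%N}.
  exact: (choice lip).
have [c cP] : exists c, forall k, k \in K -> (lipc k <= c)%N /\ (lipc k^-1%g <= c)%N.
  exists (\max_(k <- K ++ [seq k^-1%g | k <- K]) lipc k) => k kK; split.
    by rewrite (big_rem k) ?mem_cat ?kK //= leq_maxl.
  by rewrite (big_rem k^-1%g) ?mem_cat ?map_f ?orbT //= leq_maxl.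
pose Q : R := C%:R * (c * c.+1)%:R ^+ 2.
have Q0 : 0 <= Q by rewrite mulr_ge0 // exprn_ge0.
have [N NP] := harm_unbounded (1 + c%:R + 2 * Q / eta).
set h := harm N in NP.
have q0 : 0 <= 2 * Q / eta by rewrite divr_ge0 ?mulr_ge0 // ltW.
have c0 : 0 <= c%:R :> R by [].
have h0 : 0 < h by lra.
pose Phi r : R := 1 - Num.min 1 (harm r / h).
have Phi1 r : (N <= r)%N -> Phi r = 0.
  move=> Nr; rewrite /Phi min_l ?subrr // ler_pdivlMr // mul1r; exact: harm_le.
have Philip r r' : `|Phi r - Phi r'| <= `|harm r - harm r'| / h.
  have -> : `|harm r - harm r'| / h = `|harm r / h - harm r' / h|.
    by rewrite -mulrBl normrM [X in _ = _ * X]gtr0_norm // invr_gt0.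
  rewrite /Phi; set x := harm r / h; set y := harm r' / h.
  have h1 := ler_norm (x - y); have h2 := ler_norm (y - x); rewrite distrC in h2.
  by rewrite ler_norml /Num.min; case: ltP => hx; case: ltP => hy; apply/andP; split; lra.
have finphi : finitary (fun y => Phi (rho y)).
  exists (flatten [seq sph r | r <- iota 0 N]) => y yN; apply: Phi1.
  rewrite leqNgt; apply: contra yN => yN; apply/flattenP; exists (sph (rho y)) => //.
  by apply: map_f; rewrite mem_iota.
exists (fun y => Phi (rho y)); split=> //.
- by rewrite rhoo /Phi /harm big_ord0 mul0r min_r ?subr0.
- move=> y; have : 0 <= harm (rho y) / h.
    by rewrite divr_ge0 ?harm_ge0 // ltW.
  by rewrite /Phi /Num.min; case: ltP => ?; lra.
move=> k kK; have [ck ck'] := cP k kK.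
have lip1 y : (rho (act y k) <= rho y + c)%N.
  by apply: leq_trans (lipcP _ _) _; rewrite leq_add2l.
have lip2 y : (rho y <= rho (act y k) + c)%N.
  have := lipcP k^-1%g (act y k); rewrite -ractM mulgV ract1 => /leq_trans; apply.
  by rewrite leq_add2l.
have fsq : finitary (fun y => (Phi (rho (act y k)) - Phi (rho y)) ^+ 2).
  apply: finitaryM; apply: (finitaryB _ finphi).
  exact: (@finitary_shift _ _ _ act _ k finphi).
have [D [uD vD _]] := finitaryP fsq fsq; rewrite (ysumE uD vD).
pose g r : R := ((c * c.+1)%:R / r.+1%:R / h) ^+ 2.
have g0 r : 0 <= g r by exact: sqr_ge0.
have bound y : (Phi (rho (act y k)) - Phi (rho y)) ^+ 2 <=
    \sum_(r < N + c) (rho y == r)%:R * g r.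
  have [lt|le] := ltnP (rho y) (N + c).
    rewrite (bigD1 (Ordinal lt)) //= eqxx mul1r; apply: ler_wpDr.
      by apply: sumr_ge0 => r _; rewrite mulr_ge0.
    have lb : `|Phi (rho (act y k)) - Phi (rho y)| <= (c * c.+1)%:R / (rho y).+1%:R / h.
      rewrite distrC; apply: le_trans (Philip _ _) _.
      by rewrite ler_pM2r ?invr_gt0 //; exact: harm_lip.
    rewrite /g -[X in X <= _]real_normK ?num_real // ler_pXn2r ?nnegrE //.
    exact: le_trans lb.
  rewrite !Phi1; first by rewrite subrr expr0n sumr_ge0 // => r _; rewrite mulr_ge0.
    exact: leq_trans (leq_addr _ _) le.
  by have := lip2 y; lia.
apply: le_trans (ler_sum _ (fun y _ => bound y)) _.
rewrite exchange_big /=.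
have cnt r : \sum_(y <- D) (rho y == r)%:R * g r <= (C * r.+1)%:R * g r.
  rewrite -big_distrl ler_wpM2r //= -natr_sum ler_nat.
  apply: leq_trans (_ : size [seq y <- D | rho y == r] <= _)%N.
    by rewrite size_filter -sum1_count [leqRHS]big_mkcond /=; apply: leq_sum => y _; case: eqP.
  apply: leq_trans (uniq_leq_size _ _) (_ : (size (sph r) <= _)%N); first exact: filter_uniq.
    by move=> y; rewrite mem_filter => /andP[/eqP<- _].
  by have := sizesph r; rewrite expn1.
have : \sum_(r < N + c) \sum_(y <- D) (rho y == r)%:R * g r <= \sum_(r < N + c) Q / h ^+ 2 * r.+1%:R^-1.
  apply: ler_sum => r _; apply: le_trans (cnt r) _; rewrite le_eqVlt; apply/orP; left; apply/eqP.
  by rewrite /g /Q natrM; field; rewrite nat1r pnatr_eq0 /= gt_eqF.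
move=> /le_trans; apply; rewrite -big_distrr /= -/(harm (N + c)).
have hc : harm (N + c) <= h + c%:R.
  have : c%:R / N.+1%:R <= c%:R :> R.
    by rewrite ler_pdivrMr ?ltr0n // ler_peMr // ler1n.
  by have := harmD_le N c; rewrite -/h; set q := c%:R / _; lra.
apply: (@le_trans _ _ (Q / h ^+ 2 * (2 * h))).
  apply: ler_wpM2l; first by rewrite divr_ge0 ?sqr_ge0.
  by lra.
have -> : Q / h ^+ 2 * (2 * h) = 2 * Q / h by field; rewrite gt_eqF.
rewrite ler_pdivrMr // [leRHS]mulrC -ler_pdivrMr //.
by apply: le_trans NP; rewrite lerDr addr_ge0.
Qed.
End LogCutoff.

Section Recurrence.
Variables (R : realType) (T : eqType) (s : seq T) (p : T -> R).
Hypotheses (p0 : forall x, 0 <= p x) (p1 : \sum_(x <- s) p x = 1).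
Hypothesis ps : forall x, x \in s -> 0 < p x.
Variables (H : groupType) (Y : choiceType) (act : right_action H Y) (top : T -> H).

Definition pos (y : Y) (l : seq T) : Y := foldl (fun y x => act y (top x)) y l.

Fixpoint hits (o y : Y) (l : seq T) : bool :=
  (y == o) || (if l is x :: l' then hits o (act y (top x)) l' else false).

Definition noreturn o (l : seq T) : bool :=
  if l is x :: l' then ~~ hits o (act o (top x)) l' else true.

Definition trans n y z : R := pexp s p n (fun l => (pos y l == z)%:R).
Definition escape o n : R := pexp s p n (fun l => (noreturn o l)%:R).

(** The terms are the probabilities that the last visit to [o] is at time [i]. *)
Lemma last_visit o y n :
  \sum_(i < n.+1) trans i y o * escape o (n - i) = pexp s p n (fun l => (hits o y l)%:R).
Proof.
elim: n y => [|n IHn] y.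
  by rewrite big_ord_recl big_ord0 addr0 /trans /escape /= orbF mulr1.
rewrite big_ord_recl /= {1}/trans /= subn0.
have -> : \sum_(i < n.+1) trans (bump 0 i) y o * escape o (n.+1 - bump 0 i) =
    \sum_(x <- s) p x * pexp s p n (fun l => (hits o (act y (top x)) l)%:R).
  under eq_bigr => i _ do rewrite /bump add1n subSS /trans /= big_distrl /=.
  rewrite exchange_big /=; apply: eq_bigr => x _; rewrite -IHn big_distrr /=.
  by apply: eq_bigr => i _; rewrite mulrA.
case: eqVneq => [->|yo] /=; last by rewrite mul0r add0r.
rewrite mul1r /escape /= -big_split /=; apply: eq_bigr => x _.
rewrite -mulrDr -pexpD; congr (_ * _); apply: eq_pexp => l _ _.
by case: hits; rewrite ?add0r ?addr0.
Qed.

Lemma hits_cat o y l1 l2 : hits o y l1 -> hits o y (l1 ++ l2).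
Proof.
elim: l1 y => [|x l1 IHl] y /=; first by rewrite orbF => /eqP->; case: l2 => /= *; rewrite eqxx.
by case/orP => [->//|/IHl ->]; rewrite orbT.
Qed.

Lemma escapeS o n : escape o n.+1 <= escape o n.
Proof.
rewrite {1}/escape -addn1 pexp_cat; apply: le_pexp => // l _ _.
rewrite -[leRHS](pexp_cst p1 1); apply: le_pexp => // l' _ _; rewrite ler_nat.
case: l => [|x l] /=; first by case: noreturn.
by have := @hits_cat o (act o (top x)) l l'; do 2 case: hits => //; move/(_ isT).
Qed.

Lemma escape_le o m n : (m <= n)%N -> escape o n <= escape o m.
Proof.
move=> /subnKC <-; elim: (n - m)%N => [|j IHj]; first by rewrite addn0.
by rewrite addnS; apply: le_trans (escapeS _ _) IHj.
Qed.

Lemma escape_green o n : escape o n * \sum_(i < n.+1) trans i o o <= 1.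
Proof.
have -> : 1 = \sum_(i < n.+1) trans i o o * escape o (n - i).
  rewrite last_visit -[LHS](pexp_cst p1 n); apply: eq_pexp => l _ _.
  by case: l => /= *; rewrite eqxx.
rewrite big_distrr /=; apply: ler_sum => i _; rewrite mulrC ler_wpM2l //.
  exact: pexp_ge0.
by apply: escape_le; exact: leq_subr.
Qed.

Lemma pos_cat y l1 l2 : pos y (l1 ++ l2) = pos (pos y l1) l2.
Proof. exact: foldl_cat. Qed.

Lemma trans0 o y : trans 0 o y = (o == y)%:R.
Proof. by []. Qed.

Lemma transS n o y : trans n.+1 o y = \sum_(x <- s) p x * trans n o (act y (top x)^-1%g).
Proof.
rewrite {1}/trans -addn1 pexp_cat.
transitivity (pexp s p n (fun l => \sum_(x <- s) p x * (pos o l == act y (top x)^-1%g)%:R)).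
  apply: eq_pexp => l _ _; apply: eq_bigr => x _; rewrite pos_cat; congr (_ * _%:R).
  congr nat_of_bool.
  by apply/eqP/eqP => /= [<-|->]; rewrite -ractM ?mulgV ?mulVg ract1.
by rewrite pexp_sum; apply: eq_bigr => x _; rewrite pexpZ.
Qed.

Lemma trans_ge0 n y z : 0 <= trans n y z.
Proof. exact: pexp_ge0. Qed.

Lemma trans_finitary n o : finitary (trans n o).
Proof.
elim: n => [|n IHn].
  by exists [:: o] => y; rewrite inE trans0 eq_sym => /negPf->.
have -> : trans n.+1 o = fun y => \sum_(x <- s) p x * trans n o (act y (top x)^-1%g).
  by apply/funext => y; exact: transS.
apply: finitary_sum => x; have [D DP] := @finitary_shift _ _ _ act _ (top x)^-1%g IHn.
by exists D => y /DP->; rewrite mulr0.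
Qed.

Hypothesis tors : forall x, x \in s -> exists m, (0 < m)%N /\ (top x ^+ m = 1)%g.
Hypothesis planar : polynomial_spheres act 1.

Lemma return_path y l : {subset l <= s} -> exists l', {subset l' <= s} /\ pos (pos y l) l' = y.
Proof.
elim: l y => [|x l IHl] y ls; first by exists [::].
have [|l' [l's l'P]] := IHl (act y (top x)).
  by move=> z zl; apply: ls; rewrite in_cons zl orbT.
have xs : x \in s by apply: ls; rewrite mem_head.
have [m [m0 xm]] := tors xs; exists (l' ++ nseq m.-1 x); split.
  by move=> z; rewrite mem_cat => /orP[/l's//|]; rewrite mem_nseq => /andP[_ /eqP->].
rewrite pos_cat /= l'P.
have -> : forall k z, pos z (nseq k x) = act z (top x ^+ k)%g.
  by elim=> [|k IHk] z /=; rewrite ?ract1 // IHk -ractM -expgS.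
by rewrite -ractM -expgS prednK // xm ract1.
Qed.

(** A bound for the Green function at [o] gives one at every other point, by
    returning to [o]. *)
Lemma green_bounded o B : (forall N, \sum_(n < N) trans n o o <= B) ->
  forall y, exists C, forall N, \sum_(n < N) trans n o y <= C.
Proof.
move=> oB y; have [[l [ls oly]]|none] := pselect (exists l, {subset l <= s} /\ pos o l = y).
  have [l' [l's yl'o]] := return_path o ls; rewrite oly in yl'o.
  pose q := trans (size l') y o.
  have q0 : 0 < q by apply: (pexp_gt0 p0 p1 (l := l')) => //; rewrite yl'o eqxx.
  exists (B / q) => N; rewrite ler_pdivlMr // big_distrl /=.
  apply: le_trans (oB (N + size l')%N); rewrite addnC big_split_ord /=.
  apply: ler_wpDl; first by apply: sumr_ge0 => n _; exact: trans_ge0.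
  apply: ler_sum => n _; rewrite {2}/trans addnC pexp_cat /q mulrC -pexpZ.
  apply: le_pexp => // l1 _ _; rewrite /trans; case: eqP => [<-|_]; rewrite ?mulr1 ?mulr0.
    by apply: le_pexp => // l2 _ _; rewrite pos_cat.
  exact: pexp_ge0.
exists 0 => N; rewrite big1 // => n _; rewrite /trans -(pexp_cst p1 n 0).
apply: eq_pexp => l _ ls; case: eqP => // oly; case: none; exists l; by split.
Qed.

(** Were the Green function at [o] bounded, so would be the energy of the occupation
    density [u] up to any time [N]. The Laplacian of [u] is the point mass at [o] minus
    the law at time [N]; its pairing with a cutoff [phi] of small energy is at least
    1 / 2 once half of the mass has left the support of [phi]. The sector condition
    bounds the same pairing by 1 / 4. *)
Lemma green_unbounded o (B : R) : 0 < B -> exists N, B < \sum_(n < N) trans n o o.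
Proof.
move=> B0; apply: contrapT => none.
have oB N : \sum_(n < N) trans n o o <= B.
  by rewrite leNgt; apply/negP => h; apply: none; exists N.
have [ord ordP] : {f : T -> nat & forall x, x \in s -> (0 < f x)%N /\ (top x ^+ f x = 1)%g}.
  apply: (@choice _ _ (fun x n => x \in s -> (0 < n)%N /\ (top x ^+ n = 1)%g)) => x.
  have [xs|xs] := boolP (x \in s); last by exists 0%N.
  by have [m mP] := tors xs; exists m.
pose K := [seq ((top x)^-1 ^+ j)%g | x <- s, j <- iota 0 (ord x)].
have KP x j : x \in s -> ((top x)^-1 ^+ j)%g \in K.
  move=> xs; have [ord0 xo] := ordP x xs.
  have -> : ((top x)^-1 ^+ j = (top x)^-1 ^+ (j %% ord x))%g.
    by rewrite {1}(divn_eq j (ord x)) expgnDr mulnC expgnA expVgn xo invg1 expg1n mul1g.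
  by apply/allpairsPdep; exists x, (j %% ord x)%N; split=> //; rewrite mem_iota ltn_mod.
pose t := 8 * B; have t0 : 0 < t by rewrite mulr_gt0.
have eta0 : 0 < (4 * t)^-1 by rewrite invr_gt0 mulr_gt0.
have [phi [fphi phio phi01 phiK]] := small_energy planar o K eta0.
have [D [uD phiD _]] := finitaryP fphi fphi.
pose mass N := ysum (fun y => phi y * trans N o y).
have [N massN] : exists N, mass N <= 1 / 2.
  apply: contrapT => big.
  have lt N : 1 / 2 < mass N by rewrite ltNge; apply/negP => h; apply: big; exists N.
  have [C CP] : {C : Y -> R & forall y N, \sum_(n < N) trans n o y <= C y}.
    apply: (@choice _ _ (fun y C => forall N, \sum_(n < N) trans n o y <= C)) => y.
    exact: green_bounded oB y.
  have massE N : mass N <= \sum_(y <- D) trans N o y.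
    rewrite /mass (ysumE uD) => [|y /phiD->]; last by rewrite mul0r.
    by apply: ler_sum => y _; have /andP[_ phi1] := phi01 y; rewrite ler_piMl ?trans_ge0.
  pose N := (Num.truncn (2 * `|\sum_(y <- D) C y|)).+1.
  have : \sum_(n < N) (1 / 2 : R) <= \sum_(n < N) mass n by apply: ler_sum => n _; apply/ltW.
  have : \sum_(n < N) mass n <= \sum_(y <- D) C y.
    apply: (@le_trans _ _ (\sum_(n < N) \sum_(y <- D) trans n o y)).
      by apply: ler_sum => n _; exact: massE.
    rewrite exchange_big /=.
    by apply: ler_sum => y _; exact: CP.
  rewrite sumr_const card_ord -mulr_natr => h1 h2.
  have := truncnS_gt (2 * `|\sum_(y <- D) C y|); rewrite -/N.
  by have := ler_norm (\sum_(y <- D) C y); lra.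
pose u y := \sum_(n < N) trans n o y.
have fu : finitary u by apply: finitary_sum => n; exact: trans_finitary.
have u0 y : 0 <= u y by apply: sumr_ge0 => n _; exact: trans_ge0.
pose d x y := u y - u (act y (top x)^-1%g).
have ushift x : finitary (fun y => u (act y (top x)^-1%g)) by exact: finitary_shift.
have fd x : finitary (d x) by exact: finitaryB.
have lapl y : \sum_(x <- s) p x * d x y = (o == y)%:R - trans N o y.
  under eq_bigr do rewrite mulrBr; rewrite sumrB -big_distrl /= p1 mul1r.
  have -> : \sum_(x <- s) p x * u (act y (top x)^-1%g) = \sum_(n < N) trans n.+1 o y.
    under eq_bigr do rewrite big_distrr /=.
    by rewrite exchange_big /=; apply: eq_bigr => n _; rewrite transS.
  rewrite -sumrB -opprB -[X in _ = - (_ - X)]trans0; apply/eqP; rewrite -eqr_oppLR -sumrN.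
  under eq_bigr do rewrite opprB.
  by rewrite -(big_mkord predT (fun n => trans n.+1 o y - trans n o y)) telescope_sumr.
have pair f : finitary f -> \sum_(x <- s) p x * ysum (fun y => f y * d x y) =
    f o - ysum (fun y => f y * trans N o y).
  move=> ff; have [E [uE fE tE]] := finitaryP ff (trans_finitary N o).
  have fEg (g : Y -> R) : vanishes_off (fun y => f y * g y) E by move=> y /fE->; rewrite mul0r.
  have delta : ysum (fun y => f y * (o == y)%:R) = f o.
    have [oE|oE] := boolP (o \in E).
      rewrite (ysumE uE) // (bigD1_seq o) //= eqxx mulr1 big1 ?addr0 // => y.
      by rewrite eq_sym => /negPf->; rewrite mulr0.
    rewrite (ysumE uE) // fE // big_seq big1 // => y yE.
    by case: eqP yE oE => [->->//|]; rewrite mulr0.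
  rewrite -delta -ysumB; try exact: finitaryM.
  rewrite (ysumE uE); last by move=> y /fE->; rewrite !mul0r subr0.
  under eq_bigr do rewrite (ysumE uE) // big_distrr /=.
  rewrite exchange_big /=; apply: eq_bigr => y _; rewrite -mulrBr -lapl big_distrr /=.
  by apply: eq_bigr => x _; rewrite mulrCA.
have energy : \sum_(x <- s) p x * ysum (fun y => d x y ^+ 2) <= 2 * B.
  have -> : \sum_(x <- s) p x * ysum (fun y => d x y ^+ 2) =
      2 * \sum_(x <- s) p x * ysum (fun y => u y * d x y).
    rewrite big_distrr /=; apply: eq_bigr => x _; rewrite mulrCA; congr (_ * _).
    have fuu : finitary (fun y => u y * u y) by exact: finitaryM.
    have fud : finitary (fun y => 2 * (u y * d x y)).
      by have [E EP] := fu; exists E => y /EP->; rewrite mul0r mulr0.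
    have fdd : finitary (fun y => d x y ^+ 2) by exact: finitaryM.
    rewrite -ysumZ; last exact: finitaryM.
    apply/eqP; rewrite -subr_eq0 -ysumB //.
    have -> : (fun y => d x y ^+ 2 - 2 * (u y * d x y)) =
        fun y => u (act y (top x)^-1%g) * u (act y (top x)^-1%g) - u y * u y.
      by apply/funext => y; rewrite /d; ring.
    rewrite ysumB //; last exact: (@finitary_shift _ _ _ act _ (top x)^-1%g fuu).
    by rewrite (ysum_shift act (fun y => u y * u y)) subrr.
  rewrite pair // ler_pM2l // lerBlDr; apply: le_trans (oB N) _.
  by rewrite lerDl ysum_ge0 //; [exact: finitaryM|move=> y; rewrite mulr_ge0 ?trans_ge0].
have : \sum_(x <- s) p x * ysum (fun y => phi y * d x y) <=
    \sum_(x <- s) p x * (t * (4 * t)^-1 / 2 + ysum (fun y => d x y ^+ 2) / (2 * t)).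
  rewrite !big_seq; apply: ler_sum => x xs; rewrite ler_wpM2l //.
  have [ord0 xo] := ordP x xs.
  apply: (sector_condition (act := act) ord0 _ t0 fphi fu).
    by rewrite expVgn xo invg1.
  by move=> j; apply: phiK; exact: KP.
rewrite pair // phio -/(mass N).
have -> : \sum_(x <- s) p x * (t * (4 * t)^-1 / 2 + ysum (fun y => d x y ^+ 2) / (2 * t)) =
    1 / 8 + (\sum_(x <- s) p x * ysum (fun y => d x y ^+ 2)) / (2 * t).
  rewrite -[X in X / 8 + _]p1 !mulr_suml -big_split /=; apply: eq_bigr => x _.
  by field; rewrite gt_eqF.
have : (\sum_(x <- s) p x * ysum (fun y => d x y ^+ 2)) / (2 * t) <= 1 / 8.
  by rewrite ler_pdivrMr ?mulr_gt0 //; apply: le_trans energy _; rewrite /t; lra.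
by move: massN; set e := _ / (2 * t); lra.
Qed.

Lemma escape_small o (e : R) : 0 < e -> exists N, forall n, (N <= n)%N -> escape o n <= e.
Proof.
move=> e0; have ie0 : 0 < e^-1 by rewrite invr_gt0.
have [N NP] := green_unbounded o ie0; exists N => n Nn.
have gN : e^-1 < \sum_(i < N.+1) trans i o o.
  by apply: lt_le_trans NP _; rewrite big_ord_recr /= lerDl trans_ge0.
apply: le_trans (escape_le o Nn) _.
have gN0 := lt_trans ie0 gN.
have := escape_green o N; rewrite -ler_pdivlMr // => /le_trans; apply.
by rewrite div1r -[leRHS]invrK lef_pV2 ?posrE // ltW.
Qed.
End Recurrence.

(** * Walks on wreath products have zero entropy *)

Section WreathWalk.
Variables (R : realType) (A : finGroupType) (H : groupType) (Y : choiceType).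
Variable act : right_action H Y.
Local Notation W := (wreath A act).
Variables (s : seq W) (p : W -> R).
Hypotheses (p0 : forall x, 0 <= p x) (p1 : \sum_(x <- s) p x = 1).
Hypothesis ps : forall x, x \in s -> 0 < p x.

Variable Z : seq Y.
Hypothesis suppZ : forall x, x \in s -> forall y, y \notin Z -> wbase x y = 1%g.

Fixpoint touched (l : seq W) (y : Y) : bool :=
  (y \in Z) || (if l is x :: l' then touched l' (act y (wtop x)) else false).

(** The first step of [l] visits a point of [Z] for the last time. *)
Definition fresh (l : seq W) : bool := has (fun z => noreturn act (@wtop A H Y act) z l) Z.

Fixpoint fresh_count (l : seq W) : nat :=
  if l is _ :: l' then (fresh l + fresh_count l')%N else 1%N.

(** What an endpoint of the walk retains of the time between two fresh times: a
    displacement, read as a word of length [g], and then lamps over [Z]. *)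
Definition block g (b : W) := exists (e : seq H) (f : finsupp_fun Y A),
  [/\ size e = g, {subset e <= [seq wtop x | x <- s]},
      forall y, y \notin Z -> f y = 1%g
    & b = (wmove A act (\prod_(h <- e) h) * lamp act f)%g].

Fixpoint block_product r n (w : W) : Prop :=
  if r is r'.+1 then exists g m b w', [/\ n = (g + m)%N, block g b, block_product r' m w'
    & w = (b * w')%g]
  else n = 0%N /\ w = 1%g.

Lemma block_product_shift x r n w : x \in s -> block_product r.+1 n w ->
  block_product r.+1 n.+1 (wmove A act (wtop x) * w)%g.
Proof.
move=> xs [g [m [b [w' [-> [e [f [eg es fZ ->]]] w'P ->]]]]].
exists g.+1, m, (wmove A act (\prod_(h <- wtop x :: e) h) * lamp act f)%g, w'; split=> //.
  exists (wtop x :: e), f; split=> //; first by rewrite /= eg.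
  by move=> h; rewrite in_cons => /orP[/eqP->|/es//]; apply: map_f.
by rewrite big_cons wmoveM !mulgA.
Qed.

Lemma hits_touched z y l : z \in Z -> hits act (@wtop A H Y act) z y l -> touched l y.
Proof.
move=> zZ; elim: l y => [|x l IHl] y /=; first by rewrite orbF => /eqP->; rewrite zZ.
by case/orP => [/eqP->|/IHl->]; rewrite ?zZ ?orbT.
Qed.

(** Only the last visits matter: the lamps touched along [l] lie over positions at
    fresh times, and the walk may be replaced by jumps between those. *)
Lemma touched_block_product l (F : finsupp_fun Y A) : {subset l <= s} ->
  (forall y, ~~ touched l y -> F y = 1%g) ->
  block_product (fresh_count l) (size l) (Wreath act F (\prod_(x <- l) wtop x)%g).
Proof.
elim: l F => [|x l IHl] F ls FT.
  exists 0%N, 0%N, (lamp act F), 1%g; rewrite big_nil mulg1; split=> //.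
  exists [::], F; rewrite big_nil wmove1 mul1g; split=> // y yZ.
  by apply: FT; rewrite /= orbF.
have xs : x \in s by apply: ls; rewrite mem_head.
have {}ls : {subset l <= s} by move=> y yl; apply: ls; rewrite in_cons yl orbT.
rewrite big_cons; set h := wtop x; set t := (\prod_(y <- l) wtop y)%g.
pose F2 y := if touched l y then F (act y h^-1%g) else 1%g.
have F2fin : finite_set [set y | F2 y <> 1%g].
  apply: sub_finite_set (translate_fin act F h^-1%g) => y /=.
  by rewrite /F2; case: ifP.
have FT2 : block_product (fresh_count l) (size l) (Wreath act (FinsuppFun F2fin) t).
  by apply: IHl => // y /negPf yl; rewrite /= /F2 yl.
have [q qE] : exists q, fresh_count l = q.+1.
  elim: (l) => [|y l' [q qE]]; first by exists 0%N.
  by exists (fresh (y :: l') + q)%N; rewrite /= qE addnS.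
rewrite qE in FT2; have := block_product_shift xs FT2; rewrite -/h => {}FT2.
rewrite [fresh_count _]/= qE.
case fr : (fresh (x :: l)).
  have VZ y : y \notin Z ->
      (if (y \in Z) && ~~ touched l (act y h) then F y else 1)%g = 1%g by move/negPf->.
  exists 0%N, (size l).+1, (lamp act (fin_fun VZ)),
    (wmove A act h * Wreath act (FinsuppFun F2fin) t)%g; split; last first.
  - suff -> : Wreath act F (h * t)%g = (lamp act (fin_fun VZ) *
        (wmove A act h * Wreath act (FinsuppFun F2fin) t))%g by [].
    apply: wreathP => [y|] /=; rewrite ?mul1g // ract1 /F2 -ractM mulgV ract1.
    case yh: (touched l _) => /=; rewrite ?andbF ?andbT /= ?mul1g ?mulg1 //; case: ifPn => // yZ.
    by apply: FT; rewrite /= (negPf yZ) yh.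
  - exact: FT2.
  - exists [::], (fin_fun VZ); rewrite big_nil wmove1 mul1g; split=> //.
  - by [].
rewrite add0n; suff -> : Wreath act F (h * t)%g =
    (wmove A act h * Wreath act (FinsuppFun F2fin) t)%g by exact: FT2.
apply: wreathP => [y|] //=; rewrite mul1g /F2 -ractM mulgV ract1.
case: ifPn => // yh; apply: FT; rewrite /= negb_or yh andbT.
apply/negP => yZ; move/hasPn: (negbT fr) => /(_ y yZ) /=; rewrite negbK.
by move/(hits_touched yZ); apply/negP.
Qed.

Lemma prod_wbase l : {subset l <= s} ->
  forall y, ~~ touched l y -> wbase (\prod_(x <- l) x)%g y = 1%g.
Proof.
elim: l => [|x l IHl] ls y /=; first by rewrite big_nil.
rewrite negb_or => /andP[yZ yl]; rewrite big_cons /= suppZ ?ls ?mem_head // mul1g.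
by apply: IHl => // z zl; apply: ls; rewrite in_cons zl orbT.
Qed.

Lemma path_block_product l : {subset l <= s} ->
  block_product (fresh_count l) (size l) (\prod_(x <- l) x)%g.
Proof.
move=> ls; have := touched_block_product (F := wbase (\prod_(x <- l) x)%g) ls (prod_wbase ls).
have -> // : Wreath act (wbase (\prod_(x <- l) x)%g) (\prod_(x <- l) wtop x)%g =
    (\prod_(x <- l) x)%g.
apply: wreathP => //=; elim: l {ls} => [|x l IHl]; first by rewrite !big_nil.
by rewrite !big_cons /= IHl.
Qed.

Hypothesis sub : subexponential R H.

Lemma block_cover (d : R) : 0 < d -> exists2 K : R, 0 < K & forall g, exists D : seq W,
  (size D)%:R <= K * expR (d * g%:R) /\ forall b, block g b -> b \in D.
Proof.
move=> d0; have [K K0 KP] := sub [seq wtop x | x <- s] d0.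
have fZ (t : (size Z).-tuple A) y : y \notin Z -> nth 1%g t (index y Z) = 1%g.
  by move=> yZ; rewrite nth_default // size_tuple memNindex.
pose lamps := [seq lamp act (fin_fun (fZ t)) | t : (size Z).-tuple A].
exists (K * (#|A| ^ size Z)%:R) => [|g].
  rewrite mulr_gt0 // ltr0n expn_gt0; apply/orP; left; apply/card_gt0P.
  by exists 1%g.
have [D [sD DP]] := KP g; exists [seq (wmove A act e * f)%g | e <- D, f <- lamps]; split.
  rewrite size_allpairs natrM size_map -cardE card_tuple mulrAC ler_pM2r //.
  by rewrite ltr0n expn_gt0; apply/orP; left; apply/card_gt0P; exists 1%g.
move=> b [e [f [eg es fZ' ->]]]; apply: allpairs_f; first exact: DP.
have sz : size [seq f z | z <- Z] == size Z by rewrite size_map.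
apply/mapP; exists (Tuple sz); first by rewrite mem_enum.
apply: wreathP => //= y; have [yZ|yZ] := boolP (y \in Z).
  by rewrite (nth_map y) ?index_mem // nth_index.
by rewrite fZ' // nth_default // size_map memNindex.
Qed.

(** The slack [d / 2] absorbs the choice of the lengths of the blocks, through a geometric
    series. *)
Lemma block_product_cover (d : R) : 0 < d -> exists2 K : R, 1 <= K & forall r n,
  exists D : seq W, (size D)%:R <= K ^+ r * expR (d * n%:R) /\
    forall w, block_product r n w -> w \in D.
Proof.
move=> d0; have d20 : 0 < d / 2 by rewrite divr_gt0.
have [K0 K00 K0P] := block_cover d20.
pose q : R := expR (- (d / 2)).
have q0 : 0 < q by exact: expR_gt0.
have q1 : q < 1 by rewrite expR_lt1 oppr_lt0.
have q1' : 0 < 1 - q by rewrite subr_gt0.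
pose K := K0 / (1 - q) + 1.
have K1 : 1 <= K by rewrite lerDr divr_ge0 // ltW.
exists K => //; elim=> [|r IHr] n.
  exists [:: 1%g]; split=> [|w [_ ->]]; last by rewrite inE.
  by rewrite expr0 mul1r -[leLHS]expR0 ler_expR mulr_ge0 // ltW.
have [B BP] := choice K0P; have [D DP] := choice IHr.
exists (flatten [seq [seq (b * w)%g | b <- B g, w <- D (n - g)%N] | g <- iota 0 n.+1]); split.
  rewrite size_flatten /shape -map_comp sumnE big_map natr_sum.
  apply: (@le_trans _ _ (\sum_(g <- iota 0 n.+1) K0 * K ^+ r * expR (d * n%:R) * q ^+ g)).
    rewrite !big_seq; apply: ler_sum => g; rewrite mem_iota => /andP[_ gn] /=.
    rewrite size_allpairs natrM.
    apply: le_trans (ler_pM (ler0n _ _) (ler0n _ _) (BP g).1 (DP _).1) _.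
    have ee : expR (d / 2 * g%:R) * expR (d * (n - g)%:R) = expR (d * n%:R) * q ^+ g.
      by rewrite -expRM_natl -!expRD natrB; [congr expR; lra|lia].
    rewrite le_eqVlt; apply/orP; left; apply/eqP; rewrite -[RHS]mulrA -ee; ring.
  rewrite -big_distrr /= exprS.
  have geo m : \sum_(g <- iota 0 m) q ^+ g <= (1 - q)^-1.
    have -> : \sum_(g <- iota 0 m) q ^+ g = (1 - q ^+ m) / (1 - q).
      elim: m => [|m IHm]; first by rewrite big_nil expr0 subrr mul0r.
      rewrite -addn1 iotaD big_cat big_seq1 add0n IHm addn1 exprS /=.
      by field; rewrite gt_eqF.
    by rewrite ler_pdivrMr // mulVf ?gt_eqF // gerBl exprn_ge0 // ltW.
  have c0 : 0 <= K ^+ r * expR (d * n%:R).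
    by rewrite mulr_ge0 ?exprn_ge0 ?expR_ge0 // (le_trans ler01).
  have := ler_wpM2l c0 (ler_wpM2l (ltW K00) (geo n.+1)); rewrite /K; set c := K ^+ r * _ in c0 *.
  have -> : K0 * K ^+ r * expR (d * n%:R) = c * K0 by rewrite /c; ring.
  have -> : (K0 / (1 - q) + 1) * K ^+ r * expR (d * n%:R) = c * (K0 / (1 - q)) + c.
    by rewrite /c; ring.
  by rewrite mulrA; set S := \sum_(_ <- _) _; lra.
move=> w [g [m [b [w' [nE bP w'P ->]]]]]; apply/flattenP.
exists [seq (b * w)%g | b <- B g, w <- D (n - g)%N].
  by apply: (map_f (fun g => [seq (b * w)%g | b <- B g, w <- D (n - g)%N])); rewrite mem_iota; lia.
by apply: allpairs_f; [exact: (BP g).2|rewrite nE addKn; exact: (DP m).2].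
Qed.

Hypothesis tors : forall x, x \in s -> exists m, (0 < m)%N /\ (wtop x ^+ m = 1)%g.
Hypothesis planar : polynomial_spheres act 1.

Lemma fresh_count_sublinear : sublinear (fun n => pexp s p n (fun l => (fresh_count l)%:R)).
Proof.
pose f n := pexp s p n (fun l => (fresh l)%:R).
have rec n : pexp s p n (fun l => (fresh_count l)%:R) = 1 + \sum_(i < n) f i.+1.
  elim: n => [|n IHn]; first by rewrite big_ord0 addr0.
  rewrite [in RHS]big_ord_recr [RHS]/= addrA -IHn.
  transitivity (pexp s p n.+1 (fun l => (fresh_count (behead l))%:R + (fresh l)%:R)).
    by apply: eq_pexp => -[|x l] // _ _; rewrite addrC -natrD.
  by rewrite pexpD; congr (_ + _); rewrite /= -mulr_suml p1 mul1r.
have f1 n : f n <= 1.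
  by rewrite -[leRHS](pexp_cst p1 n); apply: le_pexp => // l _ _; rewrite lern1 leq_b1.
have fsmall (e : R) : 0 < e -> exists N, forall n, (N <= n)%N -> f n <= e.
  move=> e0; have e'0 : 0 < e / (size Z).+1%:R by rewrite divr_gt0.
  have fle n : f n <= \sum_(z <- Z) escape s p act (@wtop A H Y act) z n.
    rewrite -pexp_sum; apply: le_pexp => // l _ _; rewrite -natr_sum ler_nat /fresh.
    by elim: (Z) => [|z Z' IHZ] /=; rewrite ?big_nil // big_cons; case: noreturn.
  have [N NP] : {N : Y -> nat & forall z n, (N z <= n)%N ->
      escape s p act (@wtop A H Y act) z n <= e / (size Z).+1%:R}.
    apply: (@choice _ _ (fun z N => forall n, (N <= n)%N ->
      escape s p act (@wtop A H Y act) z n <= e / (size Z).+1%:R)) => z.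
    exact: escape_small.
  exists (\max_(z <- Z) N z) => n Nn; apply: le_trans (fle n) _.
  apply: (@le_trans _ _ (\sum_(z <- Z) e / (size Z).+1%:R)).
    rewrite !big_seq; apply: ler_sum => z zZ; apply: NP; apply: leq_trans Nn.
    by rewrite (big_rem z) //= leq_maxl.
  rewrite big_const_seq count_predT iter_addr addr0 -[_ *+ size Z]mulr_natr mulrAC ler_pdivrMr ?ltr0n //.
  by apply: ler_wpM2l; [exact: ltW|rewrite ler_nat].
move=> e e0; have e20 : 0 < e / 2 by rewrite divr_gt0.
have [N NP] := fsmall _ e20.
exists (Num.truncn (2 * (N.+1)%:R / e)).+1 => n nlarge; rewrite rec.
have bound m : \sum_(i < m) f i.+1 <= N%:R + e / 2 * m%:R.
  elim: m => [|m IHm]; first by rewrite big_ord0 mulr0 addr0.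
  rewrite big_ord_recr /= -[m.+1%:R]natr1; have [Nm|mN] := leqP N m.+1.
    by have := NP _ Nm; lra.
  have : \sum_(i < m) f i.+1 <= m%:R.
    rewrite -[m in leRHS]card_ord -sumr_const; apply: ler_sum => i _; exact: f1.
  have := f1 m.+1; have : m%:R + 1 <= N%:R :> R by rewrite natr1 ler_nat; lia.
  have : 0 <= e / 2 * (m%:R + 1) by rewrite mulr_ge0 ?ltW // addr_ge0.
  by lra.
have := bound n; have : 2 * N.+1%:R / e <= n%:R.
  by apply/ltW/(lt_le_trans (truncnS_gt _)); rewrite ler_nat.
by rewrite ler_pdivrMr // -[N.+1%:R]natr1; lra.
Qed.

Lemma fresh_count_bounds l : (0 < fresh_count l <= (size l).+1)%N.
Proof. by elim: l => //= x l; case: fresh => /=; lia. Qed.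

(** An element that is a product of [r] blocks of total length [n] gets the weight
    [(2 * K) ^- r * expR (- (e / 2 * n))]. By [block_product_cover] these weights satisfy
    Kraft's inequality, and the corresponding code length is small because [r] is. *)
Lemma wreath_zero_entropy : sublinear (entropy s p).
Proof.
move=> e e0; have d0 : 0 < e / 2 by rewrite divr_gt0.
have [K K1 KP] := block_product_cover d0.
have K0 : 0 < K by exact: lt_le_trans K1.
have lnK : 0 < ln (2 * K) by rewrite ln_gt0 //; lra.
have [N NP] := fresh_count_sublinear (divr_gt0 d0 lnK).
exists N => n /NP freshn.
have [D DP] := choice (fun r => KP r n).
pose wt r : R := (2 * K) ^- r * expR (- (e / 2 * n%:R)).
have wt0 r : 0 < wt r by rewrite mulr_gt0 ?expR_gt0 // invr_gt0 exprn_gt0 // mulr_gt0.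
pose c w : R := \sum_(r < n.+1) wt r.+1 * (w \in D r.+1)%:R.
have cpath l : size l = n -> {subset l <= s} -> wt (fresh_count l) <= c (\prod_(x <- l) x)%g.
  move=> ln ls; have := path_block_product ls; have := fresh_count_bounds l.
  case: fresh_count => // r; rewrite ln /= ltnS => rn bp.
  have lt : (r < n.+1)%N by [].
  rewrite /c (bigD1 (Ordinal lt)) //= (DP r.+1).2 // mulr1 lerDl.
  by apply: sumr_ge0 => i _; rewrite mulr_ge0 // ltW.
apply: le_trans (entropy_le_code p0 p1 ps (c := c) _ _) _.
- move=> g; rewrite mem_undup => /mapP[l /mem_paths[ln ls] ->].
  exact: lt_le_trans (cpath l ln ls).
- rewrite exchange_big /=.
  apply: (@le_trans _ _ (\sum_(r < n.+1) 2^-1 ^+ r.+1)).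
    apply: ler_sum => r _; rewrite -big_distrr /= -natr_sum.
    apply: (@le_trans _ _ (wt r.+1 * (K ^+ r.+1 * expR (e / 2 * n%:R)))).
      rewrite ler_pM2l //; apply: le_trans (DP r.+1).1; rewrite ler_nat.
      apply: leq_trans (_ : size [seq g <- psupp s n | g \in D r.+1] <= _)%N.
        by rewrite size_filter -sum1_count [leqRHS]big_mkcond /=; apply: leq_sum => g _; case: ifP.
      apply: uniq_leq_size; first by rewrite filter_uniq // undup_uniq.
      by move=> g; rewrite mem_filter => /andP[].
    rewrite /wt exprMn invfM expRN exprVn; set x := expR _.
    have x0 : x != 0 by rewrite gt_eqF // expR_gt0.
    have Kr : K ^+ r.+1 != 0 by rewrite gt_eqF // exprn_gt0.
    rewrite le_eqVlt; apply/orP; left; apply/eqP.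
    by field; rewrite x0 Kr expf_neq0.
  have -> : \sum_(r < n.+1) 2^-1 ^+ r.+1 = 1 - 2^-1 ^+ n.+1 :> R.
    elim: (n) => [|m IHm]; first by rewrite big_ord_recl big_ord0; field.
    by rewrite big_ord_recr /= IHm ![_ ^+ m.+2]exprS; set x := _ ^+ m.+1; lra.
  by rewrite gerBl exprn_ge0 // invr_ge0.
apply: (@le_trans _ _ (pexp s p n (fun l => ln (2 * K) * (fresh_count l)%:R + e / 2 * n%:R))).
  apply: le_pexp => // l lsz ls; have := cpath l lsz ls; set r := fresh_count l => wc.
  have c0 := lt_le_trans (wt0 r) wc.
  rewrite lerNl; move: wc; rewrite -ler_ln ?posrE // => /(le_trans _); apply.
  rewrite /wt [ln (_ * expR _)]lnM ?posrE ?expR_gt0 ?invr_gt0 ?exprn_gt0 ?mulr_gt0 // expRK.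
  rewrite lnV ?posrE ?exprn_gt0 ?mulr_gt0 // lnXn ?mulr_gt0 // -[_ *+ r]mulr_natr.
  by lra.
rewrite pexpD pexpZ pexp_cst //.
have := ler_wpM2l (ltW lnK) freshn.
have -> : ln (2 * K) * (e / 2 / ln (2 * K) * n%:R) = e / 2 * n%:R by field; rewrite gt_eqF.
by lra.
Qed.
End WreathWalk.

(** * Trivial boundary *)

Section Trajectories.
Variables (R : realType) (H : groupType).
Local Notation T := (trajectories H).

Lemma measurable_coordinate n (B : set H) : measurable ([set x | B (x n)] : set T).
Proof. by apply: sub_sigma_algebra; exists n, B. Qed.

Definition rectangle n (B : nat -> set H) : set T :=
  [set x | forall i, (i <= n)%N -> B i (x i)].

Lemma measurable_rectangle n B : measurable (rectangle n B).
Proof.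
have -> : rectangle n B = \bigcap_(i in [set i | (i <= n)%N]) [set x | B i (x i)] by [].
by apply: bigcap_measurableType => i _; exact: measurable_coordinate.
Qed.

Lemma measure_fibres (m : {measure set T -> \bar R}) (I : eqType) (X : T -> I)
    (D : seq I) (E : set T) : uniq D ->
  (forall d, measurable (E `&` [set x | X x = d])) ->
  measurable (E `&` [set x | X x \in D]) /\
  m (E `&` [set x | X x \in D]) = (\sum_(d <- D) m (E `&` [set x | X x = d]))%E.
Proof.
move=> uD mE; elim: D uD => [_|d D IHD /= /andP[dD /IHD[mD mDE]]].
  have -> : E `&` [set x | X x \in [::]] = set0 by apply/seteqP; split=> x [].
  by rewrite measure0 big_nil; split.
have -> : E `&` [set x | X x \in d :: D] =
    (E `&` [set x | X x = d]) `|` (E `&` [set x | X x \in D]).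
  apply/seteqP; split=> x /=; rewrite inE.
    by case=> Ex /orP[/eqP|]; [left|right].
  by case=> [[Ex ->]|[Ex ->]]; rewrite ?eqxx ?orbT.
split; first exact: measurableU.
rewrite big_cons -mDE measureU //; apply/seteqP; split=> x //= [[_ ->] [_]].
by rewrite (negPf dD).
Qed.

Lemma measure_conull (m : {measure set T -> \bar R}) (E C : set T) : measurable E ->
  measurable C -> m (~` C) = 0%E -> m (E `&` C) = m E.
Proof.
move=> mE mC C0; rewrite -[in RHS](setUIDK E C) measureU0 //.
- exact: measurableI.
- exact: measurableD.
by apply: (subset_measure0 (measurableD mE mC) (measurableC mC)) => // x [].
Qed.

(** Where a trajectory is at each time is, up to a null set, one of finitely many
    elements, so a rectangle is a finite union of cylinders up to a null set. *)
Lemma cylinder_measure_unique (m1 m2 : {measure set T -> \bar R}) (D : nat -> seq H) :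
  (forall i, m1 [set x | x i \notin D i] = 0%E) ->
  (forall i, m2 [set x | x i \notin D i] = 0%E) ->
  (forall n g, m1 (rectangle n (fun i => [set g i])) = m2 (rectangle n (fun i => [set g i]))) ->
  (m1 setT < +oo)%E -> forall E : set T, measurable E -> m1 E = m2 E.
Proof.
move=> D1 D2 m12 fin1.
have split_at (m : {measure set T -> \bar R}) k E : m [set x | x k \notin D k] = 0%E ->
    measurable E ->
    m E = (\sum_(d <- undup (D k)) m (E `&` [set x | x k = d]))%E.
  move=> mD mE; have mEk d : measurable (E `&` [set x : T | x k = d]).
    by apply: measurableI => //; exact: (measurable_coordinate k [set d]).
  have [mED <-] := measure_fibres m (undup_uniq (D k)) mEk.
  apply/esym/measure_conull => //.
    exact: (measurable_coordinate k [set d | d \in undup (D k)]).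
  rewrite -mD; congr (m _); apply/seteqP.
  by split=> x /=; rewrite mem_undup => /negP.
have rect n k B : (forall i, (k <= i <= n)%N -> exists g, B i = [set g]) ->
    m1 (rectangle n B) = m2 (rectangle n B).
  have eq_rect B1 B2 : (forall i, (i <= n)%N -> B1 i = B2 i) -> rectangle n B1 = rectangle n B2.
    by move=> B12; apply/seteqP; split=> x xB i lin; move: (xB i lin); rewrite B12.
  elim: k B => [|k IHk] B Bk.
    have /choice[g gB] : forall i, exists g, (i <= n)%N -> B i = [set g].
      move=> i; have [lin|] := boolP (i <= n)%N; last by exists 1%g.
      by have [g ->] := Bk i lin; exists g.
    by rewrite (eq_rect B _ gB).
  have [nk|kn] := ltnP n k; first by apply: IHk => i; lia.
  rewrite (split_at m1 k) // 1?(split_at m2 k) //; try exact: measurable_rectangle.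
  apply: eq_bigr => d _; have [Bd|Bd] := pselect (B k d); last first.
    have -> : rectangle n B `&` [set x | x k = d] = set0; last by rewrite !measure0.
    by apply/seteqP; split=> x //= [/(_ k kn) + xk]; rewrite xk.
  have -> : rectangle n B `&` [set x | x k = d] =
      rectangle n (fun i => if i == k then [set d] else B i).
    apply/seteqP; split=> x /=.
      by case=> xB xk i lin; case: eqP => [->|_] //; exact: xB.
    move=> xB; have := xB k kn; rewrite eqxx => xk; split=> // i lin.
    by have := xB i lin; case: eqP => // -> /= ->.
  apply: IHk => i ikn; case: eqP => [_|/eqP ik]; first by exists d.
  by apply: Bk; lia.
pose G : set (set T) := [set E | exists n B, E = rectangle n B].
have GI : setI_closed G.
  move=> _ _ [n1 [B1 ->]] [n2 [B2 ->]]; exists (maxn n1 n2), (fun i => [set y |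
    ((i <= n1)%N -> B1 i y) /\ ((i <= n2)%N -> B2 i y)]).
  apply/seteqP; split=> x /=; first by case=> x1 x2 i _; split; [exact: x1|exact: x2].
  by move=> x12; split=> i li; apply: (x12 i _).1 || apply: (x12 i _).2; rewrite // leq_max li ?orbT.
have GT (k : nat) : G [set: T] by exists 0%N, (fun=> setT); apply/seteqP; split.
have Gm : G `<=` measurable by move=> _ [n [B ->]]; exact: measurable_rectangle.
have Gcover : \bigcup_k (fun _ : nat => [set: T]) k = [set: T].
  by apply/seteqP; split=> // x _; exists 0%N.
have m12G F : G F -> m1 F = m2 F.
  by move=> [n [B ->]]; apply: (rect n n.+1) => i; lia.
move=> E mE; apply: (g_sigma_algebra_measure_unique G Gm (fun=> setT) GT Gcover m1 m2 GI m12G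
  (fun=> fin1)).
apply: sub_sigma_algebra2 mE => _ [n [B ->]].
exists n, (fun i => if i == n then B else setT); apply/seteqP; split=> x /=.
  by move=> xB i _; case: eqP => // ->.
by move/(_ n (leqnn n)); rewrite eqxx.
Qed.
End Trajectories.

Section TrivialBoundary.
Variables (R : realType) (H : groupType) (s : seq H) (p : H -> R).
Hypotheses (p0 : forall x, 0 <= p x) (p1 : \sum_(x <- s) p x = 1).
Hypotheses (ps : forall x, x \in s -> 0 < p x) (ps0 : forall x, x \notin s -> p x = 0).
Hypothesis us : uniq s.
Hypothesis zero_entropy : sublinear (entropy s p).
Local Notation T := (trajectories H).
Variable P : probability T R.
Hypothesis lawP : walk_law p P.

Definition increments n (x : T) : seq H := [seq ((x i)^-1 * x i.+1)%g | i <- iota 0 n].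

Lemma prod_increments n (x : T) : x 0%N = 1%g -> (\prod_(h <- increments n x) h)%g = x n.
Proof.
move=> x0; rewrite big_map; elim: n => [|n IHn]; first by rewrite big_nil x0.
by rewrite -addn1 iotaD big_cat /= IHn big_seq1 mulVKg addn1.
Qed.

Lemma uniq_paths n : uniq (paths s n).
Proof.
elim: n => //= n IHn; apply: allpairs_uniq => //.
by case=> [x1 l1] [x2 l2] _ _ [-> ->].
Qed.

Lemma paths_mass n : \sum_(l <- paths s n) \prod_(x <- l) p x = 1.
Proof.
elim: n => [|n IHn] /=; first by rewrite big_seq1 big_nil.
rewrite big_allpairs_dep -[RHS]p1; apply: eq_bigr => x _.
by under eq_bigr do rewrite big_cons; rewrite -big_distrr /= IHn mulr1.
Qed.

Lemma increments_cylinder n l : size l = n ->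
  [set x : T | x 0%N = 1%g] `&` [set x | increments n x = l] =
  rectangle n (fun i => [set (\prod_(h <- take i l) h)%g]).
Proof.
move=> ln; apply/seteqP; split=> x /=.
  case=> x0 xl i lin; rewrite -xl /increments -map_take take_iota (minn_idPl lin).
  by rewrite prod_increments.
move=> xl; have x0 : x 0%N = 1%g by rewrite xl // take0 big_nil.
split=> //; apply: (@eq_from_nth _ 1%g); rewrite size_map size_iota // => i lin.
rewrite (nth_map 0%N) ?size_iota // nth_iota // xl ?(ltnW lin) // xl //.
by rewrite (take_nth 1%g) ?ln // -cats1 big_cat big_seq1 mulKg.
Qed.

Lemma law_increments n l : size l = n ->
  P ([set x : T | x 0%N = 1%g] `&` [set x | increments n x = l]) =
  (\prod_(h <- l) p h)%:E.
Proof.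
move=> ln; rewrite increments_cylinder // lawP take0 big_nil eqxx mul1r.
rewrite (big_nth 1%g) ln big_mkord; congr EFin; apply: eq_bigr => i _.
by rewrite (take_nth 1%g) ?ln // -cats1 big_cat big_seq1 mulKg.
Qed.

(** The cylinders over the paths with steps in [s] carry the whole mass. *)
Lemma law_psupp n (D : seq H) : {subset psupp s n <= D} -> P [set x | x n \notin D] = 0%E.
Proof.
move=> sD; have mD : measurable ([set x | x n \in D] : set T).
  exact: (measurable_coordinate n [set d | d \in D]).
have mfib l : measurable ([set x : T | x 0%N = 1%g] `&` [set x | increments n x = l]).
  have [ln|ln] := eqVneq (size l) n.
    by rewrite increments_cylinder //; exact: measurable_rectangle.
  rewrite (_ : _ `&` _ = set0) //; apply/seteqP; split=> x //= [_ xl].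
  by move: ln; rewrite -xl size_map size_iota eqxx.
have [mE PE] := measure_fibres P (uniq_paths n) mfib.
have PE1 : P ([set x : T | x 0%N = 1%g] `&` [set x | increments n x \in paths s n]) = 1%E.
  rewrite PE -(paths_mass n) -sumEFin !big_seq; apply: eq_bigr => l /mem_paths[ln _].
  exact: law_increments.
have -> : [set x : T | x n \notin D] = ~` [set x | x n \in D].
  by apply/seteqP; split=> x /= /negP.
rewrite probability_setC // [P _](_ : _ = 1%E) ?subee //; apply/eqP.
rewrite eq_le probability_le1 //= -PE1; apply: le_measure; rewrite ?inE //.
move=> x /= [x0 /mem_paths[sx xs]]; apply: sD; rewrite -(prod_increments n x0).
exact: psuppP.
Qed.

Definition advance n h (x : T) : T := fun i => (h * x (n + i)%N)%g.

Lemma advance1 x : advance 0 1%g x = x.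
Proof. by apply/funext => i; rewrite /advance mul1g. Qed.

Lemma advanceM h y x : advance 0 h (advance 0 y x) = advance 0 (h * y)%g x.
Proof. by apply/funext => i; rewrite /advance mulgA. Qed.

Lemma measurable_advance n h : measurable_fun setT (advance n h).
Proof.
apply: (measurability (rT := T) (aT := T) (@path_events H)) => //.
move=> _ [_ [m [B ->]] <-]; rewrite setTI.
exact: (measurable_coordinate (n + m) [set y | B (h * y)%g]).
Qed.

Lemma measurable_advance_preimage n h E : measurable E -> measurable (advance n h @^-1` E).
Proof.
by move=> mE; rewrite -[X in measurable X]setTI; exact: measurable_advance.
Qed.

Definition cylinder n (g : nat -> H) : set T := rectangle n (fun i => [set g i]).

(** Both sides are finite measures in [E], and they agree on cylinders. *)
Lemma markov_property n g (E : set T) : measurable E ->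
  P (cylinder n g `&` advance n 1%g @^-1` E) =
  (P (cylinder n g) * P (advance 0 (g n) @^-1` E))%E.
Proof.
move=> mE; have mC : measurable (cylinder n g) by exact: measurable_rectangle.
pose r := (g 0%N == 1%g)%:R * \prod_(i < n) p ((g i)^-1 * g i.+1)%g.
have r0 : 0 <= r by rewrite mulr_ge0 // prodr_ge0.
have rE : P (cylinder n g) = r%:E by exact: lawP.
pose m1 : {measure set T -> \bar R} :=
  measure_function_pushforward__canonical__measure_function_Measure
    (mrestr P mC) (measurable_advance n 1%g).
pose m2 : {measure set T -> \bar R} := mscale (NngNum r0)
  (measure_function_pushforward__canonical__measure_function_Measure
    P (measurable_advance 0 (g n))).
have m1E F : m1 F = P (advance n 1%g @^-1` F `&` cylinder n g) by [].
have m2E F : m2 F = (r%:E * P (advance 0 (g n) @^-1` F))%E by [].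
pose D i := psupp s (n + i) ++ [seq (g n * h)%g | h <- psupp s i].
rewrite rE setIC -m1E -m2E; apply: (@cylinder_measure_unique _ _ m1 m2 D) => //.
- move=> i; rewrite m1E.
  apply: (@subset_measure0 _ _ _ P _ [set x | (x (n + i)%N) \notin D i]).
  + apply: measurableI => //; apply: measurable_advance_preimage.
    exact: (measurable_coordinate i [set d | d \notin D i]).
  + exact: (measurable_coordinate (n + i) [set d | d \notin D i]).
  + by move=> x /= []; rewrite /advance mul1g.
  by apply: law_psupp => h hs; rewrite mem_cat hs.
- move=> i; rewrite m2E.
  rewrite (@subset_measure0 _ _ _ P _ [set x | x i \notin psupp s i]) ?mule0 //.
  + apply: measurable_advance_preimage.
    exact: (measurable_coordinate i [set d | d \notin D i]).
  + exact: (measurable_coordinate i [set d | d \notin psupp s i]).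
  + move=> x /=; apply: contra => xs; rewrite mem_cat; apply/orP; right.
    exact: map_f.
  exact: law_psupp.
- move=> k f; rewrite m1E m2E.
  have -> : advance 0 (g n) @^-1` rectangle k (fun i => [set f i]) =
      cylinder k (fun i => (g n)^-1 * f i)%g.
    apply/seteqP; split=> x xf i ik; have := xf i ik; rewrite /advance add0n /=.
      by move=> <-; rewrite mulKg.
    by move=> ->; rewrite mulVKg.
  rewrite [X in (_ * X)%E]lawP -EFinM /=.
  have -> : ((g n)^-1 * f 0%N == 1)%g = (g n == f 0%N).
    by apply/eqP/eqP => [/(congr1 (mulg (g n)))|->]; rewrite ?mulVg // mulVKg mulg1.
  have [gf|gf] := eqVneq (g n) (f 0%N); last first.
    rewrite (_ : _ `&` _ = set0) ?measure0 ?mul0r ?mulr0 //.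
    apply/seteqP; split=> x //= [xf xg]; move: gf; rewrite -(xg n) //.
    by have := xf 0%N isT; rewrite /advance mul1g addn0 => ->; rewrite eqxx.
  have -> : advance n 1%g @^-1` rectangle k (fun i => [set f i]) `&` cylinder n g =
      cylinder (n + k) (fun i => if (i <= n)%N then g i else f (i - n)%N).
    apply/seteqP; split=> x /=.
      move=> [xf xg] i ink; case: leqP => [|ni]; first exact: xg.
      by have := xf (i - n)%N; rewrite /advance mul1g subnKC ?(ltnW ni) //; apply; lia.
    move=> xh; split=> i li; last by have := xh i; rewrite li; apply; lia.
    rewrite /advance mul1g /= xh ?leq_add2l //; case: leqP => [ni|_]; last by rewrite addKn.
    by have -> : i = 0%N by [lia]; rewrite addn0.
  rewrite lawP big_split_ord mul1r mulrA; congr (_ * _)%:E.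
    congr (_ * _); apply: eq_bigr => i _ /=.
    by rewrite (ltnW (ltn_ord i)) ltn_ord.
  apply: eq_bigr => i _ /=; rewrite addKn subSn ?leq_addr // addKn ltnNge leq_addr /=.
  rewrite invMg invgK mulgA mulgK; case: leqP => // ni.
  by have -> : i = 0%N :> nat by [lia]; rewrite addn0 gf.
rewrite m1E preimage_setT setTI; exact: le_lt_trans (probability_le1 P mC) (ltry 1).
Qed.

Lemma saturated_advance n (E : set T) : saturated E -> forall x, E x <-> E (advance n 1%g x).
Proof.
move=> satE x; split; apply: satE; [exists n, (- n%:Z)|exists 0%N, n%:Z] => i j le ij.
  rewrite /advance mul1g; congr x; lia.
rewrite /advance mul1g; congr x; lia.
Qed.

Lemma saturated_translate h (E : set T) : saturated E -> saturated (advance 0 h @^-1` E).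
Proof.
move=> satE x y [N [k xy]] /=; apply: satE; exists N, k => n m Nn mn.
by rewrite /advance !add0n (xy n m).
Qed.

Lemma saturated_cylinder n g (E : set T) : measurable E -> saturated E ->
  P (cylinder n g `&` E) = (P (cylinder n g) * P (advance 0 (g n) @^-1` E))%E.
Proof.
move=> mE satE; rewrite -markov_property //; congr (P (_ `&` _)).
by apply/seteqP; split=> x; have [advE Eadv] := saturated_advance n satE x.
Qed.

Lemma invariant_harmonic (E : set T) h : measurable E -> saturated E ->
  fine (P (advance 0 h @^-1` E)) =
  \sum_(y <- s) p y * fine (P (advance 0 (h * y)%g @^-1` E)).
Proof.
move=> mE satE; set E' := advance 0 h @^-1` E.
have mE' : measurable E' by exact: measurable_advance_preimage.
have satE' : saturated E' by exact: saturated_translate.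
pose g y i : H := if i is 0%N then 1%g else y.
have fibE y : E' `&` [set x : T | x 0%N = 1%g] `&` [set x | x 1%N = y] = cylinder 1 (g y) `&` E'.
  apply/seteqP; split=> x /=; last by case=> xg; split; [split|]; rewrite // (xg 0%N, xg 1%N).
  by case=> [[Ex x0] x1]; split=> // -[|[|i]].
have m0 : measurable ([set x | x 0%N = 1%g] : set T).
  exact: (measurable_coordinate 0 [set 1%g]).
have mfib y : measurable (E' `&` [set x : T | x 0%N = 1%g] `&` [set x | x 1%N = y]).
  by rewrite fibE; apply: measurableI => //; exact: measurable_rectangle.
have [_ /=] := measure_fibres P us mfib.
have conull n (D : seq H) : {subset psupp s n <= D} -> P (~` [set x | x n \in D]) = 0%E.
  move=> sD; rewrite -(law_psupp sD); congr (P _).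
  by apply/seteqP; split=> x /= /negP.
have -> : P (E' `&` [set x | x 0%N = 1%g] `&` [set x | x 1%N \in s]) = P E'.
  rewrite measure_conull.
  - apply: measure_conull => //.
    have -> : [set x : T | x 0%N = 1%g] = [set x | x 0%N \in [:: 1%g]].
      by apply/seteqP; split=> x /=; rewrite inE => /eqP.
    by apply: conull => y; rewrite mem_undup /= big_nil.
  - exact: measurableI.
  - exact: (measurable_coordinate 1 [set d | d \in s]).
  apply: conull => y; rewrite mem_undup => /mapP[l /mem_paths[]].
  case: l => [|z [|? ?]] //= _ ls ->; rewrite big_seq1; apply: ls; exact: mem_head.
move=> PE; rewrite PE.
transitivity (fine (\sum_(y <- s) (p y * fine (P (advance 0 (h * y)%g @^-1` E)))%:E)%E);
  last by rewrite sumEFin.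
congr fine; apply: eq_bigr => y _.
rewrite fibE saturated_cylinder // lawP big_ord1 /= invg1 mul1g eqxx mul1r EFinM.
rewrite fineK; last by apply: fin_num_measure; exact: measurable_advance_preimage.
congr (_ * P _)%E.
by apply/seteqP; split=> x; rewrite /E' /= advanceM.
Qed.

(** The probability of [E] for the walk started at [h] is a harmonic function of [h],
    hence constant along the walk. So [E] is independent of every cylinder, and then of
    itself. *)
Lemma saturated_zero_one (E : set T) : measurable E -> saturated E -> P E = 0%E \/ P E = 1%E.
Proof.
move=> mE satE; pose F h := fine (P (advance 0 h @^-1` E)).
have mA h : measurable (advance 0 h @^-1` E) by exact: measurable_advance_preimage.
have PF h : P (advance 0 h @^-1` E) = (F h)%:E by rewrite fineK // fin_num_measure.
have F01 h : 0 <= F h <= 1.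
  by rewrite -!lee_fin -PF measure_ge0 probability_le1.
have F1E : P E = (F 1%g)%:E.
  by rewrite -PF; congr (P _); apply/seteqP; split=> x; rewrite /= advance1.
have Fconst x g : x \in s -> F (g * x)%g = F g.
  apply: (bounded_harmonic_const p0 p1 ps zero_entropy (B := 1)).
    by move=> h; rewrite ger0_norm; have /andP[] := F01 h.
  by move=> h; exact: invariant_harmonic.
have cyl n g : P (cylinder n g `&` E) = (P (cylinder n g) * P E)%E.
  rewrite saturated_cylinder // F1E PF; have [-> //|] := eqVneq (P (cylinder n g)) 0%E.
    by rewrite !mul0e.
  rewrite lawP eqe mulf_eq0 negb_or => /andP[g0 gs]; congr (_ * _%:E)%E.
  have {}g0 : g 0%N = 1%g by move: g0; rewrite pnatr_eq0 eqb0 negbK => /eqP.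
  have {}gs i : (i < n)%N -> ((g i)^-1 * g i.+1)%g \in s.
    move=> lin; apply: contraTT isT => /ps0 gi; case/negP: gs.
    by rewrite (bigD1 (Ordinal lin)) //= gi mul0r.
  have Fg i : (i <= n)%N -> F (g i) = F 1%g.
    elim: i => [|i IHi] lin; first by rewrite g0.
    by rewrite -IHi ?(ltnW lin) // -(Fconst _ (g i) (gs _ lin)) mulVKg.
  exact: Fg.
have q0 : 0 <= F 1%g by have /andP[] := F01 1%g.
have sq : P E = (P E * P E)%E.
  pose m1 : {measure set T -> \bar R} := mrestr P mE.
  pose m2 : {measure set T -> \bar R} := mscale (NngNum q0) P.
  have m1E B : m1 B = P (B `&` E) by [].
  have m2E B : m2 B = (P E * P B)%E by rewrite F1E.
  rewrite -{1}(setIid E) -m1E -m2E; apply: (@cylinder_measure_unique _ _ m1 m2 (psupp s)) => //.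
  - move=> i; rewrite m1E; apply: (@subset_measure0 _ _ _ P _ [set x | x i \notin psupp s i]).
    + apply: measurableI => //.
      exact: (measurable_coordinate i [set d | d \notin psupp s i]).
    + exact: (measurable_coordinate i [set d | d \notin psupp s i]).
    + by move=> x [].
    exact: law_psupp.
  - by move=> i; rewrite m2E law_psupp ?mule0.
  - by move=> n g; rewrite m1E m2E muleC; exact: cyl.
  by rewrite m1E setTI; exact: le_lt_trans (probability_le1 P mE) (ltry 1).
move: sq; rewrite F1E -EFinM => -[/eqP]; rewrite -subr_eq0 -{1}[F 1%g]mulr1 -mulrBr mulf_eq0.
by case/orP=> [/eqP->|]; [left|rewrite subr_eq0 => /eqP <-; right].
Qed.
End TrivialBoundary.

(** * Laws with finite support *)

Section FiniteLaws.
Variables (R : realType) (H : groupType) (mu : H -> R).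

Lemma finsupp_seq : finsupp_probability mu -> exists s : seq H,
  [/\ uniq s, forall x, x \in s -> 0 < mu x, forall x, x \notin s -> mu x = 0
    & \sum_(x <- s) mu x = 1].
Proof.
case=> fin mu0 mu1; pose D := fset_set [set g | mu g <> 0]; exists D.
have DP x : x \in D = (mu x != 0).
  by rewrite in_fset_set //; apply/idP/idP => [/set_mem/eqP|/eqP/mem_set].
split=> [|x|x|]; rewrite ?DP ?fset_uniq // ?lt_neqAle ?mu0 ?andbT 1?eq_sym //.
  by rewrite negbK => /eqP.
by rewrite -mu1; apply/esym/fsbigTE => x; rewrite DP negbK => /eqP.
Qed.

Variable s : seq H.
Hypotheses (us : uniq s) (ps0 : forall x, x \notin s -> mu x = 0).
Hypothesis p1 : \sum_(x <- s) mu x = 1.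

Lemma fsbig_seq (D : seq H) (F : H -> R) : uniq D -> (forall x, x \notin D -> F x = 0) ->
  \sum_(x \in [set: H]) F x = \sum_(x <- D) F x.
Proof.
move=> uD FD; rewrite (fsbigTE [fset x in D]%fset); last first.
  by move=> x; rewrite inE; exact: FD.
by apply/perm_big/uniq_perm; rewrite ?fset_uniq // => x; rewrite inE.
Qed.

Lemma convolution_pow_pmf n g : convolution_pow mu n g = pmf s mu n g.
Proof.
elim: n g => [|n IHn] g; first by rewrite /pmf gexp0 eq_sym.
rewrite /convolution_pow iterS /convolution (fsbig_seq us); last first.
  by move=> x /ps0 ->; rewrite mul0r.
rewrite /pmf gexpS; apply: eq_bigr => x _; congr (_ * _).
rewrite -/(convolution_pow mu n) IHn; apply: eq_pexp => l _ _.
by rewrite -(inj_eq (mulgI x)) mulVKg.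
Qed.

Lemma mean_norm_gexp S n :
  mean_norm S (convolution_pow mu n) = gexp s mu n (fun g => (word_norm S g)%:R).
Proof.
have us' : uniq (psupp s n) by exact: undup_uniq.
rewrite (gexpE mu _ us') // /mean_norm (fsbig_seq us').
  by apply: eq_bigr => g _; rewrite convolution_pow_pmf.
move=> g gs; rewrite convolution_pow_pmf /pmf /gexp.
rewrite (@eq_pexp _ _ s mu n _ (fun=> 0)) ?(pexp_cst p1) ?mul0r // => l ln ls.
by case: eqP => // lg; move: gs; rewrite -lg psuppP.
Qed.
End FiniteLaws.

(** * Torsion *)

Lemma prod_torsion (H1 H2 : groupType) : torsion H1 -> torsion H2 ->
  torsion (H1 * H2)%type.
Proof.
move=> t1 t2 [g1 g2]; have [m [m0 g1m]] := t1 g1; have [n [n0 g2n]] := t2 g2.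
have expE k : (((g1, g2) : (H1 * H2)%type) ^+ k = (g1 ^+ k, g2 ^+ k) :> (H1 * H2)%type)%g.
  by elim: k => // k IHk; rewrite !expgS IHk.
exists (m * n)%N; rewrite muln_gt0 m0 n0 expE; split=> //.
by rewrite expgM g1m expg1n mulnC expgM g2n expg1n.
Qed.

(** The elements with trivial top form a restricted power of [A], whose exponent divides
    [#|A|]. *)
Lemma wreath_torsion (A : finGroupType) (H : groupType) (Y : Type) (act : right_action H Y) :
  torsion H -> torsion (wreath A act).
Proof.
move=> tH u; have [m [m0 um]] := tH (wtop u).
have topE k : wtop (u ^+ k)%g = (wtop u ^+ k)%g.
  by elim: k => // k IHk; rewrite !expgS -IHk.
exists (m * #|[set: A]%G|)%N; rewrite muln_gt0 m0 cardG_gt0 expgM; split=> //.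
set v := (u ^+ m)%g; have v1 : wtop v = 1%g by rewrite topE.
have vE k : wtop (v ^+ k)%g = 1%g /\ forall y, wbase (v ^+ k)%g y = (wbase v y ^+ k)%g.
  elim: k => [|k [IHt IHb]]; first by split.
  rewrite !expgS; split=> [|y]; first by rewrite /= v1 IHt mulg1.
  by rewrite /= v1 ract1 IHb expgS.
have [vt vb] := vE #|[set: A]%G|.
apply: wreathP => [y|] //; rewrite vb /=.
have /dvdnP[q ->] : (#[wbase v y]%g %| #|[set: A]%G|)%N by exact: cardSg (finset.subsetT _).
by rewrite mulnC expgM expg_order expg1n.
Qed.

Lemma common_support (A H : groupType) (Y : choiceType) (act : right_action H Y)
    (s : seq (wreath A act)) : exists Z : seq Y,
  forall x, x \in s -> forall y, y \notin Z -> wbase x y = 1%g.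
Proof.
elim: s => [|x s [Z ZP]]; first by exists [::].
have [Z1 Z1P] := (finite_seqP _).1 (fsfP (wbase x)).
exists (Z1 ++ Z) => x'; rewrite in_cons => /orP[/eqP->|/ZP x'Z] y; rewrite mem_cat negb_or.
  move=> /andP[yZ1 _]; apply: contrapT => xy.
  by move: yZ1; have : [set y | wbase x y <> 1%g] y by []; rewrite Z1P /= => ->.
by case/andP => _ /x'Z.
Qed.

Theorem corollary5p7 (R : realType) (omega : nat -> 'I_3) (x0 : boundary)
    (A : finGroupType) :
  torsion (grigorchuk omega) ->
  (1 < #|A|)%N ->
  let X := orbit_action (grig_action omega) x0 in
  let W := wreath A (prod_action X X) in
  [/\ exponential_word_growth R W,
      (forall mu : W -> R, finsupp_probability mu -> trivial_boundary mu)
    & (forall (S : set W) (mu : W -> R), finite_generating_set S ->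
         finsupp_probability mu -> has_drift S mu 0)].
Proof.
move=> tors A1 X W.
have tors2 := prod_torsion tors tors.
have rec := torsion_recurring tors.
have sub := prod_subexponential (R := R) (grigorchuk_subexponential rec)
  (grigorchuk_subexponential rec).
have orbit : polynomial_spheres X 0 by exact: grig_orbit_spheres.
have planar : polynomial_spheres (prod_action X X) 1 by exact: prod_spheres.
have zero_entropy (mu : W -> R) (s : seq W) : (forall x, 0 <= mu x) -> \sum_(x <- s) mu x = 1 ->
    (forall x, x \in s -> 0 < mu x) -> sublinear (entropy s mu).
  move=> mu0 mu1 mus; have [Z ZP] := common_support s.
  by apply: (wreath_zero_entropy mu0 mu1 mus ZP sub _ planar) => x _; exact: tors2.
split; first exact: exponential_growth.
  move=> mu fmu P lawP E mE satE; have mu0 : forall x, 0 <= mu x by case: fmu.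
  have [s [us mus smu mu1]] := finsupp_seq fmu.
  exact: (saturated_zero_one mu0 mu1 mus smu us (zero_entropy _ _ mu0 mu1 mus) lawP mE satE).
move=> S mu [_ genS] fmu; have mu0 : forall x, 0 <= mu x by case: fmu.
have [s [us mus smu mu1]] := finsupp_seq fmu.
rewrite /has_drift; under eq_fun do rewrite (mean_norm_gexp us smu mu1).
apply: (zero_drift mu0 mu1 mus (zero_entropy _ _ mu0 mu1 mus) genS) => x _.
exact: wreath_torsion.
Qed.
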